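(* Let $(R,\mathfrak m)$ be a Noetherian local ring of prime characteristic $p>0$ and Krull dimension $d$, and let $\hat R$ be its $\mathfrak m$-adic completion. If the dimension of the nilradical $N$ of $\hat R$ (as a module, i.e. $\dim \hat R/\operatorname{Ann}(N)$) is less than $d$, then for every $p$-family $I_\bullet$ of $\mathfrak m$-primary ideals of $R$ the limit \[\operatorname{vol}_R(I_\bullet)=\lim_{q\to\infty}\frac{\ell_R(R/I_q)}{q^d}\] exists and is finite. Conversely, if this limit exists for every $p$-family of $\mathfrak m$-primary ideals of $R$, then the dimension of the nilradical of $\hat R$ is less than $d$.
   Context: Throughout, $p>0$ is a prime and $q$ always denotes a power $p^e$ with $e\ge 0$; limits as $q\to\infty$ mean limits as $e\to\infty$. For an ideal $I$ of a ring of characteristic $p$, $I^{[q]}$ denotes the ideal generated by $\{x^q : x\in I\}$. A $p$-family of ideals in a ring $R$ of characteristic $p$ is a sequence $I_\bullet=\{I_q\}$ of ideals of $R$ indexed by the powers $q$ of $p$ such that $I_q^{[p]}\subseteq I_{pq}$ for every $q$. $\ell_R$ denotes length of $R$-modules. *)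

(* Defs.v *)
From HB Require Import structures.
From mathcomp Require Import all_boot all_order all_algebra.
Set Implicit Arguments. Unset Strict Implicit. Unset Printing Implicit Defensive.
Import GRing.Theory.
Local Open Scope ring_scope.

Section CommAlg.
Variable A : comNzRingType.

Definition is_ideal (I : A -> Prop) : Prop :=
  I 0 /\ (forall x y, I x -> I y -> I (x + y)) /\ (forall r x, I x -> I (r * x)).

Definition proper_ideal (I : A -> Prop) : Prop := is_ideal I /\ ~ I 1.

Definition is_prime (P : A -> Prop) : Prop :=
  proper_ideal P /\ (forall x y, P (x * y) -> P x \/ P y).

Definition strict_sub (I J : A -> Prop) : Prop :=
  (forall x, I x -> J x) /\ exists x, J x /\ ~ I x.

Definition noetherian : Prop :=
  forall I : nat -> (A -> Prop), (forall n, is_ideal (I n)) ->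
    (forall n x, I n x -> I n.+1 x) ->
    exists N : nat, forall (n : nat) x, (N <= n)%N -> I n x -> I N x.

Definition local_with_max (m : A -> Prop) : Prop :=
  proper_ideal m /\ forall I, proper_ideal I -> forall x, I x -> m x.

Definition prime_chain (P : nat -> (A -> Prop)) (n : nat) : Prop :=
  (forall i, (i <= n)%N -> is_prime (P i)) /\
  (forall i, (i < n)%N -> strict_sub (P i) (P i.+1)).

Definition krull_dim_eq (d : nat) : Prop :=
  (exists P, prime_chain P d) /\ ~ (exists P, prime_chain P d.+1).

Definition m_primary (m I : A -> Prop) : Prop :=
  proper_ideal I /\ forall x, m x <-> exists n, I (x ^+ n).

(* length of A/I: maximal length n of a strict chain of ideals
   I = J_0 < J_1 < ... < J_n = A (i.e. of submodules of A/I) *)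
Definition ideal_chain (I : A -> Prop) (J : nat -> (A -> Prop)) (n : nat) : Prop :=
  (forall i, (i <= n)%N -> is_ideal (J i)) /\
  (forall x, J 0%N x <-> I x) /\ (forall x, J n x) /\
  (forall i, (i < n)%N -> strict_sub (J i) (J i.+1)).

Definition colength_eq (I : A -> Prop) (n : nat) : Prop :=
  (exists J, ideal_chain I J n) /\ forall J k, ideal_chain I J k -> (k <= n)%N.

(* p-family indexed by the exponent e (q = p^e): I_q^[p] ⊆ I_(pq),
   equivalently x^p ∈ I_(pq) for all x ∈ I_q *)
Definition p_family (p : nat) (I : nat -> (A -> Prop)) : Prop :=
  (forall e, is_ideal (I e)) /\ (forall e x, I e x -> I e.+1 (x ^+ p)).

Inductive mpow (m : A -> Prop) : nat -> A -> Prop :=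
  | mpow0 : forall x, mpow m 0 x
  | mpow_zero : forall k, mpow m k.+1 0
  | mpow_mul : forall k a b, m a -> mpow m k b -> mpow m k.+1 (a * b)
  | mpow_add : forall k x y, mpow m k x -> mpow m k y -> mpow m k (x + y).

(* ---- m-adic completion, described by m-adic Cauchy sequences ---- *)
Definition cauchy (m : A -> Prop) (x : nat -> A) : Prop :=
  forall k, exists N, forall n n', (N <= n)%N -> (N <= n')%N -> mpow m k (x n - x n').

(* x represents 0 in the completion *)
Definition null_seq (m : A -> Prop) (x : nat -> A) : Prop :=
  forall k, exists N, forall n, (N <= n)%N -> mpow m k (x n).

Definition seq_eqv (m : A -> Prop) (x y : nat -> A) : Prop :=
  null_seq m (fun n => x n - y n).

Definition compl_nilpotent (m : A -> Prop) (x : nat -> A) : Prop :=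
  cauchy m x /\ exists e, null_seq m (fun n => x n ^+ e).

Definition compl_ann_nil (m : A -> Prop) (a : nat -> A) : Prop :=
  cauchy m a /\ forall x, compl_nilpotent m x -> null_seq m (fun n => a n * x n).

(* prime ideals of the completion, as predicates on Cauchy sequences that
   respect the equivalence *)
Definition compl_prime (m : A -> Prop) (P : (nat -> A) -> Prop) : Prop :=
  (forall x, P x -> cauchy m x) /\
  (forall x y, cauchy m y -> P x -> seq_eqv m x y -> P y) /\
  (forall x, cauchy m x -> null_seq m x -> P x) /\
  (forall x y, P x -> P y -> P (fun n => x n + y n)) /\
  (forall r x, cauchy m r -> P x -> P (fun n => r n * x n)) /\
  ~ P (fun _ => 1) /\
  (forall x y, cauchy m x -> cauchy m y -> P (fun n => x n * y n) -> P x \/ P y).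

Definition compl_strict_sub (P Q : (nat -> A) -> Prop) : Prop :=
  (forall x, P x -> Q x) /\ exists x, Q x /\ ~ P x.

(* dim of the nilradical of the completion, dim (Â / Ann N), is < d:
   no chain P_0 < ... < P_d of primes of Â containing Ann(N) *)
Definition compl_nil_dim_lt (m : A -> Prop) (d : nat) : Prop :=
  ~ exists P : nat -> ((nat -> A) -> Prop),
      (forall i, (i <= d)%N -> compl_prime m (P i) /\
                 forall a, compl_ann_nil m a -> P i a) /\
      (forall i, (i < d)%N -> compl_strict_sub (P i) (P i.+1)).

End CommAlg.

(* Main.v *)
Require Import Defs.
From Stdlib Require Import Reals.
From HB Require Import structures.
From mathcomp Require Import all_boot all_algebra.
From mathcomp Require Import boolp classical_sets functions.
From mathcomp Require Import zify ring.

Set Implicit Arguments.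
Unset Strict Implicit.
Unset Printing Implicit Defensive.

Import GRing.Theory.
Delimit Scope nat_scope with N.
Delimit Scope ring_scope with R.

(* Lengths do not change under completion, so work in the completion [B] of [A].

   If the nilradical has dimension [< d], then up to [O(q^(d-1))] the colength of an ideal
   containing [m^(Nq)] is the sum of its colengths in the complete local domains [B/T], where [T]
   runs over the primes of dimension [d].  In such a domain [R], the colength of [I^[p]] is at most
   [p^d] times that of [I], up to [O(q^(d-1))], so that along a p-family the sequence
   [colength / q^d] is decreasing up to a summable error.  This inequality needs no finiteness of
   Frobenius: with a p-basis of the residue field lifted to [X], [R] is finite over the closure [U]
   of the subring generated by [R^p] and [X] minus finitely many elements [e].  Lengths over [U]
   are [p^|e|] times those over [R], the generic rank of [R] over [U] is at most [p^(|e|+d)], and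
   [I^p U] has colength at most that of [I], with equality once [e] is large enough for the rank to
   be multiplied by [p] at each further enlargement of [e].

   Conversely, if a chain of primes [P_0 < ... < P_d] contains the annihilator of the nilradical,
   there is [w] with [w^2 = 0] and annihilator inside [P_0].  The p-families [m^q] and
   [m^q + (w)] have colengths differing by at least [eps q^d]; since [w^p = 0], alternating
   between them gives another p-family, and its limit does not exist. *)

(** * Quotient rings and subrings *)

Section QuotientRing.
Local Open Scope ring_scope.
Local Open Scope quotient_scope.

(** The obstacle is a residue field of infinite p-degree: [R] is then not finite over its p-th
    powers. Keeping all but finitely many elements [e] of the p-basis among the scalars makes [R]
    finite over [U], but with a rank not known beforehand. Two comparisons of [p^|e| *
    length(R/I^[p])] with [rank * length(U/I^p U)] determine enough. The upper one, for [I = m^n],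
    forces the rank to be at least [p^|e|], so enlargements of [e] that multiply the rank by at most
    [p - 1] cannot occur indefinitely. Past them [I -> I^p U] preserves strict inclusions, and the
    lower comparison, iterated along [n -> p(n+s)] against a Hilbert function of exact order [n^d],
    bounds the rank by [p^(|e|+d)]. The upper comparison for arbitrary [I] then gives the
    inequality, the factor [p^|e|] cancelling. Errors are always written [n * length <= C * n^d].
    This avoids the exponent [d - 1], hence a separate case [d = 0], and with [n = N0 q] it becomes
    an error [O(1/q)] after division by [q^d], which is summable. Two-sided bounds of order [n^d]
    replace Hilbert polynomials throughout. *)

Lemma quotient_ring_exists (A : comNzRingType) (I : A -> Prop) :
  Defs.proper_ideal I ->
  exists (B : comNzRingType) (f : {rmorphism A -> B}),
    (forall b, exists a, f a = b) /\ (forall x, f x = 0 <-> I x).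
Proof.
move=> [[I0 [hD hM]] I1]; pose I' : A -> bool := fun x => `[< I x >].
have hI' : idealr_closed I'.
  split=> [||a u v].
  - by rewrite unfold_in; apply/asboolP.
  - by rewrite unfold_in; apply/asboolP.
  rewrite !unfold_in => /asboolP Iu /asboolP Iv; apply/asboolP => /=.
  by apply: hD => //; apply: hM.
pose J : idealr A := HB.pack_for (idealr A) I'
  (GRing.isZmodClosed.Build A _ (idealr_closedB hI'))
  (isProperIdeal.Build A _ (idealr_closed_nontrivial hI')).
exists {ideal_quot J}.
pose f (x : A) : {ideal_quot J} := \pi x.
have fB : zmod_morphism f by move=> x y; rewrite /f !piE.
have fM : monoid_morphism f by split=> [|x y]; rewrite /f !piE.
pose fa := GRing.isZmodMorphism.Build _ _ f fB.
pose fm := GRing.isMonoidMorphism.Build _ _ f fM.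
pose F : {rmorphism A -> {ideal_quot J}} := HB.pack f fa fm.
exists F; split=> [b|x]; first by exists (repr b); rewrite /= /f reprK.
have -> : (F x = 0) <-> (x \in J).
  have e : (x \in J) = (f x == 0) :> bool.
    by rewrite /f -[0](rmorph0 F) /= /f -Quotient.idealrBE subr0.
  by rewrite e; split=> /eqP.
by rewrite unfold_in; split=> [/asboolP|h] //; apply/asboolP.
Qed.

Definition is_subring (C : comNzRingType) (S : C -> Prop) : Prop :=
  [/\ S 1, forall x y, S x -> S y -> S (x - y)
    & forall x y, S x -> S y -> S (x * y)].

Record subring_of (C : comNzRingType) := SubringOf {
  subring_carrier : C -> Prop;
  subring_carrierP : is_subring subring_carrier }.

Definition subring_pred (C : comNzRingType) (S : subring_of C) : C -> bool :=
  fun x => `[< subring_carrier S x >].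

Lemma subring_pred_closed (C : comNzRingType) (S : subring_of C) :
  subring_closed (subring_pred S).
Proof.
have [S1 SB SM] := subring_carrierP S; split=> [|x y|x y]; rewrite !unfold_in.
- exact/asboolP.
- by move=> /asboolP ? /asboolP ?; apply/asboolP; apply: SB.
- by move=> /asboolP ? /asboolP ?; apply/asboolP; apply: SM.
Qed.

HB.instance Definition _ (C : comNzRingType) (S : subring_of C) :=
  GRing.isSubringClosed.Build C (subring_pred S) (subring_pred_closed S).

Definition subring_type (C : comNzRingType) (S : subring_of C) :=
  {x : C | subring_pred S x}.

HB.instance Definition _ C S := SubChoice.on (@subring_type C S).
HB.instance Definition _ C S :=
  [SubChoice_isSubComNzRing of @subring_type C S by <:].

(** Two uses: the ring of Cauchy sequences inside all sequences, and polynomial division over a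
    subfield given only as a predicate. *)
Lemma subring_ring_exists (C : comNzRingType) (S : C -> Prop) :
  is_subring S ->
  exists (B : comNzRingType) (f : {rmorphism B -> C}),
    injective f /\ (forall x, S x <-> exists b, f b = x).
Proof.
move=> hS; pose T := SubringOf hS.
exists (@subring_type C T), (val : {rmorphism @subring_type C T -> C}).
split=> [|x]; first exact: val_inj.
split=> [Sx|[b <-]].
  have Tx : subring_pred T x by apply/asboolP.
  by exists (exist _ x Tx).
by case: b => b /= /asboolP.
Qed.

End QuotientRing.

Section PowersOfIdeal.
Local Open Scope ring_scope.
Variables (A : comNzRingType) (m : A -> Prop).
Hypothesis mI : is_ideal m.

Lemma mpow_is_ideal k : is_ideal (mpow m k).
Proof.
have mM : forall r x, m x -> m (r * x) by case: mI => _ [].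
split; first by case: k => [|k]; constructor.
split; first by move=> x y; apply: mpow_add.
move=> r x; elim=> {k x} [x|k|k a b ma mb IH|k x y _ hx _ hy].
- exact: mpow0.
- by rewrite mulr0; apply: mpow_zero.
- by rewrite mulrA; apply: mpow_mul => //; apply: mM.
- by rewrite mulrDr; apply: mpow_add.
Qed.

End PowersOfIdeal.

Lemma not_subP (T : Type) (B C : T -> Prop) :
  ~ (forall x, B x -> C x) -> exists x, B x /\ ~ C x.
Proof. by move/existsNP => [x /not_implyP]; exists x. Qed.

Lemma choice_ex (X Y : Type) (P : X -> Y -> Prop) :
  (forall x, exists y, P x y) -> exists f, forall x, P x (f x).
Proof. by move/choice => [f]; exists f. Qed.

(** * Lengths *)

Section Submodules.
Local Open Scope ring_scope.
Local Open Scope classical_set_scope.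
Variable R : comNzRingType.
Implicit Types (S N M K L : R -> Prop) (x y s : R).

(* Modules are additive subsets of a ring stable under a set of scalars [S]; all lengths below are lengths of quotients of such. *)
Definition smod S M : Prop :=
  M 0 /\ (forall x y, M x -> M y -> M (x + y)) /\
  (forall s x, S s -> M x -> M (s * x)).

Definition addm N M : R -> Prop := fun x => exists a b, [/\ N a, M b & x = a + b].
Definition capm N M : R -> Prop := fun x => N x /\ M x.
Definition cyc S y : R -> Prop := fun x => exists2 s, S s & x = s * y.
Definition ann S N y : R -> Prop := fun s => S s /\ N (s * y).

Fixpoint span S (gs : seq R) : R -> Prop :=
  if gs is g :: gs' then addm (cyc S g) (span S gs') else (fun x => x = 0).

Lemma smodT M : is_ideal M <-> smod setT M.
Proof.
by split=> [[h0 [hD hM]]|[h0 [hD hM]]]; split=> //; split=> // r x;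
  [move=> _; apply: hM | apply: hM].
Qed.

Lemma subring0 S : is_subring S -> S 0.
Proof. by case=> h1 hB _; rewrite -(subrr 1); apply: hB. Qed.

Lemma subringN S x : is_subring S -> S x -> S (- x).
Proof. by move=> hS Sx; rewrite -sub0r; case: (hS) => _ hB _; apply: hB => //; apply: subring0. Qed.

Lemma subringD S x y : is_subring S -> S x -> S y -> S (x + y).
Proof. by move=> hS Sx Sy; rewrite -[y]opprK; case: (hS) => _ hB _; apply: hB => //; apply: subringN. Qed.

Lemma subringM S x y : is_subring S -> S x -> S y -> S (x * y).
Proof. by case=> _ _; apply. Qed.

Lemma subring1 S : is_subring S -> S 1.
Proof. by case. Qed.

Lemma subringX S x n : is_subring S -> S x -> S (x ^+ n).
Proof.
move=> hS Sx; elim: n => [|n IH]; first by rewrite expr0; apply: subring1.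
by rewrite exprS; apply: subringM.
Qed.

Lemma subringT : is_subring (setT : set R).
Proof. by []. Qed.

Lemma smod_self S : is_subring S -> smod S S.
Proof.
move=> hS; split; first exact: subring0.
by split=> [x y|s x]; [apply: subringD | apply: subringM].
Qed.

Lemma smodN S M x : is_subring S -> smod S M -> M x -> M (- x).
Proof.
move=> hS [_ [_ hM]] Mx; rewrite -mulN1r; apply: hM => //.
by apply: subringN => //; apply: subring1.
Qed.

Lemma smodB S M x y : is_subring S -> smod S M -> M x -> M y -> M (x - y).
Proof. by move=> hS hM Mx My; case: (hM) => _ [hD _]; apply: hD => //; apply: (smodN hS hM). Qed.

Lemma smodD S M x y : smod S M -> M x -> M y -> M (x + y).
Proof. by case=> _ [hD _]; apply: hD. Qed.

Lemma smodM S M x y : smod S M -> S x -> M y -> M (x * y).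
Proof. by case=> _ [_]; apply. Qed.

Lemma smod0 S M : smod S M -> M 0.
Proof. by case. Qed.

Lemma smod_sum S M n (F : nat -> R) : smod S M -> (forall i, (i < n)%N -> M (F i)) ->
  M (\sum_(i < n) F i).
Proof.
move=> hM; elim: n => [|n IH] hF; first by rewrite big_ord0; apply: smod0 hM.
rewrite big_ord_recr /=; apply: (smodD hM); last exact: hF.
by apply: IH => i hi; apply: hF; apply: ltnW.
Qed.

Lemma smod_scal S S' M : S' `<=` S -> smod S M -> smod S' M.
Proof. by move=> hS [h0 [hD hM]]; split=> //; split=> // s x /hS; apply: hM. Qed.

Lemma smod_add S N M : smod S N -> smod S M -> smod S (addm N M).
Proof.
move=> hN hM; split; first by exists 0, 0; rewrite addr0; split=> //; [apply: smod0 hN | apply: smod0 hM].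
split=> [x y [a [b [Na Mb ->]]] [c [d [Nc Md ->]]]|s x Ss [a [b [Na Mb ->]]]].
  exists (a + c), (b + d); split; [exact: smodD hN _ _ | exact: smodD hM _ _ | by ring].
by exists (s * a), (s * b); split; [exact: smodM hN _ _ | exact: smodM hM _ _ | ring].
Qed.

Lemma smod_cap S N M : smod S N -> smod S M -> smod S (capm N M).
Proof.
move=> hN hM; split; first by split; [apply: smod0 hN | apply: smod0 hM].
split=> [x y [? ?] [? ?]|s x Ss [? ?]]; split.
- exact: smodD hN _ _.
- exact: smodD hM _ _.
- exact: smodM hN _ _.
- exact: smodM hM _ _.
Qed.

Lemma smod_ann S N y : is_subring S -> smod S N -> smod S (ann S N y).
Proof.
move=> hS hN; split; first by split; rewrite ?mul0r; [apply: subring0 | apply: smod0 hN].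
split=> [a b [Sa Na] [Sb Nb]|s a Ss [Sa Na]]; split.
- exact: subringD.
- by rewrite mulrDl; apply: smodD hN _ _.
- exact: subringM.
- by rewrite -mulrA; apply: smodM hN _ _.
Qed.

(* The scalars of a cyclic module or a span may be any additive set [J]; stability is then asserted under the ring [S] acting on [J]. *)
Lemma smod_cyc S J y : smod S J -> smod S (cyc J y).
Proof.
move=> hJ; split; first by exists 0; rewrite ?mul0r //; apply: smod0 hJ.
split=> [_ _ [a Ja ->] [b Jb ->]|s _ Ss [a Ja ->]].
  by exists (a + b); rewrite ?mulrDl //; apply: smodD hJ _ _.
by exists (s * a); rewrite ?mulrA //; apply: smodM hJ _ _.
Qed.

Lemma smod_span S J gs : smod S J -> smod S (span J gs).
Proof.
move=> hJ; elim: gs => [|g gs IH] /=; last by apply: smod_add => //; apply: smod_cyc.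
by split=> //; split=> [x y -> ->|s x _ ->]; rewrite ?addr0 ?mulr0.
Qed.

Lemma addmP1 S N M : smod S M -> N `<=` addm N M.
Proof. by move=> hM x Nx; exists x, 0; rewrite addr0; split=> //; apply: smod0 hM. Qed.

Lemma addmP2 S N M : smod S N -> M `<=` addm N M.
Proof. by move=> hN x Mx; exists 0, x; rewrite add0r; split=> //; apply: smod0 hN. Qed.

Lemma addm_sub S N M K : smod S K -> N `<=` K -> M `<=` K -> addm N M `<=` K.
Proof. by move=> hK hN hM _ [a [b [/hN Ka /hM Kb ->]]]; apply: smodD hK _ _. Qed.

Lemma addmS N M N' M' : N `<=` N' -> M `<=` M' -> addm N M `<=` addm N' M'.
Proof. by move=> h h' _ [a [b [/h Na /h' Mb ->]]]; exists a, b. Qed.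

Lemma addmC N M : addm N M = addm M N.
Proof. by apply/predeqP => x; split=> -[a [b [? ? ->]]]; exists b, a; rewrite addrC. Qed.

Lemma addmA N M K : addm N (addm M K) = addm (addm N M) K.
Proof.
apply/predeqP => x; split.
  move=> [a [_ [Na [b [c [Mb Kc ->]]] ->]]]; exists (a + b), c; rewrite addrA; split=> //.
  by exists a, b.
move=> [_ [c [[a [b [Na Mb ->]] Kc ->]]]]; exists a, (b + c); rewrite addrA; split=> //.
by exists b, c.
Qed.

Lemma cyc_self S y : is_subring S -> cyc S y y.
Proof. by move=> hS; exists 1; rewrite ?mul1r //; apply: subring1. Qed.

Lemma cyc_sub S K y : smod S K -> K y -> cyc S y `<=` K.
Proof. by move=> hK Ky _ [s Ss ->]; apply: smodM hK _ _. Qed.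

Lemma span_mem S gs g : is_subring S -> g \in gs -> span S gs g.
Proof.
move=> hS; elim: gs => // h gs IH; rewrite inE => /orP[/eqP->|/IH hg] /=.
  apply: (@addmP1 S); first by apply: smod_span; apply: smod_self.
  exact: cyc_self.
apply: (@addmP2 S) => //; apply: smod_cyc; exact: smod_self.
Qed.

Lemma span_sub S K gs : smod S K -> (forall g, g \in gs -> K g) -> span S gs `<=` K.
Proof.
move=> hK; elim: gs => [_ x ->|g gs IH hgs]; first exact: smod0 hK.
apply: (@addm_sub S) => //; first by apply: cyc_sub => //; apply: hgs; rewrite mem_head.
by apply: IH => h hh; apply: hgs; rewrite inE hh orbT.
Qed.

Lemma spanS J J' gs : J `<=` J' -> span J gs `<=` span J' gs.
Proof.
move=> hJ; elim: gs => //= g gs IH; apply: addmS => //.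
by move=> _ [s /hJ Js ->]; exists s.
Qed.

Lemma span_cat S J l1 l2 : smod S J -> span J (l1 ++ l2) = addm (span J l1) (span J l2).
Proof.
move=> hJ; elim: l1 => [|g l1 IH] /=; last by rewrite IH addmA.
apply/predeqP => x; split; first by move=> h; exists 0, x; rewrite add0r.
by move=> [_ [b [-> h ->]]]; rewrite add0r.
Qed.

Lemma span_mulr J gs x r : span J gs x -> span J [seq g * r | g <- gs] (x * r).
Proof.
elim: gs x => [x ->|g gs IH x [_ [b [[s Js ->] hb ->]]]] /=; first by rewrite mul0r.
by exists (s * g * r), (b * r); split; [exists s => //; ring | exact: IH | ring].
Qed.

(** Length as a relation (a strict chain of [n] steps exists) lets inequalities be transported along
    maps before any finiteness is known. Stability under [S] is imposed on the terms above [N]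
    only. *)
Fixpoint lge S n N M : Prop :=
  if n is n'.+1 then
    exists K, [/\ smod S K, strict_sub N K, K `<=` M & lge S n' K M]
  else True.

Lemma lge_anti S n N N' M : N' `<=` N -> lge S n N M -> lge S n N' M.
Proof.
case: n => // n hN [K [hK [h [x [Kx nx]]] KM hl]]; exists K; split=> //.
by split; [move=> y /hN; apply: h | exists x; split=> // /hN].
Qed.

Lemma lge_mono S n N M M' : M `<=` M' -> lge S n N M -> lge S n N M'.
Proof.
move=> hM; elim: n N => // n IH N [K [hK h KM hl]]; exists K; split=> //.
  by move=> x /KM /hM.
exact: IH.
Qed.

Lemma lge_leq S n n' N M : (n' <= n)%N -> lge S n N M -> lge S n' N M.
Proof.
elim: n n' N => [|n IH] [|n'] N // hn [K [hK h KM hl]]; exists K; split=> //.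
exact: IH hl.
Qed.

Lemma lge_cat S a b N K M : N `<=` K -> K `<=` M ->
  lge S a N K -> lge S b K M -> lge S (a + b) N M.
Proof.
move=> + KM; elim: a N => [|a IH] N NK; first by move=> _; apply: lge_anti.
move=> [L [hL h LK hl]] hb; exists L; split=> //; first by move=> x /LK /KM.
exact: IH.
Qed.

(** Each step [N < L] of a chain stays strict after intersecting with [K] or after adding [K]: if
    both collapsed, the modular law would give [L = N]. Additivity of length follows. *)
Lemma lge_split S n N K M : is_subring S -> smod S N -> smod S K -> smod S M ->
  N `<=` M -> K `<=` M -> lge S n N M ->
  exists a b, [/\ (a + b = n)%N, lge S a (capm N K) K & lge S b (addm N K) M].
Proof.
move=> hS hN hK hM + KM; elim: n N hN => [|n IH] N hN NM; first by exists 0%N, 0%N.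
move=> [L [hL [NL [x [Lx nNx]]] LM hl]].
have [a [b [hab ha hb]]] := IH L hL LM hl.
have [hcap|hcap] := pselect (capm L K `<=` capm N K).
  exists a, b.+1; split; [lia | by apply: lge_anti ha => y [Ny Ky]; split=> //; apply: NL |].
  exists (addm L K); split=> //; first exact: smod_add.
    split; first exact: addmS.
    exists x; split; first exact: (addmP1 hK).
    move=> [u [v [Nu Kv e]]]; apply: nNx.
    have Lv : L v by rewrite (_ : v = x - u); [apply: (smodB hS hL) => //; apply: NL | rewrite e; ring].
    by rewrite e; apply: (smodD hN) => //; have [] := hcap v (conj Lv Kv).
  exact: (@addm_sub S).
exists a.+1, b; split; [lia | | by apply: lge_anti hb; exact: addmS].
exists (capm L K); split=> //; first exact: smod_cap.
  split; first by move=> y [Ny Ky]; split=> //; apply: NL.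
  exact: not_subP.
Qed.

Definition fin S N M : Prop := exists n, ~ lge S n N M.

Lemma len_exists S N M : exists l, fin S N M -> forall n, lge S n N M <-> (n <= l)%N.
Proof.
have [h|nh] := pselect (fin S N M); last by exists 0%N.
pose P n := `[< ~ lge S n N M >].
have exP : exists n, P n by case: h => n hn; exists n; apply/asboolP.
case: (ex_minnP exP) => n /asboolP hn hmin; exists n.-1 => _ k; split=> [hk|hk].
  rewrite leqNgt; apply/negP => hlt; apply: hn; apply: lge_leq hk.
  by case: (n) hlt.
apply: contrapT => nk; have /hmin : P k by apply/asboolP.
by case: n hn hk {hmin} => [[]|n] //= hn hk; lia.
Qed.

(** The value is meaningful only under [fin]; otherwise it is an unspecified number. *)
Definition len S N M : nat := projT1 (cid (len_exists S N M)).

Lemma lenP S N M : fin S N M -> forall n, lge S n N M <-> (n <= len S N M)%N.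
Proof. by rewrite /len; case: (cid _). Qed.

Lemma len_lge S N M : fin S N M -> lge S (len S N M) N M.
Proof. by move=> h; apply/lenP. Qed.

Lemma fin_lenP S N M l : (~ lge S l.+1 N M) -> fin S N M /\ (len S N M <= l)%N.
Proof.
move=> h; have hf : fin S N M by exists l.+1.
split=> //; rewrite leqNgt; apply/negP => hl; apply: h; exact/lenP.
Qed.

Lemma fin_le S N M N' M' : N' `<=` N -> M `<=` M' -> fin S N' M' -> fin S N M.
Proof. by move=> hN hM [n hn]; exists n => h; apply: hn; apply: lge_anti hN _; apply: lge_mono hM _. Qed.

Lemma len_le S N M N' M' : N' `<=` N -> M `<=` M' -> fin S N' M' ->
  (len S N M <= len S N' M')%N.
Proof.
move=> hN hM hf; apply/lenP => //; apply: (lge_anti hN); apply: (lge_mono hM).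
exact: (len_lge (fin_le hN hM hf)).
Qed.

Section Additivity.
Variables (S N K M : R -> Prop).
Hypotheses (hS : is_subring S) (hN : smod S N) (hK : smod S K) (hM : smod S M).
Hypotheses (NK : N `<=` K) (KM : K `<=` M).

Let NM : N `<=` M. Proof. by move=> x /NK /KM. Qed.

Let capE : capm N K = N.
Proof. by apply/predeqP => x; split=> [[]|Nx] //; split=> //; apply: NK. Qed.

Let addE : addm N K = K.
Proof.
apply/predeqP => x; split; first by apply: (@addm_sub S).
exact: (addmP2 hN).
Qed.

Lemma fin_cat : fin S N K -> fin S K M -> fin S N M.
Proof.
move=> [a ha] [b hb]; exists (a + b)%N => h.
have [a' [b' [e]]] := lge_split hS hN hK hM NM KM h; rewrite capE addE => h1 h2.
have [la|la] := leqP a a'; first by apply: ha; apply: lge_leq h1.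
by apply: hb; apply: lge_leq h2; lia.
Qed.

Lemma len_cat : fin S N M -> len S N M = (len S N K + len S K M)%N.
Proof.
move=> hf.
have f1 : fin S N K by apply: (fin_le _ _ hf).
have f2 : fin S K M by apply: (fin_le _ _ hf).
apply/eqP; rewrite eqn_leq; apply/andP; split; last first.
  by apply/lenP => //; apply: (@lge_cat _ _ _ _ K) => //; apply: len_lge.
have [a [b [<-]]] := lge_split hS hN hK hM NM KM (len_lge hf); rewrite capE addE.
by move=> /(lenP f1) h1 /(lenP f2) h2; lia.
Qed.
End Additivity.

Lemma finxx S M : fin S M M.
Proof.
by exists 1%N => -[K [_ [h [x [Kx nx]]] KM _]]; apply: nx; apply: KM.
Qed.

Lemma lenxx S M : len S M M = 0%N.
Proof.
have [|_] := @fin_lenP S M M 0; last by case: (len S M M).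
by move=> [K [_ [h [x [Kx nx]]] KM _]]; apply: nx; apply: KM.
Qed.

Lemma len_eq0 S N M : smod S M -> N `<=` M -> fin S N M -> len S N M = 0%N -> M = N.
Proof.
move=> hM NM hf h0; apply/predeqP => x; split; last exact: NM.
move=> Mx; apply: contrapT => nNx.
have : lge S 1 N M by exists M; split=> //; split=> //; exists x.
by move/(lenP hf); rewrite h0.
Qed.

Lemma len_gt0 S N M : smod S M -> strict_sub N M -> fin S N M -> (0 < len S N M)%N.
Proof. by move=> hM h hf; apply/(lenP hf); exists M; split. Qed.

Definition simple S N K : Prop :=
  strict_sub N K /\ forall y, K y -> ~ N y -> K `<=` addm N (cyc S y).

(** The first step of a chain of maximal length is simple, since a module strictly between would
    lengthen the chain. *)
Lemma simple_step S N M : is_subring S -> smod S N -> smod S M -> N `<=` M -> fin S N M ->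
  ~ M `<=` N ->
  exists K, [/\ smod S K, simple S N K, K `<=` M & len S K M < len S N M]%N.
Proof.
move=> hS hN hM NM hf nMN.
have hl := len_lge hf.
have hpos : (0 < len S N M)%N.
  apply: len_gt0 => //; split=> //.
  exact: not_subP.
move: hl; rewrite -(prednK hpos) => -[K [hK h KM hl]]; exists K; split=> //; last first.
  have fK : fin S K M by apply: (fin_le _ _ hf) => //; case: h.
  rewrite ltnNge; apply/negP => hle.
  have : lge S (len S N M).+1 N M.
    by exists K; split=> //; apply/(lenP fK); move: hle; rewrite prednK.
  by move/(lenP hf); rewrite ltnn.
split=> // y Ky nNy x Kx; apply: contrapT => nx.
have hL : smod S (addm N (cyc S y)) by apply: smod_add => //; apply: smod_cyc; apply: smod_self.
have LK : addm N (cyc S y) `<=` K.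
  by apply: (@addm_sub S) => //; [case: h | apply: cyc_sub].
have : lge S (len S N M).-1.+2 N M.
  exists (addm N (cyc S y)); split=> //; last 2 first.
  - by move=> z /LK /KM.
  - by exists K; split=> //; split=> //; exists x.
  split; first by apply: (addmP1 (smod_cyc y (smod_self hS))).
  by exists y; split=> //; apply: (addmP2 hN); apply: cyc_self.
by move/(lenP hf); lia.
Qed.

(** Dévissage: a property descends from [M] to [N] along a composition series, one simple step at a
    time. *)
Lemma fin_ind S (Q : (R -> Prop) -> Prop) M : is_subring S -> smod S M -> Q M ->
  (forall N K, smod S N -> smod S K -> simple S N K -> K `<=` M -> fin S N M -> Q K -> Q N) ->
  forall N, smod S N -> N `<=` M -> fin S N M -> Q N.
Proof.
move=> hS hM QM Qs N; have [n] := ubnP (len S N M).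
elim: n N => // n IH N hn hN NM hf.
have [MN|nMN] := pselect (M `<=` N).
  by rewrite (_ : N = M) //; apply/predeqP => x; split; [apply: NM | apply: MN].
have [K [hK sK KM hlt]] := simple_step hS hN hM NM hf nMN.
apply: (Qs N K) => //; apply: IH => //; first by lia.
by apply: (fin_le _ _ hf) => //; case: sK => [[]].
Qed.

Lemma fin_len_simple S N K : is_subring S -> smod S N -> smod S K -> simple S N K ->
  fin S N K /\ len S N K = 1%N.
Proof.
move=> hS hN hK [st hs].
have [|hf hle] := @fin_lenP S N K 1; last first.
  by split=> //; have := len_gt0 hK st hf; lia.
move=> [L [hL [NL [y [Ly nNy]]] LK [L' [hL' [LL' [z [L'z nLz]]] LK' _]]]].
apply: nLz; have := hs y (LK _ Ly) nNy z (LK' _ L'z).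
by apply: (@addm_sub S) => //; apply: cyc_sub.
Qed.

End Submodules.

(** * Transport of lengths along additive maps *)

Section LengthMaps.
Local Open Scope ring_scope.
Local Open Scope classical_set_scope.
Variables (R1 R2 : comNzRingType).
Variables (S1 N1 M1 : R1 -> Prop) (S2 N2 M2 : R2 -> Prop).

(** [Phi] acts on submodules and need not come from a linear map; [K -> K^p U] is treated this way
    later. The disjunct [K = N1] covers the bottom of the chain. *)
Lemma lge_strict_map (Phi : (R1 -> Prop) -> (R2 -> Prop)) n :
  (forall K, smod S1 K -> N1 `<=` K -> K `<=` M1 -> smod S2 (Phi K) /\ Phi K `<=` M2) ->
  (forall K K', K = N1 \/ smod S1 K -> smod S1 K' -> N1 `<=` K -> K' `<=` M1 ->
     strict_sub K K' -> strict_sub (Phi K) (Phi K')) ->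
  lge S1 n N1 M1 -> lge S2 n (Phi N1) M2.
Proof.
move=> h1 h2.
have : forall K, K = N1 \/ smod S1 K -> N1 `<=` K -> lge S1 n K M1 -> lge S2 n (Phi K) M2.
  elim: n => // n IH K hK NK [L [hL KL LM hl]]; exists (Phi L).
  have NL : N1 `<=` L by move=> x /NK; case: KL => h _; apply: h.
  have [hP PM] := h1 L hL NL LM.
  by split=> //; [apply: h2 | apply: IH => //; right].
by move=> h; apply: h => //; left.
Qed.

Variable f : R1 -> R2.
Hypothesis fD : forall x y, f (x + y) = f x + f y.

Let f0 : f 0 = 0. Proof. by apply: (addrI (f 0)); rewrite -fD !addr0. Qed.
Let fN x : f (- x) = - f x. Proof. by apply/eqP; rewrite -subr_eq0 opprK -fD addNr f0. Qed.
Let fB x y : f (x - y) = f x - f y. Proof. by rewrite fD fN. Qed.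

(** As [f] is only additive and the scalars are matched by a hypothesis, ring maps and
    multiplication by a fixed element are covered at once. Surjectivity modulo [N2] keeps the
    pulled-back steps strict. *)
Lemma lge_pull n : is_subring S2 -> smod S1 M1 -> smod S2 N2 ->
  (forall s x, S1 s -> M1 x -> exists2 s', S2 s' & f (s * x) = s' * f x) ->
  (forall y, M2 y -> exists2 x, M1 x & N2 (y - f x)) ->
  lge S2 n N2 M2 -> lge S1 n (fun x => M1 x /\ N2 (f x)) M1.
Proof.
move=> hS2 hM1 hN2 fS fsurj.
have : forall K, smod S2 K -> N2 `<=` K -> lge S2 n K M2 ->
   lge S1 n (fun x => M1 x /\ K (f x)) M1; last by apply.
elim: n => // n IH K hK NK [L [hL [KL [y [Ly nKy]]] LM hl]].
have NL : N2 `<=` L by move=> x /NK /KL.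
exists (fun x => M1 x /\ L (f x)); split.
- split; first by rewrite f0; split; [apply: smod0 hM1 | apply: smod0 hL].
  split=> [a b [Ma La] [Mb Lb]|s a Ss [Ma La]]; first by rewrite fD; split; [apply: smodD hM1 _ _ | apply: smodD hL _ _].
  split; first exact: smodM hM1 _ _.
  by have [s' Ss' ->] := fS s a Ss Ma; apply: smodM hL _ _.
- split; first by move=> a [Ma Ka]; split=> //; apply: KL.
  have [x Mx Nx] := fsurj y (LM y Ly); exists x; split.
    split=> //; rewrite (_ : f x = y - (y - f x)); last by ring.
    by apply: (smodB hS2 hL) => //; apply: NL.
  move=> [_ Kx]; apply: nKy; rewrite (_ : y = (y - f x) + f x); last by ring.
  by apply: smodD hK _ _ => //; apply: NK.
- by move=> x [].
- exact: IH.
Qed.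

Lemma lge_push n : is_subring S1 -> is_subring S2 -> smod S1 N1 -> smod S1 M1 ->
  smod S2 N2 -> smod S2 M2 ->
  (forall s' x, S2 s' -> M1 x -> exists2 s, S1 s & s' * f x = f (s * x)) ->
  (forall x, M1 x -> N2 (f x) -> N1 x) ->
  (forall x, M1 x -> M2 (f x)) -> N2 `<=` M2 ->
  lge S1 n N1 M1 -> lge S2 n N2 M2.
Proof.
move=> hS1 hS2 hN1 hM1 hN2 hM2 fS finj fM NM2 h.
pose Phi K := addm N2 (fun y => exists2 x, K x & y = f x).
apply: (@lge_anti _ _ _ (Phi N1)).
  by move=> y Ny; exists y, 0; rewrite addr0; split=> //; exists 0; rewrite ?f0 //; apply: smod0 hN1.
apply: lge_strict_map h => [K hK NK KM|K K' hK hK' NK K'M [KK' [x [K'x nKx]]]].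
  split; last by apply: (addm_sub hM2) => // _ [x Kx ->]; apply/fM/KM.
  apply: smod_add => //; split; first by exists 0; rewrite ?f0 //; apply: smod0 hK.
  split=> [_ _ [a Ka ->] [b Kb ->]|s _ Ss [a Ka ->]].
    by exists (a + b); rewrite ?fD //; apply: smodD hK _ _.
  by have [s' Ss' ->] := fS s a Ss (KM _ Ka); exists (s' * a) => //; apply: smodM hK _ _.
have {}hK : smod S1 K by case: hK => [->|].
split; first by apply: addmS => // _ [a Ka ->]; exists a => //; apply: KK'.
exists (f x); split; first by exists 0, (f x); rewrite add0r; split=> //; [apply: smod0 hN2 | exists x].
move=> [u [_ [Nu [k Kk ->] e]]]; apply: nKx.
rewrite (_ : x = (x - k) + k); last by ring.
apply: smodD hK _ _ => //; apply: NK; apply: finj.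
  by apply: (smodB hS1 hM1); apply: K'M => //; apply: KK'.
by rewrite fB e addrK.
Qed.

End LengthMaps.

(** * Cyclic modules and colengths of ideals *)

Section ColengthTools.
Local Open Scope ring_scope.
Local Open Scope classical_set_scope.
Variable R : comNzRingType.
Implicit Types (S N M K I J : R -> Prop) (x y s : R).

Lemma len_lge_iff (R' : comNzRingType) S N M (S' N' M' : R' -> Prop) :
  (forall n, lge S n N M <-> lge S' n N' M') ->
  (fin S N M <-> fin S' N' M') /\ (fin S N M -> len S N M = len S' N' M').
Proof.
move=> h.
have hf : fin S N M <-> fin S' N' M'.
  by split=> -[n hn]; exists n => /h.
split=> // f; have f' := hf.1 f; apply/eqP; rewrite eqn_leq; apply/andP; split.
  by apply/(lenP f')/h; apply: len_lge.
by apply/(lenP f)/h; apply: len_lge.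
Qed.

(** Multiplication by [y] identifies [S/(N : y)] with [(N + S y)/N]. Lengths are counted over [S'],
    typically a smaller ring than [S]. *)
Lemma lge_cyc S' S N y n : is_subring S' -> smod S' S -> smod S' N ->
  lge S' n N (addm N (cyc S y)) <-> lge S' n (ann S N y) S.
Proof.
move=> hS' hS hN; split.
  apply: (@lge_pull _ _ S' S S' N _ (fun x => x * y)) => //.
  - by move=> a b; rewrite mulrDl.
  - by move=> s x Ss Sx; exists s => //; rewrite mulrA.
  - by move=> _ [a [_ [Na [s Ss ->] ->]]]; exists s => //; rewrite addrK.
apply: (@lge_push _ _ S' (ann S N y) S S' N _ (fun x => x * y)) => //.
- by move=> a b; rewrite mulrDl.
- split; first by split; rewrite ?mul0r; [apply: smod0 hS | apply: smod0 hN].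
  split=> [a b [Sa Na] [Sb Nb]|s a Ss [Sa Na]]; split.
  + by apply: smodD hS _ _.
  + by rewrite mulrDl; apply: smodD hN _ _.
  + by apply: smodM hS _ _.
  + by rewrite -mulrA; apply: smodM hN _ _.
- by apply: smod_add => //; apply: smod_cyc.
- by move=> s x Ss Sx; exists s => //; rewrite mulrA.
- by move=> x Sx; exists 0, (x * y); rewrite add0r; split=> //; [apply: smod0 hN | exists x].
- exact: (addmP1 (smod_cyc y hS)).
Qed.

Lemma fin_cyc S' S N y : is_subring S' -> smod S' S -> smod S' N ->
  fin S' N (addm N (cyc S y)) <-> fin S' (ann S N y) S.
Proof.
move=> h1 h2 h3.
exact: (len_lge_iff (fun n => lge_cyc (N := N) y n h1 h2 h3)).1.
Qed.

Lemma len_cyc S' S N y : is_subring S' -> smod S' S -> smod S' N ->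
  fin S' (ann S N y) S -> len S' N (addm N (cyc S y)) = len S' (ann S N y) S.
Proof.
move=> h1 h2 h3 hf; have [h4 h5] := len_lge_iff (fun n => lge_cyc (N := N) y n h1 h2 h3).
by apply: h5; apply/h4.
Qed.

Lemma fin_cyc_le S' S N J y : is_subring S' -> smod S' S -> smod S' N -> smod S' J ->
  J `<=` S -> (forall s, J s -> N (s * y)) -> fin S' J S ->
  fin S' N (addm N (cyc S y)) /\ (len S' N (addm N (cyc S y)) <= len S' J S)%N.
Proof.
move=> h1 h2 h3 h4 JS hJ hf.
have Jann : J `<=` ann S N y by move=> s Js; split; [apply: JS | apply: hJ].
have hf' : fin S' (ann S N y) S by apply: (fin_le _ _ hf).
by split; [apply/fin_cyc | rewrite len_cyc //; apply: len_le].
Qed.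

Lemma fin_span_le S' S N J gs : is_subring S' -> smod S' S -> smod S' N -> smod S' J ->
  J `<=` S -> (forall g s, g \in gs -> J s -> N (s * g)) -> fin S' J S ->
  fin S' N (addm N (span S gs)) /\
  (len S' N (addm N (span S gs)) <= size gs * len S' J S)%N.
Proof.
move=> h1 h2 h3 h4 JS + hf; elim: gs N h3 => [|g gs IH] N h3 hJ /=.
  have -> : addm N (fun x => x = 0) = N.
    by apply/predeqP => x; split=> [[a [_ [Na -> ->]]]|Nx]; [rewrite addr0 | exists x, 0; rewrite addr0].
  by rewrite lenxx; split=> //; apply: finxx.
rewrite addmA; set L := addm N (cyc S g).
have hL : smod S' L by apply: smod_add => //; apply: smod_cyc.
have NL : N `<=` L by apply: (addmP1 (smod_cyc g h2)).
have [f1 l1] : fin S' N L /\ (len S' N L <= len S' J S)%N.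
  by apply: fin_cyc_le => // s; apply: hJ; rewrite mem_head.
have [|f2 l2] := IH L hL.
  by move=> g' s hg Js; apply: NL; apply: hJ => //; rewrite inE hg orbT.
have hT : smod S' (addm L (span S gs)) by apply: smod_add => //; apply: smod_span.
have LT : L `<=` addm L (span S gs) by apply: (addmP1 (smod_span gs h2)).
have hf' : fin S' N (addm L (span S gs)) by apply: (@fin_cat _ S' N L).
by split=> //; rewrite (@len_cat _ S' N L) // mulSn; apply: leq_add.
Qed.

Definition colen I := len setT I setT.
Definition fincol I := fin setT I setT.
Definition colon I y := ann setT I y.
Definition pid y := cyc setT y.

Lemma ideal_add I J : is_ideal I -> is_ideal J -> is_ideal (addm I J).
Proof. by move=> /smodT hI /smodT hJ; apply/smodT/smod_add. Qed.

Lemma ideal_pid y : is_ideal (pid y).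
Proof. by apply/smodT/smod_cyc/smod_self. Qed.

Lemma ideal_colon I y : is_ideal I -> is_ideal (colon I y).
Proof. by move=> /smodT hI; apply/smodT/smod_ann. Qed.

Lemma ideal_span gs : is_ideal (span (R:=R) setT gs).
Proof. by apply/smodT/smod_span/smod_self. Qed.

Lemma ideal_setT : @is_ideal R setT.
Proof. by []. Qed.

Lemma idealN I x : is_ideal I -> I x -> I (- x).
Proof. by move=> [_ [_ hM]] Ix; rewrite -mulN1r; apply: hM. Qed.

Lemma idealD I x y : is_ideal I -> I x -> I y -> I (x + y).
Proof. by move=> [_ [hD _]]; apply: hD. Qed.

Lemma idealB I x y : is_ideal I -> I x -> I y -> I (x - y).
Proof. by move=> hI Ix Iy; apply: idealD => //; apply: idealN. Qed.

Lemma idealMl I x y : is_ideal I -> I y -> I (x * y).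
Proof. by move=> [_ [_]]; apply. Qed.

Lemma idealMr I x y : is_ideal I -> I x -> I (x * y).
Proof. by move=> hI Ix; rewrite mulrC; apply: idealMl. Qed.

Lemma ideal0 I : is_ideal I -> I 0. Proof. by case. Qed.

Lemma ideal1 I : is_ideal I -> I 1 -> I = setT.
Proof.
by move=> hI I1; apply/predeqP => x; split=> // _; rewrite -[x]mulr1; apply: idealMl.
Qed.

Lemma idealP1 I J : is_ideal J -> I `<=` addm I J.
Proof. by move/smodT; apply: addmP1. Qed.

Lemma idealP2 I J : is_ideal I -> J `<=` addm I J.
Proof. by move/smodT; apply: addmP2. Qed.

Lemma ideal_add_sub I J K : is_ideal K -> I `<=` K -> J `<=` K -> addm I J `<=` K.
Proof. by move/smodT; apply: addm_sub. Qed.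

Lemma pid_mem y : pid y y.
Proof. exact: cyc_self. Qed.

Lemma pid_sub I y : is_ideal I -> I y -> pid y `<=` I.
Proof. by move/smodT; apply: cyc_sub. Qed.

Lemma fincol_le I J : I `<=` J -> fincol I -> fincol J.
Proof. by move=> h; apply: fin_le. Qed.

Lemma colen_le I J : I `<=` J -> fincol I -> (colen J <= colen I)%N.
Proof. by move=> h; apply: len_le. Qed.

Lemma colen_split I J : is_ideal I -> is_ideal J -> I `<=` J -> fincol I ->
  colen I = (len setT I J + colen J)%N.
Proof. by move=> /smodT hI /smodT hJ IJ hf; apply: len_cat. Qed.

Lemma colen_step I y : is_ideal I -> fincol I ->
  colen I = (colen (colon I y) + colen (addm I (pid y)))%N.
Proof.
move=> hI hf.
have IJ : I `<=` addm I (pid y) by apply: idealP1; apply: ideal_pid.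
rewrite (@colen_split I (addm I (pid y))) //; last by apply: ideal_add => //; apply: ideal_pid.
rewrite /pid len_cyc //; first exact/smodT.
by apply: (fin_le _ _ hf) => // x Ix; split=> //; rewrite mulrC; apply: idealMl.
Qed.

(** Filter by the ideals [I + (x^i)], [i <= n]: each successive quotient is cyclic, generated by
    [x^i] and killed by [I + (x)]. *)
Lemma colen_nilpotent I x n : is_ideal I -> fincol I -> I (x ^+ n) ->
  (colen I <= n * colen (addm I (pid x)))%N.
Proof.
move=> hI hf hx.
have hId i : is_ideal (addm I (pid (x ^+ i))) by apply: ideal_add => //; apply: ideal_pid.
have hfi i : fincol (addm I (pid (x ^+ i))) by apply: fincol_le hf; apply: idealP1; apply: ideal_pid.
suff h i : (colen (addm I (pid (x ^+ i))) <= i * colen (addm I (pid x)))%N.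
  apply: leq_trans (h n); apply: colen_le => //; apply: ideal_add_sub => //.
  exact: pid_sub.
elim: i => [|i IH].
  rewrite expr0 mul0n (_ : addm _ _ = setT) ?lenxx // /colen ?lenxx //.
  by apply: ideal1 (hId 0) _; rewrite expr0; apply: idealP2 => //; apply: pid_mem.
rewrite (colen_step (x ^+ i) (hId i.+1)) // mulSn; apply: leq_add.
  apply: colen_le; last by apply: fincol_le hf; apply: idealP1; apply: ideal_pid.
  have hc : is_ideal (colon (addm I (pid (x ^+ i.+1))) (x ^+ i)) by apply: ideal_colon.
  apply: ideal_add_sub => // [a Ia|].
    by split=> //; apply: idealP1; [apply: ideal_pid | apply: idealMr].
  by apply: pid_sub => //; split=> //; rewrite -exprS; apply: idealP2 => //; apply: pid_mem.
apply: leq_trans IH; apply: colen_le; last exact: hfi.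
apply: ideal_add_sub; first by apply: ideal_add => //; apply: ideal_pid.
  by move=> a Ia; apply: idealP1; [apply: ideal_pid | apply: idealP1 => //; apply: ideal_pid].
by apply: idealP2; apply: hId.
Qed.

Lemma colength_eqP I n : is_ideal I -> colength_eq I n <-> fincol I /\ colen I = n.
Proof.
move=> hI.
have to_lge (J : nat -> R -> Prop) k : ideal_chain I J k -> lge setT k I setT.
  move=> [h1 [h2 [h3 h4]]].
  have -> : I = J 0%N by apply/predeqP => x; rewrite h2.
  suff h i : (i <= k)%N -> lge setT i (J (k - i)%N) setT by have := h k (leqnn k); rewrite subnn.
  elim: i => // i IH hik; exists (J (k - i)%N); split=> //; last by apply: IH; apply: ltnW.
    by apply/smodT/h1; rewrite leq_subr.
  by have := h4 (k - i.+1)%N; rewrite -subSn // subSS; apply; lia.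
(* A chain for [lge] may stop short of the ring while an [ideal_chain] ends there, so the last term
   is replaced by the whole ring. This needs at least one step; colength 0 is treated separately at
   the end. *)
have of_lge k K : is_ideal K -> lge setT k.+1 K setT -> exists J : nat -> R -> Prop, ideal_chain K J k.+1.
  elim: k K => [|k IH] K hK.
    move=> [L [/smodT hL [KL [x [Lx nKx]]] LM _]].
    exists (fun i => if i is 0%N then K else setT); split; first by case.
    by split=> //; split=> //; case=> // _; split=> //; exists x.
  move=> [L [/smodT hL KL LM /(IH L hL)[J [h1 [h2 [h3 h4]]]]]].
  exists (fun i => if i is i'.+1 then J i' else K); split; first by case=> // i hi; apply: h1.
  split=> //; split=> //; case=> [_|i hi]; last exact: h4.
  by have -> : J 0%N = L by apply/predeqP.
split=> [[[J hJ] hmax]|[hf <-]].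
  have hn := to_lge _ _ hJ.
  have nS : ~ lge setT n.+1 I setT.
    by move=> /(of_lge _ _ hI)[J' /hmax]; rewrite ltnn.
  have [hf hle] := fin_lenP nS; split=> //; apply/eqP; rewrite eqn_leq hle /=.
  exact/(lenP hf).
split; last by move=> J k /to_lge /(lenP hf).
have := len_lge hf; rewrite -/(colen I); case E : (colen I) => [|k]; last exact: of_lge.
move=> _; exists (fun _ => I); split=> //; split=> //; split=> // x.
by have -> : I = setT by apply: esym; apply: len_eq0 hf E => //; apply/smodT.
Qed.

End ColengthTools.

(** * Noetherian rings *)

Section Noetherian.
Local Open Scope ring_scope.
Local Open Scope classical_set_scope.
Variable A : comNzRingType.
Implicit Types (I J K P Q : A -> Prop).

Lemma noetherian_ind (Q : (A -> Prop) -> Prop) : noetherian A ->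
  (forall J, is_ideal J -> (forall J', is_ideal J' -> strict_sub J J' -> Q J') -> Q J) ->
  forall J, is_ideal J -> Q J.
Proof.
move=> hN step J0 hJ0; apply: contrapT => nQ.
pose T := {J | is_ideal J /\ ~ Q J}.
have next (t : T) : exists t' : T, strict_sub (projT1 t) (projT1 t').
  case: t => J [hJ nJ] /=; apply: contrapT => hno; apply: nJ; apply: step => // J' hJ' hlt.
  by apply: contrapT => nJ'; apply: hno; exists (exist _ J' (conj hJ' nJ')).
have [f hf] := choice next.
pose t n := iter n f (exist _ J0 (conj hJ0 nQ) : T).
have [||N hNN] := hN (fun n => projT1 (t n)).
- by move=> n; case: (projT2 (t n)).
- by move=> n x; have [h _] := hf (t n); apply: h.
have [_ [x [hx nx]]] := hf (t N).
by apply: nx; apply: (hNN N.+1) => //.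
Qed.

Lemma noetherian_fg I : noetherian A -> is_ideal I -> exists gs, I = span setT gs.
Proof.
move=> hN hI.
pose Q (J : A -> Prop) := forall gs, J = span setT gs -> J `<=` I ->
  exists gs, I = span setT gs.
suff h J : is_ideal J -> Q J.
  apply: (h (span setT [::]) (@ideal_span _ [::]) [::]) => // x ->; exact: ideal0.
apply: (noetherian_ind (Q := Q) hN) => {}J _ IH gs eJ JI.
have [IJ|/not_subP[x [Ix nJx]]] := pselect (I `<=` J).
  by exists gs; rewrite -eJ; apply/predeqP => x; split; [apply: IJ | apply: JI].
apply: (IH (span setT (x :: gs)) (@ideal_span _ _) _ (x :: gs)) => //.
  rewrite eJ; split; first by apply: idealP2; apply: ideal_pid.
  by exists x; rewrite -eJ; split=> //; apply: idealP1; [apply: ideal_span | apply: pid_mem].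
by apply: ideal_add_sub => //; [apply: pid_sub | move=> z hz; apply: JI; rewrite eJ].
Qed.

Lemma noetherian_of_fg : (forall I, is_ideal I -> exists gs, I = span setT gs) -> noetherian A.
Proof.
move=> hfg I hI hinc.
have hmono i j x : (i <= j)%N -> I i x -> I j x.
  by elim: j => [|j IH]; [rewrite leqn0 => /eqP -> | rewrite leq_eqVlt => /orP[/eqP->|/IH h /h /hinc]].
pose U x := exists n, I n x.
have hU : is_ideal U.
  split; first by exists 0%N; apply: ideal0.
  split=> [x y [i hi] [j hj]|r x [i hi]]; last by exists i; apply: idealMl.
  exists (maxn i j); apply: idealD => //; [apply: (hmono i) | apply: (hmono j)] => //.
    exact: leq_maxl.
  exact: leq_maxr.
have [gs hgs] := hfg U hU.
have [N hN] : exists N, forall g, g \in gs -> I N g.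
  have : forall g, g \in gs -> U g by move=> g hg; rewrite hgs; apply: span_mem.
  elim: gs {hgs} => [|g gs IH] hg; first by exists 0%N.
  have [|N hN] := IH; first by move=> g' h; apply: hg; rewrite inE h orbT.
  have [n hn] := hg g (mem_head _ _); exists (maxn n N) => g'; rewrite inE => /orP[/eqP->|/hN h].
    by apply: hmono hn; apply: leq_maxl.
  by apply: hmono h; apply: leq_maxr.
exists N => n x hn hx.
have : U x by exists n.
rewrite hgs; apply: span_sub => //; exact/smodT.
Qed.

(** This says that [z] times the product of the ideals [Qs] lies in [J], without forming the product
    ideal. *)
Fixpoint prodin (Qs : seq (A -> Prop)) J (z : A) : Prop :=
  if Qs is Q :: Qs' then forall x, Q x -> prodin Qs' J (x * z) else J z.

Lemma prodin_mono Qs J J' z w : (forall x, J x -> J' (x * w)) ->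
  prodin Qs J z -> prodin Qs J' (z * w).
Proof.
move=> h; elim: Qs z => [|Q Qs IH] z /=; first exact: h.
by move=> hz x Qx; rewrite mulrA; apply: IH; apply: hz.
Qed.

Lemma prodin_cat Qs Qs' J z : prodin (Qs ++ Qs') J z <-> prodin Qs (prodin Qs' J) z.
Proof. by elim: Qs z => //= Q Qs IH z; split=> h x Qx; apply/IH/h. Qed.

(** Noetherian induction: if [x y] is in [J] but neither factor is, the prime products found for
    [J + (x)] and [J + (y)] multiply into [J]. This replaces primary decomposition: every prime
    above [J] contains a listed one, so the minimal primes are among the list. *)
Lemma prime_product : noetherian A -> forall J, is_ideal J ->
  exists Qs, (forall Q, List.In Q Qs -> is_prime Q /\ J `<=` Q) /\ prodin Qs J 1.
Proof.
move=> hN; apply: (noetherian_ind hN) => J hJ IH.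
have [J1|nJ1] := pselect (J 1); first by exists [::].
have [hp|] := pselect (forall x y, J (x * y) -> J x \/ J y).
  exists [:: J]; split=> [Q [<-|[]]|x Jx /=]; last by rewrite mulr1.
  by split=> //; split.
move=> /existsNP[x /existsNP[y /not_implyP[Jxy /not_orP[nx ny]]]].
have step z : ~ J z -> exists Qs, (forall Q, List.In Q Qs -> is_prime Q /\ J `<=` Q) /\ prodin Qs (addm J (pid z)) 1.
  move=> nz; have hz : is_ideal (addm J (pid z)) by apply: ideal_add => //; apply: ideal_pid.
  have Jz : J `<=` addm J (pid z) by apply: idealP1; apply: ideal_pid.
  have [|Qs [h1 h2]] := IH _ hz.
    by split=> //; exists z; split=> //; apply: idealP2 => //; apply: pid_mem.
  by exists Qs; split=> // Q /h1[hQ JQ]; split=> // a /Jz /JQ.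
have [Q1 [h1 h1']] := step x nx; have [Q2 [h2 h2']] := step y ny.
exists (Q1 ++ Q2); split.
  by move=> Q /(List.in_app_or _ _ _)[/h1|/h2].
apply/prodin_cat; rewrite -[1]mulr1; apply: prodin_mono h1' => w hw; rewrite mulr1 -[w]mul1r.
apply: prodin_mono h2' => v hv.
case: hw => [j [_ [Jj [a _ ->] ->]]]; case: hv => [j' [_ [Jj' [b _ ->] ->]]].
rewrite (_ : _ * _ = j * (j' + b * y) + (a * x) * j' + (a * b) * (x * y)); last by ring.
by apply: idealD => //; [apply: idealD => //; [apply: idealMr | apply: idealMl] | apply: idealMl].
Qed.

Lemma prime_contains_factor Qs J T z : is_prime T -> J `<=` T -> prodin Qs J z -> ~ T z ->
  exists2 Q, List.In Q Qs & Q `<=` T.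
Proof.
move=> hT JT; elim: Qs z => [|Q Qs IH] z /=; first by move=> /JT.
move=> h nTz; have [QT|/not_subP[x [Qx nTx]]] := pselect (Q `<=` T); first by exists Q => //; left.
have [||Q' hQ' Q'T] := IH (x * z); [exact: h | by case: hT => _ h' /h'[] | by exists Q' => //; right].
Qed.

Lemma prime_separating P Qs I : is_prime P -> ~ I `<=` P ->
  is_ideal I -> (forall Q, List.In Q Qs -> is_ideal Q) ->
  exists y, [/\ I y, ~ P y & forall Q, List.In Q Qs -> ~ Q `<=` P -> Q y].
Proof.
move=> hP hIP hI; elim: Qs => [|Q Qs IH] hQs; first by have [y [Iy nPy]] := not_subP hIP; exists y.
have [|y [Iy nPy hy]] := IH; first by move=> Q' h; apply: hQs; right.
have hQ : is_ideal Q by apply: hQs; left.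
have [QP|/not_subP[x [Qx nPx]]] := pselect (Q `<=` P).
  by exists y; split=> // Q' [<-|/hy].
exists (x * y); split; first exact: idealMl.
  by case: hP => _ h /h[].
move=> Q' [<- _|hin nQ']; first exact: idealMr.
by apply: idealMl; [apply: hQs; right | apply: hy].
Qed.

Lemma prime_avoidance Qs I : is_ideal I ->
  (forall Q, List.In Q Qs -> is_prime Q /\ ~ I `<=` Q) ->
  exists x, I x /\ forall Q, List.In Q Qs -> ~ Q x.
Proof.
move=> hI; elim: Qs => [|Q Qs IH] hQs; first by exists 0; split=> //; apply: ideal0.
have [|x [Ix hx]] := IH; first by move=> Q' h; apply: hQs; right.
have [hQ nIQ] := hQs Q (or_introl erefl).
have hid Q' : is_prime Q' -> is_ideal Q' by case=> -[].
have [Qx|nQx] := pselect (Q x); last by exists x; split=> // Q' [<-|/hx].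
(* [y] lies in every listed prime not inside [Q], so passing from [x] to [x + y] leaves [Q] without
   entering those; a prime inside [Q] is avoided together with [Q]. *)
have [|y [Iy nQy hy]] := @prime_separating Q Qs I hQ nIQ hI.
  by move=> Q' h; apply: hid; case: (hQs Q' (or_intror h)).
exists (x + y); split; first exact: idealD.
have nQxy : ~ Q (x + y).
  by move=> h; apply: nQy; rewrite -(addKr x y) addrC; apply: idealB => //; apply: hid.
move=> Q' [<- //|hin hxy].
have hQ' : is_ideal Q' by apply: hid; case: (hQs Q' (or_intror hin)).
have [Q'Q|nQ'Q] := pselect (Q' `<=` Q); first by apply: nQxy; apply: Q'Q.
apply: (hx _ hin); rewrite -(addrK y x); apply: idealB => //; exact: hy.
Qed.

End Noetherian.

Section IdealPowers.
Local Open Scope ring_scope.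
Local Open Scope classical_set_scope.
Variables (A : comNzRingType) (m : A -> Prop).
Hypothesis mI : is_ideal m.
Implicit Types (I J K : A -> Prop).

Lemma mpowS_sub k K : is_ideal K -> (forall a b, m a -> mpow m k b -> K (a * b)) ->
  mpow m k.+1 `<=` K.
Proof.
move=> hK h x; move ek : k.+1 => k' hx; elim: hx ek => // {x k'}.
- by move=> k' _; apply: ideal0.
- by move=> k' a b ma mb _ [e]; apply: h => //; rewrite e.
- by move=> k' x y _ hx _ hy e; apply: idealD => //; [apply: hx | apply: hy].
Qed.

Lemma mpow0T : mpow m 0 = setT.
Proof. by apply/predeqP => x; split=> // _; constructor. Qed.

Lemma mpow1E : mpow m 1 = m.
Proof.
apply/predeqP => x; split; last by move=> mx; rewrite -[x]mulr1; apply: mpow_mul => //; constructor.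
by apply: mpowS_sub => // a b ma _; apply: idealMr.
Qed.

Lemma mpowD_mul i j x y : mpow m i x -> mpow m j y -> mpow m (i + j) (x * y).
Proof.
move=> hx hy; elim: hx => {i x} [x|k|k a b ma mb IH|k a b _ ha _ hb].
- by apply: idealMl => //; apply: mpow_is_ideal.
- by rewrite mul0r; constructor.
- by rewrite -mulrA addSn; apply: mpow_mul.
- by rewrite mulrDl; apply: mpow_add.
Qed.

Lemma mpowSS k : mpow m k.+1 `<=` mpow m k.
Proof.
apply: mpowS_sub; first exact: mpow_is_ideal.
by move=> a b ma mb; apply: idealMl => //; apply: mpow_is_ideal.
Qed.

Lemma mpow_anti i j : (i <= j)%N -> mpow m j `<=` mpow m i.
Proof.
elim: j => [|j IH]; first by rewrite leqn0 => /eqP->.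
by rewrite leq_eqVlt => /orP[/eqP->//|/IH h] x /mpowSS /h.
Qed.

Lemma mpowD_sub i j K : is_ideal K ->
  (forall a b, mpow m i a -> mpow m j b -> K (a * b)) -> mpow m (i + j) `<=` K.
Proof.
elim: i K => [|i IH] K hK h x.
  by move=> hx; rewrite -[x]mul1r; apply: h => //; constructor.
rewrite addSn; apply: (mpowS_sub hK) => a b ma hb.
have hKa : is_ideal (colon K a) by apply: ideal_colon.
suff : colon K a b by rewrite mulrC => -[].
apply: IH hb => // u v hu hv; split=> //.
by rewrite mulrC mulrA; apply: h => //; apply: mpow_mul.
Qed.

Lemma mpow_exp x n : m x -> mpow m n (x ^+ n).
Proof. by move=> mx; elim: n => [|n IH]; [constructor | rewrite exprS; apply: mpow_mul]. Qed.

Lemma mpow_sub_id k : (0 < k)%N -> mpow m k `<=` m.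
Proof. by move=> hk x /(mpow_anti hk); rewrite mpow1E. Qed.

Lemma ideal_addmpow I n : is_ideal I -> is_ideal (addm I (mpow m n)).
Proof. by move=> hI; apply: ideal_add => //; apply: mpow_is_ideal. Qed.

(** The product ideal as the intersection of all ideals containing the products, so that sums of
    products are never written out. *)
Definition idmul I J : A -> Prop := fun x =>
  forall K, is_ideal K -> (forall a b, I a -> J b -> K (a * b)) -> K x.

Lemma ideal_idmul I J : is_ideal (idmul I J).
Proof.
split=> [K hK _|]; first exact: ideal0.
split=> [x y hx hy K hK h|r x hx K hK h]; first by apply: idealD => //; [apply: hx | apply: hy].
by apply: idealMl => //; apply: hx.
Qed.

Lemma idmul_gen I J a b : I a -> J b -> idmul I J (a * b).
Proof. by move=> Ia Jb K hK; apply. Qed.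

Lemma idmul_sub I J K : is_ideal K -> (forall a b, I a -> J b -> K (a * b)) -> idmul I J `<=` K.
Proof. by move=> hK h x; apply. Qed.

Lemma idmulT I J : I = setT -> is_ideal J -> idmul I J = J.
Proof.
move=> -> hJ; apply/predeqP => x; split; last by move=> Jx; rewrite -[x]mul1r; apply: idmul_gen.
by apply: idmul_sub => // a b _; apply: idealMl.
Qed.

Lemma idmul_span I gs : is_ideal I -> idmul I (span setT gs) `<=` span I gs.
Proof.
move=> hI; apply: idmul_sub; first by apply/smodT/smod_span/smodT.
move=> a b Ia; elim: gs b => [b ->|g gs IH b [_ [c [[s _ ->] hc ->]]]] /=; first by rewrite mulr0.
exists (a * (s * g)), (a * c); split; last by rewrite mulrDr.
  by exists (a * s); rewrite ?mulrA //; apply: idealMr.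
exact: IH.
Qed.

End IdealPowers.

(** * Hilbert's basis theorem for subrings *)

Section HilbertBasis.
Local Open Scope ring_scope.
Local Open Scope classical_set_scope.
Variable C : comNzRingType.
Implicit Types (S J : C -> Prop) (t : C).

Definition subnoetherian S : Prop := forall J : nat -> C -> Prop,
  (forall n, smod S (J n) /\ J n `<=` S) -> (forall n, J n `<=` J n.+1) ->
  exists N, forall n, (N <= n)%N -> J n `<=` J N.

Fixpoint low S t k : C -> Prop :=
  if k is k'.+1 then addm (cyc S (t ^+ k')) (low S t k') else (fun x => x = 0).

Definition adj S t : C -> Prop := fun x => exists k, low S t k x.

Lemma smod_low S t k : is_subring S -> smod S (low S t k).
Proof.
move=> hS; elim: k => [|k IH] /=; last by apply: smod_add => //; apply: smod_cyc; apply: smod_self.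
by split=> //; split=> [x y -> ->|s x _ ->]; rewrite ?addr0 ?mulr0.
Qed.

Lemma low_mono S t k l : is_subring S -> (k <= l)%N -> low S t k `<=` low S t l.
Proof.
move=> hS; elim: l => [|l IH]; first by rewrite leqn0 => /eqP->.
rewrite leq_eqVlt => /orP[/eqP->//|/IH h] x /h hx /=.
by apply: (addmP2 (S := S)) => //; apply: smod_cyc; apply: smod_self.
Qed.

Lemma low_mult S t k x : is_subring S -> low S t k x -> low S t k.+1 (t * x).
Proof.
move=> hS; elim: k x => [x ->|k IH x [_ [b [[s Ss ->] hb ->]]]].
  by rewrite mulr0; apply: smod0 (smod_low _ _ hS).
exists (s * t ^+ k.+1), (t * b); split; [by exists s | exact: IH | by rewrite exprS; ring].
Qed.

Lemma low_multX S t k l x : is_subring S -> low S t k x -> low S t (l + k) (t ^+ l * x).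
Proof.
move=> hS hx; elim: l => [|l IH]; first by rewrite expr0 mul1r.
by rewrite exprS -mulrA addSn; apply: low_mult.
Qed.

Lemma adj_subring S t : is_subring S -> is_subring (adj S t).
Proof.
move=> hS; split.
- by exists 1%N, 1, 0; rewrite addr0; split=> //; exists 1; rewrite ?mulr1 //; apply: subring1.
- move=> x y [k hk] [l hl]; exists (maxn k l); apply: (smodB hS (smod_low _ _ hS)).
    by apply: (low_mono _ _ hk) => //; apply: leq_maxl.
  by apply: (low_mono _ _ hl) => //; apply: leq_maxr.
- move=> x y [k hk] [l hl]; exists (k + l)%N; elim: k x hk => [x ->|k IH x [_ [b [[s Ss ->] hb ->]]]].
    by rewrite mul0r; apply: smod0 (smod_low _ _ hS).
  rewrite mulrDl; apply: (smodD (smod_low _ _ hS)).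
    rewrite -mulrA; apply: (smodM (smod_low _ _ hS)) => //.
    by apply: (low_mono (k := k + l)) => //; apply: low_multX.
  by apply: (low_mono (k := k + l)) => //; apply: IH.
Qed.

Lemma sub_adj S t : S `<=` adj S t.
Proof. by move=> x Sx; exists 1%N, x, 0; rewrite addr0; split=> //; exists x; rewrite ?mulr1. Qed.

Lemma adj_gen S t : is_subring S -> adj S t t.
Proof.
move=> hS; exists 2%N, t, 0; rewrite addr0; split=> //.
  by exists 1; rewrite ?mul1r //; apply: subring1.
by apply: smod0 (smod_low t 1 hS).
Qed.

(* Hilbert's basis theorem, by comparing the ideals of leading coefficients; [t] need not be transcendental. *)
Lemma subnoetherian_adj S t : is_subring S -> subnoetherian S -> subnoetherian (adj S t).
Proof.
move=> hS nS J hJ hinc.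
have hlow k := smod_low t k hS.
pose L n k a := S a /\ exists2 y, low S t k y & J n (a * t ^+ k + y).
have hJn n : smod (adj S t) (J n) by case: (hJ n).
have hJS n : smod S (J n) by apply: smod_scal (hJn n); apply: sub_adj.
have hL n k : smod S (L n k) /\ L n k `<=` S.
  split; last by move=> a [].
  split; first by split; [apply: subring0 | exists 0; [apply: smod0 (hlow k) | rewrite mul0r addr0; apply: smod0 (hJn n)]].
  split=> [a b [Sa [y hy Jy]] [Sb [z hz Jz]]|s a Ss [Sa [y hy Jy]]].
    split; first exact: subringD.
    exists (y + z); first exact: smodD (hlow k) _ _.
    rewrite (_ : _ + _ = (a * t ^+ k + y) + (b * t ^+ k + z)); last by ring.
    exact: smodD (hJn n) _ _.
  split; first exact: subringM.
  exists (s * y); first exact: smodM (hlow k) _ _.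
  rewrite (_ : _ + _ = s * (a * t ^+ k + y)); last by ring.
  exact: smodM (hJS n) _ _.
have Lk n k : L n k `<=` L n k.+1.
  move=> a [Sa [y hy Jy]]; split=> //; exists (t * y); first exact: low_mult.
  rewrite (_ : _ + _ = t * (a * t ^+ k + y)); last by rewrite exprS; ring.
  by apply: smodM (hJn n) _ _ => //; apply: adj_gen.
have Jmono i j : (i <= j)%N -> J i `<=` J j.
  elim: j => [|j IH]; first by rewrite leqn0 => /eqP->.
  by rewrite leq_eqVlt => /orP[/eqP->//|/IH h] x /h /hinc.
have Lmono n n' k k' : (n <= n')%N -> (k <= k')%N -> L n k `<=` L n' k'.
  move=> hn hk a ha.
  have {}ha : L n' k a.
    by case: ha => Sa [y hy Jy]; split=> //; exists y => //; apply: Jmono Jy.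
  elim: k' hk => [|k' IH]; first by rewrite leqn0 => /eqP <-.
  by rewrite leq_eqVlt => /orP[/eqP <- //|/IH]; apply: Lk.
(* The diagonal chain controls all degrees at least [N0]; the finitely many lower degrees are
   stabilised one by one below. *)
have [N0 hN0] := nS (fun n => L n n) (fun n => hL n n) (fun n => Lmono _ _ _ _ (leqnSn n) (leqnSn n)).
have [N [hN hNk]] : exists N, (N0 <= N)%N /\ forall k, (k < N0)%N -> forall n, (N <= n)%N -> L n k `<=` L N k.
  elim: {2}N0 => [|k [N [hN hNk]]]; first by exists N0.
  have [Nk hk] := nS (fun n => L n k) (fun n => hL n k) (fun n => Lmono _ _ _ _ (leqnSn n) (leqnn k)).
  exists (maxn N Nk); split; first by apply: leq_trans hN (leq_maxl _ _).
  move=> j; rewrite ltnS leq_eqVlt => /orP[/eqP->|hj] n hn a ha.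
    by apply: (Lmono Nk) (leqnn k) _ _; [apply: leq_maxr | apply: (hk n) => //; apply: leq_trans (leq_maxr _ _) hn].
  by apply: (Lmono N) (leqnn j) _ _; [apply: leq_maxl | apply: (hNk j hj n) => //; apply: leq_trans (leq_maxl _ _) hn].
exists N => n hn.
have hLn k : L n k `<=` L N k.
  have [hk|hk] := ltnP k N0; first exact: hNk.
  move=> a ha; apply: (Lmono N0 N N0 k) => //; apply: (hN0 (maxn n k)).
    by apply: leq_trans hk (leq_maxr _ _).
  by apply: Lmono ha; [apply: leq_maxl | apply: leq_maxr].
move=> x Jx; have [k hk] : adj S t x by case: (hJ n) => _; apply.
elim: k x Jx hk => [x _ ->|k IH x Jx [_ [y [[a Sa ->] hy e]]]]; first exact: smod0 (hJn N).
have [_ [z hz Jz]] : L N k a by apply: hLn; split=> //; exists y => //; rewrite -e.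
rewrite (_ : x = (a * t ^+ k + z) + (y - z)); last by rewrite e; ring.
apply: smodD (hJn N) _ _ => //; apply: IH; last exact: smodB (hlow k) _ _.
rewrite (_ : y - z = x - (a * t ^+ k + z)); last by rewrite e; ring.
by apply: (smodB (adj_subring _ _) (hJn n)) => //; apply: Jmono Jz.
Qed.

End HilbertBasis.

(** * The Rees algebra and stable filtrations *)

Section Rees.
Local Open Scope ring_scope.
Local Open Scope classical_set_scope.
Variables (A : comNzRingType) (m : A -> Prop).
Hypotheses (mI : is_ideal m) (noethA : noetherian A).
Implicit Types (I K : A -> Prop).

(** When [ts] generates [m] this is the Rees algebra, the polynomials whose coefficient of [X^i]
    lies in [m^i]. Adjoining the [t X] one at a time makes the basis theorem applicable. *)
Definition rees_gen (ts : seq A) : {poly A} -> Prop :=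
  foldr (fun t S => adj S (t *: 'X)) (fun f => exists a, f = a%:P) ts.

Lemma rees_subring ts : is_subring (rees_gen ts).
Proof.
elim: ts => [|t ts IH] /=; last exact: adj_subring.
split; first by exists 1.
  by move=> _ _ [a ->] [b ->]; exists (a - b); rewrite polyCB.
by move=> _ _ [a ->] [b ->]; exists (a * b); rewrite polyCM.
Qed.

Lemma rees_noetherian ts : subnoetherian (rees_gen ts).
Proof.
elim: ts => [|t ts IH] /=; last by apply: subnoetherian_adj => //; apply: rees_subring.
move=> J hJ hinc.
have [||N hN] := noethA (I := fun n a => J n a%:P).
- move=> n; have [[h0 [hD hM]] _] := hJ n; split; first by rewrite polyC0.
  by split=> [x y Jx Jy|r x Jx]; [rewrite polyCD; apply: hD | rewrite polyCM; apply: hM => //; exists r].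
- by move=> n x; apply: hinc.
exists N => n hn f Jf; have [_ h] := hJ n; have [a e] := h f Jf.
by rewrite e; apply: (hN n) => //; rewrite -e.
Qed.

Lemma rees_const ts a : rees_gen ts a%:P.
Proof. by elim: ts => [|t ts IH] /=; [exists a | apply: sub_adj]. Qed.

Lemma rees_coef ts f i : (forall t, t \in ts -> m t) -> rees_gen ts f -> mpow m i f`_i.
Proof.
elim: ts f i => [|t ts IH] f i hts /=.
  move=> [a ->]; rewrite coefC; case: eqP => [->|_]; first by constructor.
  by apply: ideal0; apply: mpow_is_ideal.
have mt : m t by apply: hts; rewrite mem_head.
have {}IH g j : rees_gen ts g -> mpow m j g`_j.
  by apply: IH => t' h; apply: hts; rewrite inE h orbT.
move=> [k]; elim: k f i => [f i ->|k IHk f i [_ [g [[s Ss ->] hg ->]]]].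
  by rewrite coef0; apply: ideal0; apply: mpow_is_ideal.
rewrite coefD; apply: idealD; [exact: mpow_is_ideal | | exact: IHk].
rewrite exprZn -scalerAr coefZ coefMXn; case: ltnP => hi.
  by rewrite mulr0; apply: ideal0; apply: mpow_is_ideal.
by rewrite -[X in mpow m X](subnKC hi); apply: mpowD_mul => //; [apply: mpow_exp | apply: IH].
Qed.

Lemma rees_mpow ts a k : m = span setT ts -> mpow m k a -> rees_gen ts (a *: 'X^k).
Proof.
move=> e; have hts := rees_subring ts.
have gen1 b : m b -> rees_gen ts (b *: 'X).
  have -> : m b <-> span setT ts b by rewrite -e.
  elim: {e hts}ts b => [b ->|t ts IH b [_ [c [[s _ ->] hc ->]]]] /=; first by rewrite scale0r; apply: subring0 (rees_subring [::]).
  have hs := adj_subring (t *: 'X) (rees_subring ts).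
  rewrite scalerDl; apply: (subringD hs); last by apply: sub_adj; apply: IH.
  rewrite -scalerA -[s *: _]mul_polyC; apply: (subringM hs); last by apply: adj_gen; apply: rees_subring.
  by apply: sub_adj; apply: rees_const.
elim=> {k a} [x|k|k a b ma mb IH|k x y _ hx _ hy].
- by rewrite expr0 alg_polyC; apply: rees_const.
- by rewrite scale0r; apply: subring0.
- rewrite exprS -scalerA (_ : _ *: _ = (a *: 'X) * (b *: 'X^k)); last by rewrite -scalerAl -scalerAr.
  by apply: (subringM hts) => //; apply: gen1.
- by rewrite scalerDl; apply: (subringD hts).
Qed.

Lemma idmul_mpow_add i j I : idmul (mpow m (i + j)) I `<=` idmul (mpow m i) (idmul (mpow m j) I).
Proof.
apply: idmul_sub; first exact: ideal_idmul.
move=> a b ha Ib.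
have hK : is_ideal (colon (idmul (mpow m i) (idmul (mpow m j) I)) b).
  by apply: ideal_colon; apply: ideal_idmul.
suff [] : colon (idmul (mpow m i) (idmul (mpow m j) I)) b a by [].
apply: (mpowD_sub hK _ ha) => x y hx hy; split=> //.
by rewrite -mulrA; apply: idmul_gen => //; apply: idmul_gen.
Qed.

Lemma idmul_mono I I' K K' : I `<=` I' -> K `<=` K' -> idmul I K `<=` idmul I' K'.
Proof.
move=> h h'; apply: idmul_sub; first exact: ideal_idmul.
by move=> a b /h ? /h' ?; apply: idmul_gen.
Qed.

Variable J : nat -> A -> Prop.
Hypotheses (hJ : forall k, is_ideal (J k)) (Jm : forall k, J k `<=` mpow m k).
Hypothesis (mJ : forall k a b, m a -> J k b -> J k.+1 (a * b)).

Let mpowJ i k a b : mpow m i a -> J k b -> J (i + k) (a * b).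
Proof.
move=> ha hb; elim: ha => {i a} [x|i|i a c ma mc IH|i x y _ hx _ hy].
- exact: idealMl.
- by rewrite mul0r; apply: ideal0.
- by rewrite -mulrA addSn; apply: mJ.
- by rewrite mulrDl; apply: idealD.
Qed.

(** Degree [k] of the part generated in degrees up to [n]: it is [J k] for [k <= n] and
    [m^(k-n) J_n] beyond. Truncated subtraction and [minn] merge the two cases. *)
Let E n k := idmul (mpow m (k - n)) (J (minn n k)).

Let Emul n i k a x : mpow m i a -> E n k x -> E n (k + i) (a * x).
Proof.
move=> ha; suff : E n k `<=` colon (E n (k + i)) a by move=> h /h [_]; rewrite mulrC.
apply: idmul_sub; first by apply: ideal_colon; apply: ideal_idmul.
move=> b c hb hc; split=> //; rewrite (_ : b * c * a = (a * b) * c); last by ring.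
have [hk|hk] := leqP n k.
  apply: idmul_gen; last by rewrite (minn_idPl hk) in hc; rewrite (minn_idPl (leq_trans hk (leq_addr _ _))).
  by rewrite -addnBAC // addnC; apply: mpowD_mul.
rewrite (minn_idPr (ltnW hk)) in hc.
have {}hc : J k (b * c) by apply: idealMl.
rewrite -mulrA; move: (b * c) hc => {}c hc.
have [hki|hki] := leqP (k + i) n.
  have -> : E n (k + i) = J (k + i)%N.
    by rewrite /E (minn_idPr hki) (eqP hki) mpow0T idmulT.
  by rewrite addnC; apply: mpowJ.
have e : i = (k + i - n + (n - k))%N by lia.
have hK : is_ideal (colon (E n (k + i)) c) by apply: ideal_colon; apply: ideal_idmul.
suff [] : colon (E n (k + i)) c a by [].
rewrite e in ha; apply: (mpowD_sub hK _ ha) => u v hu hv; split=> //.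
rewrite -mulrA; apply: idmul_gen => //; rewrite (minn_idPl (ltnW hki)).
by rewrite -(subnK (ltnW hk)); apply: mpowJ.
Qed.

Let Einc n k : E n k `<=` E n.+1 k.
Proof.
rewrite /E; have [hk|hk] := leqP k n.
  by rewrite ?(minn_idPr hk) (minn_idPr (leqW hk)) (eqP hk) (eqP (leqW hk : k <= n.+1)%N).
rewrite ?(minn_idPl (ltnW hk)) (minn_idPl hk) => x.
have -> : (k - n = (k - n.+1) + 1)%N by lia.
move/idmul_mpow_add; apply: idmul_mono => //; apply: idmul_sub => //.
by rewrite mpow1E // => a b; apply: mJ.
Qed.

(* Stability of [m]-filtrations (Rees): the families [E n] filter the ideal [sum_k J_k X^k] of the Rees algebra, which is Noetherian. *)
Lemma stable_filtration : exists c, forall j, J (c + j)%N `<=` idmul (mpow m j) (J c).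
Proof.
have [ts ets] := noetherian_fg noethA mI.
have tsm t : t \in ts -> m t by move=> h; rewrite ets; apply: span_mem.
have [||N hN] := @rees_noetherian ts (fun n f => rees_gen ts f /\ forall k, E n k f`_k).
- move=> n; split; last by move=> f [].
  split; first by split; [apply: subring0; apply: rees_subring | move=> k; rewrite coef0; apply: ideal0; apply: ideal_idmul].
  split=> [f g [Sf Ef] [Sg Eg]|f g Sf [Sg Eg]]; split.
  + by apply: subringD => //; apply: rees_subring.
  + by move=> k; rewrite coefD; exact (idealD (ideal_idmul _ _) (Ef k) (Eg k)).
  + by apply: subringM => //; apply: rees_subring.
  + move=> k; rewrite coefM.
    have hE : smod setT (E n k) by apply/smodT/ideal_idmul.
    elim/big_ind: _ => [|x y hx hy|[i hi] _ /=]; [exact (smod0 hE) | exact (smodD hE hx hy) |].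
    by have := Emul (rees_coef i tsm Sf) (Eg (k - i)%N); rewrite subnK.
- by move=> n f [Sf Ef]; split=> // k; apply: Einc.
exists N => j b hb.
have Jb : mpow m (N + j) b by apply: Jm.
have [|_ h] := hN (N + j)%N (leq_addr _ _) (b *: 'X^(N + j)).
  split; first exact: rees_mpow.
  move=> k; rewrite coefZ coefXn; case: eqP => [->|_]; last by rewrite mulr0; apply: ideal0; apply: ideal_idmul.
  by rewrite mulr1 /E minnn subnn mpow0T idmulT.
have := h (N + j)%N; rewrite coefZ coefXn eqxx mulr1 /E addKn.
by rewrite (minn_idPl (leq_addr _ _)).
Qed.

End Rees.

(** * Local rings *)

Section ArtinRees.
Local Open Scope ring_scope.
Local Open Scope classical_set_scope.
Variables (A : comNzRingType) (m : A -> Prop).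
Hypotheses (noethA : noetherian A).
Implicit Types (I J K P : A -> Prop).

(** The filtration by the ideals [m^k ∩ I] is contained in [m^k], hence stable. *)
Lemma artin_rees I : is_ideal m -> is_ideal I ->
  exists c, forall j x, mpow m (c + j) x -> I x -> idmul (mpow m j) I x.
Proof.
move=> mI hI.
have [|||c hc] := @stable_filtration _ m mI noethA (fun k => capm (mpow m k) I).
- by move=> k; apply/smodT/smod_cap; apply/smodT => //; apply: mpow_is_ideal.
- by move=> k x [].
- by move=> k a b ma [hb Ib]; split; [apply: mpow_mul | apply: idealMl].
exists c => j x hx Ix; apply: idmul_mono (hc j x (conj hx Ix)) => //.
by move=> y [].
Qed.

Hypothesis hL : local_with_max m.

Lemma local_ideal : is_ideal m. Proof. by case: hL => -[]. Qed.

Lemma local_not1 : ~ m 1. Proof. by case: hL => -[]. Qed.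

Let mI := local_ideal.

Lemma local_unit x : ~ m x -> exists r, r * x = 1.
Proof.
move=> nx; apply: contrapT => h; apply: nx; case: hL => _ /(_ (pid x)); apply; last exact: pid_mem.
by split; [apply: ideal_pid | move=> [r _ e]; apply: h; exists r].
Qed.

Lemma local_proper I : is_ideal I -> ~ I 1 -> I `<=` m.
Proof. by move=> hI nI; case: hL => _; apply. Qed.

Lemma local_prime : is_prime m.
Proof.
split; first by case: hL.
move=> x y mxy; have [|nx] := pselect (m x); first by left.
by right; have [r e] := local_unit nx; rewrite -[y]mul1r -e -mulrA; apply: idealMl.
Qed.

Lemma simple_maximal : simple setT m setT.
Proof.
split; first by split=> //; exists 1; split=> //; apply: local_not1.
move=> y _ ny x _; have [r e] := local_unit ny.
by apply: idealP2 => //; exists (x * r) => //; rewrite -mulrA e mulr1.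
Qed.

Lemma colen_maximal : fincol m /\ colen m = 1%N.
Proof. by apply: fin_len_simple simple_maximal => //; apply/smodT. Qed.

Lemma fincol_mpow k : fincol (mpow m k).
Proof.
elim: k => [|k IH]; first by rewrite mpow0T; apply: finxx.
have hk := mpow_is_ideal mI; have [gs e] := noetherian_fg noethA (hk k).
have [f1 _] := colen_maximal.
have hs i : smod setT (mpow m i) by apply/smodT/mpow_is_ideal.
have hm : smod setT m by apply/smodT.
have hT : smod setT (setT : set A) by [].
apply: (@fin_cat _ setT _ (mpow m k)) => //; first exact: mpowSS.
have mg g s : g \in gs -> m s -> mpow m k.+1 (s * g).
  by move=> hg ms; apply: mpow_mul => //; rewrite e; exact: span_mem.
have [f _] := fin_span_le (@subringT A) hT (hs k.+1) hm (fun _ _ => I) mg f1.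
by apply: (fin_le _ _ f) => // x; rewrite e; apply: idealP2.
Qed.

Lemma nakayama I : is_ideal I -> I `<=` idmul m I -> I = (fun x => x = 0).
Proof.
move=> hI; have [gs ->] := noetherian_fg noethA hI.
elim: gs => [//|g gs IH] h.
suff e : span setT (g :: gs) = span setT gs by rewrite e; apply: IH; rewrite -e.
suff hg : span setT gs g.
  apply/predeqP => x; split; last by apply: idealP2; apply: ideal_pid.
  by apply: ideal_add_sub => //; [apply: ideal_span | apply: pid_sub => //; apply: ideal_span].
have [_ [b [[s ms ->] hb e]]] : span m (g :: gs) g.
  by apply: idmul_span => //; apply: h; apply: span_mem => //; rewrite mem_head.
have [|r er] := @local_unit (1 - s).
  by move=> h1; apply: local_not1; rewrite -(subrK s 1); apply: idealD.
rewrite -[g]mul1r -er -mulrA mulrBl mul1r {1}e [s * g + b]addrC addrK.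
by apply: idealMl; [apply: ideal_span | apply: (spanS (J' := setT)) hb].
Qed.

Lemma krull_intersection x : (forall k, mpow m k x) -> x = 0.
Proof.
pose I x := forall k, mpow m k x.
have hI : is_ideal I.
  split=> [k|]; first by apply: ideal0; apply: mpow_is_ideal.
  by split=> [a b ha hb k|r a ha k]; [apply: idealD | apply: idealMl] => //; apply: mpow_is_ideal.
suff e : I = (fun x => x = 0) by move=> h; have : I x by []; rewrite e.
have [c hc] := artin_rees mI hI.
apply: nakayama => // y Iy; rewrite -(mpow1E mI); exact: (hc 1%N).
Qed.

End ArtinRees.

Lemma leq_exp2r_weak (a b d : nat) : (a <= b)%N -> (a ^ d <= b ^ d)%N.
Proof. by move=> h; case: d => [|d]; [rewrite !expn0 | rewrite leq_exp2r]. Qed.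

(** * Hilbert functions *)

Section HilbertFunctions.
Local Open Scope ring_scope.
Local Open Scope classical_set_scope.
Variables (A : comNzRingType) (m : A -> Prop).
Hypotheses (noethA : noetherian A) (hL : local_with_max m).
Implicit Types (I J K P Q : A -> Prop).

Let mI := local_ideal hL.
Let hpow k := mpow_is_ideal mI k.

Definition has_chain d J : Prop := exists P : nat -> A -> Prop, prime_chain P d /\ J `<=` P 0%N.

Lemma has_chain_cons d J Q (T : nat -> A -> Prop) : is_prime Q -> J `<=` Q -> strict_sub Q (T 0%N) ->
  prime_chain T d -> has_chain d.+1 J.
Proof.
move=> hQ JQ QT [h1 h2]; exists (fun i => if i is i'.+1 then T i' else Q); split=> //.
split; first by case=> // i hi; apply: h1.
by case=> // i hi; apply: h2.
Qed.

Lemma fincol_addmpow I n : is_ideal I -> fincol (addm I (mpow m n)).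
Proof. by move=> hI; apply: fincol_le (fincol_mpow noethA hL n); apply: idealP2. Qed.

Lemma colen_proper I : is_ideal I -> ~ I 1 -> fincol I -> (0 < colen I)%N.
Proof.
move=> hI nI hf; have [f1 e1] := colen_maximal hL.
by rewrite -e1; apply: colen_le => //; apply: local_proper.
Qed.

Lemma prodin_mpow Qs J z : is_ideal J -> (forall Q, List.In Q Qs -> m `<=` Q) ->
  prodin Qs J z -> mpow m (size Qs) `<=` colon J z.
Proof.
move=> hJ; elim: Qs z => [|Q Qs IH] z hQs /=.
  by move=> Jz x _; split=> //; apply: idealMl.
move=> h; apply: mpowS_sub; first exact: ideal_colon.
move=> a b ma hb; have Qa : Q a by apply: hQs ma; left.
have [|_] := IH (a * z) _ (h a Qa) b hb; first by move=> Q' h'; apply: hQs; right.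
by rewrite mulrA [b * a]mulrC => ?; split.
Qed.

(** Induction on [d]. Choose [x] in [m] outside every prime factor of [J] other than [m]. A chain
    above [J + (x)] starts at a prime that properly contains such a factor and so could be
    prolonged; hence the dimension drops. As [x^n] lies in [m^n], [colen_nilpotent] costs one factor
    [n]. *)
Lemma colen_upper d J : is_ideal J -> ~ has_chain d J ->
  exists C, forall n, (n * colen (addm J (mpow m n)) <= C * n ^ d)%N.
Proof.
elim: d J => [|d IH] J hJ nch.
  have [J1|nJ1] := pselect (J 1).
    exists 0%N => n; rewrite (_ : addm _ _ = setT) ?/colen ?lenxx ?muln0 //.
    by apply: ideal1; [apply: ideal_addmpow | apply: idealP1].
  exfalso; apply: nch; exists (fun=> m); split; last exact: local_proper.
  by split=> // i _; apply: local_prime.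
have [Qs [hQs hprod]] := prime_product noethA hJ.
have Qm Q : is_prime Q -> Q `<=` m.
  by move=> [[hQ nQ] _]; apply: local_proper.
(* In dimension zero a chain above [J + (x)] may consist of [m] alone, and the choice of [x] gains
   nothing. Instead all factors contain [m], so a power of [m] lies in [J]. *)
have [d0|d0] := posnP d.
  subst d; have hall Q : List.In Q Qs -> m `<=` Q.
    move=> /hQs [hQ JQ]; apply: contrapT => /not_subP hx; apply: nch.
    apply: (@has_chain_cons 0 J Q (fun=> m)) => //; first by split=> //; apply: Qm.
    by split=> // i _; apply: local_prime.
  have hr : mpow m (size Qs) `<=` J.
    by move=> x /(prodin_mpow hJ hall hprod)[_]; rewrite mulr1.
  exists (colen (mpow m (size Qs))) => n; rewrite expn1 mulnC leq_mul2r; apply/orP; right.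
  apply: colen_le; last exact: fincol_mpow.
  by move=> x /hr; apply: idealP1.
have [x [mx hx]] : exists x, m x /\ forall Q, List.In Q Qs -> ~ m `<=` Q -> ~ Q x.
  have [Qs' [h1 h2]] : exists Qs', (forall Q, List.In Q Qs' -> List.In Q Qs /\ ~ m `<=` Q) /\
     (forall Q, List.In Q Qs -> ~ m `<=` Q -> List.In Q Qs').
    elim: {hQs hprod}Qs => [|Q Qs [Qs' [h1 h2]]]; first by exists [::].
    have [mQ|nmQ] := pselect (m `<=` Q).
      by exists Qs'; split=> [Q' /h1[h h']|Q' [<- //|]]; [split=> //; right | apply: h2].
    exists (Q :: Qs'); split=> [Q' [<-|/h1[h h']]|Q' [<-|h] h'].
    - by split=> //; left.
    - by split=> //; right.
    - by left.
    - by right; apply: h2.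
  have [|x [mx hx]] := @prime_avoidance A Qs' m mI.
    by move=> Q /h1[/hQs[hQ _] h].
  by exists x; split=> // Q hQ hmQ; apply: hx; apply: h2.
have hJx : is_ideal (addm J (pid x)) by apply: ideal_add => //; apply: ideal_pid.
have [|C hC] := IH (addm J (pid x)) hJx.
  move=> [T [hT JT]]; have hT0 : is_prime (T 0%N) by case: hT => h _; apply: h.
  have JT0 : J `<=` T 0%N by move=> y Jy; apply: JT; apply: idealP1 Jy; apply: ideal_pid.
  have [|Q hQ QT] := prime_contains_factor hT0 JT0 hprod; first by case: hT0 => [[]].
  have [hQ' JQ] := hQs Q hQ.
  have Tx : T 0%N x by apply: JT; apply: idealP2 => //; apply: pid_mem.
  have [mQ|nmQ] := pselect (m `<=` Q).
    have [_ [y [Ty nTy]]] : strict_sub (T 0%N) (T 1%N) by case: hT => _ h; apply: h.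
    by apply: nTy; apply/QT/mQ; apply: (Qm (T 1%N)) => //; case: hT => h _; apply: h.
  apply: nch; apply: (@has_chain_cons d J Q T) => //.
  by split=> //; exists x; split=> //; apply: hx.
exists C => n; have hI := ideal_addmpow mI n hJ.
have hf := fincol_addmpow n hJ.
have xn : addm J (mpow m n) (x ^+ n) by apply: idealP2 => //; apply: mpow_exp.
have h := colen_nilpotent hI hf xn.
have e : addm (addm J (mpow m n)) (pid x) = addm (addm J (pid x)) (mpow m n).
  by rewrite -!addmA (addmC (mpow m n)).
rewrite e in h; apply: leq_trans (leq_mul (leqnn n) h) _.
by rewrite expnS mulnCA leq_mul2l hC orbT.
Qed.

(** Artin-Rees for [P + (x)], followed by cancellation of [x] modulo [P]: multiplication by [x] on
    the domain [A/P] loses only a bounded number of powers of [m]. *)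
Lemma colon_prime_addmpow P x : is_prime P -> ~ P x ->
  exists c, forall j, colon (addm P (mpow m (c + j))) x `<=` addm P (mpow m j).
Proof.
move=> hP nPx; have hPi : is_ideal P by case: hP => -[].
pose I := addm P (pid x); have hI : is_ideal I by apply: ideal_add => //; apply: ideal_pid.
have [c hc] := artin_rees noethA mI hI; exists c => j y [_ [a [b [Pa hb e]]]].
have Ib : I b.
  rewrite (_ : b = y * x - a); last by rewrite e; ring.
  apply: idealB => //; first by apply: idealP2 => //; exists y.
  by apply: idealP1 => //; apply: ideal_pid.
have : addm P (cyc (mpow m j) x) b.
  move: (hc j b hb Ib); apply: idmul_sub.
    by apply: ideal_add => //; apply/smodT/smod_cyc/smodT.
  move=> u _ hu [p [_ [Pp [r _ ->] ->]]]; exists (u * p), (u * r * x); split; last by ring.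
    exact: idealMl.
  by exists (u * r) => //; apply: idealMr.
move=> [p [_ [Pp [u hu ->] e']]]; exists (y - u), u; split=> //; last by ring.
case: hP => _ /(_ (y - u) x) [|//|//].
rewrite (_ : _ * x = a + p); first exact: idealD.
by rewrite mulrBl e e'; ring.
Qed.

(** For [x] in [P_1] but not in [P_0], put [b n] for the colength of [P_0 + m^n]. Multiplication by
    [x] gives [b(c+j) >= b(j)] plus the colength of [P_0 + (x) + m^(c+j)], which is of order at
    least [(c+j)^d] by induction. Adding up about [n/c] such increments raises the order by one. *)
Lemma colen_lower d (P : nat -> A -> Prop) : prime_chain P d ->
  exists K : nat, forall n, (0 < n)%N -> (n ^ d <= K * colen (addm (P 0%N) (mpow m n)))%N.
Proof.
elim: d P => [|d IH] P [hP hs].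
  exists 1%N => n hn; rewrite expn0 mul1n.
  have [[hP0 nP0] _] := hP 0%N isT; apply: colen_proper.
  - exact: ideal_addmpow.
  - move=> h; apply: (local_not1 hL); move: h; apply: ideal_add_sub => //.
      exact: local_proper.
    exact: mpow_sub_id.
  - exact: fincol_addmpow.
have hP0 := hP 0%N isT; have hP1 := hP 1%N isT.
have [h01 [x [P1x nP0x]]] := hs 0%N isT.
have hP0i : is_ideal (P 0%N) by case: hP0 => -[].
have hP1i : is_ideal (P 1%N) by case: hP1 => -[].
have [|K hK] := IH (fun i => P i.+1).
  by split=> i hi; [apply: hP | apply: hs].
have [c0 hc0] := colon_prime_addmpow hP0 nP0x.
(* The successor makes [c] positive, since the index advances by [c] and is later divided by
   [2 * c]. *)
pose c := c0.+1.
have hc j : colon (addm (P 0%N) (mpow m (c + j))) x `<=` addm (P 0%N) (mpow m j).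
  move=> y hy; have := hc0 j.+1 y; rewrite addnS => /(_ hy).
  by apply: addmS => //; apply: mpowSS.
pose b n := colen (addm (P 0%N) (mpow m n)).
have hf n : fincol (addm (P 0%N) (mpow m n)) by apply: fincol_addmpow.
have hid n : is_ideal (addm (P 0%N) (mpow m n)) by apply: ideal_addmpow.
have bmono i j : (i <= j)%N -> (b i <= b j)%N.
  by move=> hij; apply: colen_le => //; apply: addmS => //; apply: mpow_anti.
have bpos n : (0 < n)%N -> (0 < b n)%N.
  move=> hn; apply: colen_proper => // h; apply: (local_not1 hL); move: h.
  by apply: ideal_add_sub => //; [case: hP0 => [[_ ?] _]; apply: local_proper | apply: mpow_sub_id].
have step j : ((c + j) ^ d + K * b j <= K * b (c + j))%N.
  rewrite /b (colen_step x (hid (c + j)%N) (hf _)) mulnDr addnC; apply: leq_add.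
    rewrite leq_mul2l; apply/orP; right; apply: colen_le; first exact: hc.
    by apply: fincol_le (hf (c + j)%N) => y hy; split=> //; apply: idealMr.
  apply: leq_trans (hK (c + j)%N _) _ => //; rewrite leq_mul2l; apply/orP; right; apply: colen_le.
    apply: ideal_add_sub; first exact: ideal_addmpow.
      by apply: addmS => //.
    by apply: pid_sub; [apply: ideal_addmpow | apply: idealP1].
  by apply: fincol_le (hf (c + j)%N); apply: idealP1; apply: ideal_pid.
have iter n i : (i * n ^ d + K * b (n * c) <= K * b (n * c + i * c))%N.
  elim: i => [|i IHi]; first by rewrite mul0n addn0.
  have := step (n * c + i * c)%N; rewrite (_ : c + _ = n * c + i.+1 * c)%N; last by lia.
  apply: leq_trans; rewrite mulSn -addnA; apply: leq_add => //.
  by apply: leq_exp2r_weak; lia.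
(* With [n] the integer part of [N/(2c)]: starting at [n c], [n] steps of size [c] stay below [N],
   each gaining at least [n^d], and [N <= 4 c n] once [n] is positive. The remaining [N] are smaller
   than [2c]; for them [K.+1] keeps the constant nonzero. *)
exists ((4 * c) ^ d.+1 * K.+1)%N => N hN.
pose n := (N %/ (2 * c))%N.
have h2c : (0 < 2 * c)%N by [].
have hNn : (N < n.+1 * (2 * c))%N by rewrite ltn_ceil.
have [n0|npos] := posnP n.
  rewrite n0 in hNn; rewrite -mulnA; apply: leq_trans (_ : (4 * c) ^ d.+1 * 1 <= _)%N.
    rewrite muln1; apply: leq_exp2r_weak; lia.
  by rewrite leq_mul2l muln_gt0 bpos // orbT.
apply: leq_trans (_ : (4 * c * n) ^ d.+1 <= _)%N.
  by apply: leq_exp2r_weak; nia.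
rewrite expnMn -mulnA leq_mul2l; apply/orP; right.
have hle : (n * c + n * c <= N)%N.
  by have := leq_divM N (2 * c); rewrite -/n; lia.
have := iter n n; rewrite -expnS => h.
apply: leq_trans (_ : K * b N <= _)%N; last by rewrite leq_mul2r leqnSn orbT.
apply: leq_trans (_ : K * b (n * c + n * c) <= _)%N; first by apply: leq_trans h; apply: leq_addr.
by rewrite leq_mul2l bmono // orbT.
Qed.

End HilbertFunctions.

(** * Completion *)

Section SuccessiveApproximation.
Local Open Scope ring_scope.
Local Open Scope classical_set_scope.
Variables (R : comNzRingType) (F Q : nat -> R -> Prop) (Lim : R -> Prop).
Hypotheses (hF : forall n, is_ideal (F n)) (sepF : forall x, (forall n, F n x) -> x = 0).
Hypothesis (hlim : forall r : nat -> R, (forall n, Q n (r n)) ->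
  exists2 x, Lim x & forall n, F n (x - \sum_(i < n) r i)).

(** The coefficients of each generator are summed as a series of their own. When the list is
    exhausted all terms vanish, and separatedness gives [x = 0]. *)
Lemma series_span gs (x : R) (y : nat -> R) : (forall n, span (Q n) gs (y n)) ->
  (forall n, F n (x - \sum_(i < n) y i)) -> span Lim gs x.
Proof.
elim: gs x y => [|g gs IH] x y /= hy hx.
  apply: sepF => n; have := hx n; rewrite big1 ?subr0 // => i _; exact: hy.
have [s hs] : exists s : nat -> R, forall n, Q n (s n) /\ span (Q n) gs (y n - s n * g).
  apply: (choice_ex (P := fun n s => Q n s /\ span (Q n) gs (y n - s * g))) => n.
  by case: (hy n) => _ [b [[s Qs ->] hb ->]]; exists s; rewrite addrC addKr.
have [|r Lr hr] := hlim (r := s); first by move=> n; case: (hs n).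
exists (r * g), (x - r * g); split; [by exists r | | by ring].
apply: (IH _ (fun n => y n - s n * g)) => n; first by case: (hs n).
rewrite sumrB -mulr_suml (_ : _ - _ = (x - \sum_(i < n) y i) - (r - \sum_(i < n) s i) * g); last by ring.
by apply: idealB => //; apply: idealMr.
Qed.

(** [D n] is the set of remainders allowed at stage [n]. The coefficient sets [Q] and [Lim] are
    parameters so that the same argument serves ideals of the completion and modules over the closed
    subrings [U]. *)
Lemma approximation_span gs (D : nat -> R -> Prop) :
  (forall n x, D n x -> exists2 y, span (Q n) gs y & D n.+1 (x - y)) ->
  (forall n, D n `<=` F n) -> forall x, D 0%N x -> span Lim gs x.
Proof.
move=> step DF x hx.
have [f hf] : exists f : nat * R -> R, forall p, D p.1 p.2 ->
    span (Q p.1) gs (f p) /\ D p.1.+1 (p.2 - f p).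
  apply: (choice_ex (P := fun p y => D p.1 p.2 -> span (Q p.1) gs y /\ D p.1.+1 (p.2 - y))) => -[n z] /=; have [h|h] := pselect (D n z); last by exists 0.
  by have [y h1 h2] := step n z h; exists y.
pose z := fix z n := if n is n'.+1 then z n' - f (n', z n') else x.
have hz n : D n (z n) by elim: n => [|n IH] //=; case: (hf (n, z n) IH).
apply: (@series_span gs x (fun n => f (n, z n))) => n; first by case: (hf (n, z n) (hz n)).
rewrite (_ : _ - _ = z n); first exact: DF.
elim: n => [|n IH] /=; first by rewrite big_ord0 subr0.
by rewrite big_ord_recr /= -IH; ring.
Qed.

End SuccessiveApproximation.

(** * The completion as a ring *)

Section CompletionRing.
Local Open Scope ring_scope.
Local Open Scope classical_set_scope.

Definition complete_wrt (R : comNzRingType) (m : R -> Prop) : Prop :=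
  forall r : nat -> R, (forall n, mpow m n (r n)) ->
  exists x, forall n, mpow m n (x - \sum_(i < n) r i).

Variables (A : comNzRingType) (m : A -> Prop).
Hypotheses (noethA : noetherian A) (hL : local_with_max m).
Let mI := local_ideal hL.
Let hpow k := mpow_is_ideal mI k.

Lemma cauchyB x y : cauchy m x -> cauchy m y -> cauchy m (fun n => x n - y n).
Proof.
move=> hx hy k; have [N hN] := hx k; have [N' hN'] := hy k.
exists (maxn N N') => n n'; rewrite !geq_max => /andP[h1 h2] /andP[h3 h4].
rewrite (_ : _ - _ = (x n - x n') - (y n - y n')); last by ring.
by apply: idealB => //; [apply: hN | apply: hN'].
Qed.

Lemma cauchyM x y : cauchy m x -> cauchy m y -> cauchy m (fun n => x n * y n).
Proof.
move=> hx hy k; have [N hN] := hx k; have [N' hN'] := hy k.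
exists (maxn N N') => n n'; rewrite !geq_max => /andP[h1 h2] /andP[h3 h4].
rewrite (_ : _ - _ = (x n - x n') * y n + x n' * (y n - y n')); last by ring.
by apply: idealD => //; [apply: idealMr => //; apply: hN | apply: idealMl => //; apply: hN'].
Qed.

Lemma cauchy_cst a : cauchy m (fun=> a).
Proof. by move=> k; exists 0%N => n n' _ _; rewrite subrr; apply: ideal0. Qed.

Lemma cauchy_null_sub x y : null_seq m x -> null_seq m y -> null_seq m (fun n => x n + y n).
Proof.
move=> h h' k; have [N hN] := h k; have [N' hN'] := h' k; exists (maxn N N') => n.
by rewrite geq_max => /andP[h1 h2]; apply: idealD => //; [apply: hN | apply: hN'].
Qed.

(** Cauchy sequences modulo null sequences, the very encoding of the statement, so that [lim]
    translates its predicates on sequences into ideals of [B]. Values of [lim] off Cauchy sequences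
    are arbitrary. *)
Lemma completion_exists : exists (B : comNzRingType) (iota : {rmorphism A -> B})
    (lim : (nat -> A) -> B),
  [/\ forall x y, cauchy m x -> cauchy m y -> lim (fun n => x n + y n) = lim x + lim y,
      forall x y, cauchy m x -> cauchy m y -> lim (fun n => x n * y n) = lim x * lim y,
      forall a, lim (fun=> a) = iota a,
      forall x, cauchy m x -> (lim x = 0 <-> null_seq m x)
    & forall b, exists2 x, cauchy m x & lim x = b].
Proof.
pose C : comNzRingType := (nat -> A).
have hS : @is_subring C (cauchy m).
  by split; [apply: cauchy_cst | apply: cauchyB | apply: cauchyM].
have [D [f [finj fS]]] := subring_ring_exists hS.
have hI : Defs.proper_ideal (fun d : D => null_seq m (f d)).
  split; last first.
    rewrite rmorph1 => /(_ 1%N)[N /(_ N (leqnn N))].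
    by rewrite mpow1E //; apply: local_not1.
  split; first by rewrite rmorph0 => k; exists 0%N => n _; apply: ideal0.
  split=> [x y hx hy|r x hx]; first by rewrite rmorphD; apply: cauchy_null_sub.
  rewrite rmorphM => k; have [N hN] := hx k; exists N => n hn.
  by apply: idealMl => //; apply: hN.
have [B [g [gsurj gker]]] := quotient_ring_exists hI.
have [s hs] : exists s : C -> D, forall x, cauchy m x -> f (s x) = x.
  apply: (choice_ex (P := fun x d => cauchy m x -> f d = x)) => x.
  have [h|h] := pselect (cauchy m x); last by exists 0.
  by have [d hd] := (fS x).1 h; exists d.
pose lim (x : C) := g (s x).
have limD x y : cauchy m x -> cauchy m y -> lim (fun n => x n + y n) = lim x + lim y.
  move=> hx hy; rewrite /lim -rmorphD; congr (g _); apply: finj.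
  rewrite rmorphD !hs //; have := cauchyB hx (cauchyB (cauchy_cst 0) hy).
  by congr cauchy; apply/funext => n; ring.
have limM x y : cauchy m x -> cauchy m y -> lim (fun n => x n * y n) = lim x * lim y.
  move=> hx hy; rewrite /lim -rmorphM; congr (g _); apply: finj.
  by rewrite rmorphM !hs //; apply: cauchyM.
have lim1 : lim (fun=> 1) = 1.
  rewrite /lim -(rmorph1 g); congr (g _); apply: finj; rewrite rmorph1 hs //.
  exact: cauchy_cst.
pose iota a := lim (fun=> a).
have iB : zmod_morphism iota.
  move=> a b; rewrite /iota; apply/eqP; rewrite -subr_eq opprK; apply/eqP.
  rewrite -limD; try exact: cauchy_cst.
  by congr lim; apply/funext => n; rewrite subrK.
have iM : monoid_morphism iota.
  by split=> // a b; rewrite /iota -limM //; apply: cauchy_cst.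
pose fa := GRing.isZmodMorphism.Build _ _ iota iB.
pose fm := GRing.isMonoidMorphism.Build _ _ iota iM.
pose io : {rmorphism A -> B} := HB.pack iota fa fm.
exists B, io, lim; split=> // [x hx|b]; first by rewrite /lim gker hs.
have [d <-] := gsurj b; exists (f d); first by apply/fS; exists d.
by rewrite /lim; congr (g _); apply: finj; rewrite hs //; apply/fS; exists d.
Qed.

End CompletionRing.

Section CompletionTheory.
Local Open Scope ring_scope.
Local Open Scope classical_set_scope.
Variables (A : comNzRingType) (m : A -> Prop).
Hypotheses (noethA : noetherian A) (hL : local_with_max m).
Variables (B : comNzRingType) (iota : {rmorphism A -> B}) (lim : (nat -> A) -> B).
Hypotheses
  (limD : forall x y, cauchy m x -> cauchy m y -> lim (fun n => x n + y n) = lim x + lim y)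
  (limM : forall x y, cauchy m x -> cauchy m y -> lim (fun n => x n * y n) = lim x * lim y)
  (lim_cst : forall a, lim (fun=> a) = iota a)
  (lim_eq0 : forall x, cauchy m x -> (lim x = 0 <-> null_seq m x))
  (lim_surj : forall b, exists2 x, cauchy m x & lim x = b).

Let mI := local_ideal hL.
Let hpow k : is_ideal (mpow m k) := mpow_is_ideal mI k.

Lemma limB x y : cauchy m x -> cauchy m y -> lim (fun n => x n - y n) = lim x - lim y.
Proof.
move=> hx hy; apply/eqP; rewrite -subr_eq opprK; apply/eqP; rewrite -limD //; last exact: cauchyB.
by congr lim; apply/funext => n; rewrite subrK.
Qed.

Lemma lim_eq x y : cauchy m x -> cauchy m y -> (lim x = lim y <-> seq_eqv m x y).
Proof.
move=> hx hy; rewrite /seq_eqv -lim_eq0; last exact: cauchyB.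
by rewrite limB //; split=> [->|/eqP]; [rewrite subrr | rewrite subr_eq0 => /eqP].
Qed.

(** The kernel of the map from [B] to [A/m^k]. Density and completeness are immediate for these
    ideals; that they are the powers of the maximal ideal of [B] is [closed_pow_mpow]. *)
Definition closed_pow k (b : B) : Prop :=
  exists x, [/\ cauchy m x, lim x = b & exists N, forall n, (N <= n)%N -> mpow m k (x n)].

Local Notation M := closed_pow.

Lemma closed_powE k x : cauchy m x -> M k (lim x) ->
  exists N, forall n, (N <= n)%N -> mpow m k (x n).
Proof.
move=> hx [y [hy e [N hN]]].
have [N' hN'] := (lim_eq hx hy).1 (esym e) k.
exists (maxn N N') => n; rewrite geq_max => /andP[h1 h2].
by rewrite -(subrK (y n) (x n)); apply: idealD => //; [apply: hN' | apply: hN].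
Qed.

Lemma closed_pow_ideal k : is_ideal (M k).
Proof.
split.
  exists (fun=> 0); split; [exact: cauchy_cst | by rewrite lim_cst rmorph0 |].
  by exists 0%N => n _; apply: ideal0.
split=> [_ _ [x [hx <- [N hN]]] [y [hy <- [N' hN']]]|r _ [x [hx <- [N hN]]]].
  have hxy : cauchy m (fun n => x n + y n).
    have := cauchyB hL hx (cauchyB hL (cauchy_cst hL 0) hy).
    by congr cauchy; apply/funext => n; rewrite sub0r opprK.
  exists (fun n => x n + y n); split=> //; first exact: limD.
  exists (maxn N N') => n; rewrite geq_max => /andP[h1 h2].
  by apply: idealD => //; [apply: hN | apply: hN'].
have [y hy <-] := lim_surj r; exists (fun n => y n * x n); split; first exact: cauchyM.
  exact: limM.
by exists N => n hn; apply: idealMl => //; apply: hN.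
Qed.
Let hM := closed_pow_ideal.

Lemma closed_pow_iota k a : M k (iota a) <-> mpow m k a.
Proof.
rewrite -lim_cst; split=> [/(closed_powE (cauchy_cst hL a))[N]|h]; first by apply.
by exists (fun=> a); split=> //; [apply: cauchy_cst | exists 0%N].
Qed.

Lemma closed_pow_anti i j : (i <= j)%N -> M j `<=` M i.
Proof.
move=> hij b [x [hx e [N hN]]]; exists x; split=> //; exists N => n hn.
exact: mpow_anti (hN n hn).
Qed.

Lemma closed_pow_sep b : (forall k, M k b) -> b = 0.
Proof.
have [x hx <-] := lim_surj b => h; apply/lim_eq0 => // k.
exact: closed_powE.
Qed.

Lemma closed_powM i j x y : M i x -> M j y -> M (i + j) (x * y).
Proof.
move=> [u [hu <- [N hN]]] [v [hv <- [N' hN']]].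
exists (fun n => u n * v n); split; [exact: cauchyM | exact: limM |].
exists (maxn N N') => n; rewrite geq_max => /andP[h1 h2].
by apply: mpowD_mul => //; [apply: hN | apply: hN'].
Qed.

Lemma closed_pow_dense k b : exists a, M k (b - iota a).
Proof.
have [x hx <-] := lim_surj b; have [N hN] := hx k; exists (x N).
rewrite -lim_cst -limB //; last exact: cauchy_cst.
exists (fun n => x n - x N); split=> //; first by apply: cauchyB => //; apply: cauchy_cst.
by exists N => n hn; apply: hN.
Qed.

Lemma closed_pow0 b : M 0 b.
Proof.
have [x hx <-] := lim_surj b; exists x; split=> //.
by exists 0%N => n _; constructor.
Qed.

Lemma closed_pow_complete (r : nat -> B) : (forall n, M n (r n)) ->
  exists2 x, (setT : B -> Prop) x & forall n, M n (x - \sum_(i < n) r i).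
Proof.
move=> hr; pose s n := \sum_(i < n) r i.
have [a ha] := choice_ex (fun n => closed_pow_dense n (s n)).
have has n n' : (n <= n')%N -> M n (s n' - s n).
  elim: n' => [|n' IH]; first by rewrite leqn0 => /eqP->; rewrite subrr; apply: ideal0.
  rewrite leq_eqVlt => /orP[/eqP->|hn]; first by rewrite subrr; apply: ideal0.
  rewrite {1}/s big_ord_recr /= addrAC; apply: idealD => //; first exact: IH.
  by apply: closed_pow_anti (hr n').
have haa n n' : (n <= n')%N -> mpow m n (a n' - a n).
  move=> h; apply/closed_pow_iota; rewrite rmorphB /=.
  rewrite (_ : _ - _ = (s n' - s n) + (s n - iota (a n)) - (s n' - iota (a n'))); last by ring.
  apply: idealB => //; first by apply: idealD => //; apply: has.
  exact: closed_pow_anti (ha n').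
have hca : cauchy m a.
  move=> k; exists k => n n' h1 h2.
  rewrite (_ : _ - _ = (a n - a k) - (a n' - a k)); last by ring.
  by apply: idealB => //; apply: haa.
exists (lim a) => // n.
rewrite (_ : _ - _ = (lim a - iota (a n)) - (s n - iota (a n))); last by rewrite /s; ring.
apply: idealB => //; rewrite -lim_cst -limB //; last exact: cauchy_cst.
exists (fun k => a k - a n); split=> //; first by apply: cauchyB => //; apply: cauchy_cst.
by exists n => k; apply: haa.
Qed.

Lemma closed_pow_mpow_iota k a : mpow m k a -> mpow (M 1) k (iota a).
Proof.
elim=> {k a} [x|k|k a b ma mb IH|k x y _ hx _ hy]; first by constructor.
- by rewrite rmorph0; constructor.
- by rewrite rmorphM; apply: mpow_mul => //; apply/closed_pow_iota; rewrite mpow1E.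
- by rewrite rmorphD; apply: mpow_add.
Qed.

Lemma span_iota j ts a : span (mpow m j) ts a -> span (M j) [seq iota t | t <- ts] (iota a).
Proof.
elim: ts a => [a ->|t ts IH a [_ [b [[s hs ->] hb ->]]]] /=; first by rewrite rmorph0.
exists (iota (s * t)), (iota b); split; last by rewrite rmorphD.
  by exists (iota s); rewrite ?rmorphM //; apply/closed_pow_iota.
exact: IH.
Qed.

Lemma closed_pow_span k ts : mpow m k = span setT ts -> M k `<=` span setT [seq iota t | t <- ts].
Proof.
move=> ets b hb.
apply: (@approximation_span _ M M setT hM closed_pow_sep closed_pow_complete _ (fun n => M (k + n)%N)); last by rewrite addn0.
- move=> n x hx; have [a ha] := closed_pow_dense (k + n).+1 x.
  have hma : mpow m (k + n) a.
    apply/closed_pow_iota; rewrite -(subKr x (iota a)); apply: idealB => //.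
    exact: closed_pow_anti ha.
  exists (iota a); last by rewrite addnS.
  apply: span_iota; rewrite addnC in hma.
  have hK : is_ideal (span (mpow m n) ts) by apply/smodT/smod_span/smodT.
  apply: (mpowD_sub hK _ hma) => u v hu hv.
  by apply: idmul_span => //; apply: idmul_gen => //; rewrite -ets.
- by move=> n; apply: closed_pow_anti; apply: leq_addl.
Qed.

Lemma closed_pow_mpow k : M k = mpow (M 1) k.
Proof.
apply/predeqP => b; split.
  have [ts ets] := noetherian_fg noethA (hpow k).
  move/(closed_pow_span ets); apply: span_sub; first by apply/smodT/mpow_is_ideal.
  move=> _ /mapP[t ht ->]; apply: closed_pow_mpow_iota; rewrite ets; exact: span_mem.
elim=> {k b} [x|k|k a b ha hb IH|k x y _ hx _ hy]; first exact: closed_pow0.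
- exact: ideal0.
- by rewrite -add1n; apply: closed_powM.
- exact: idealD.
Qed.

(** The ideals [G k] of leading forms of degree [k] of [J] are pulled back to [A], where they form a
    stable filtration. Lifts of generators of [G c], together with finitely many elements generating
    [J] modulo [M c], generate [J] by successive approximation. *)
Lemma completion_noetherian : noetherian B.
Proof.
apply: noetherian_of_fg => J hJ.
pose G k a := mpow m k a /\ exists2 z, J z & M k.+1 (z - iota a).
have hG k : is_ideal (G k).
  split; first by split; [apply: ideal0 | exists 0; [apply: ideal0 | rewrite rmorph0 subr0; apply: ideal0]].
  split=> [a b [ha [z Jz hz]] [hb [w Jw hw]]|r a [ha [z Jz hz]]].
    split; first exact: idealD.
    exists (z + w); first exact: idealD.
    rewrite rmorphD (_ : _ - _ = (z - iota a) + (w - iota b)); last by ring.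
    exact: idealD.
  split; first exact: idealMl.
  exists (iota r * z); first exact: idealMl.
  by rewrite rmorphM -mulrBr; apply: idealMl.
have Gm k a b : m a -> G k b -> G k.+1 (a * b).
  move=> ma [hb [z Jz hz]]; split; first exact: mpow_mul.
  exists (iota a * z); first exact: idealMl.
  rewrite rmorphM -mulrBr -[k.+2]add1n; apply: closed_powM => //.
  by apply/closed_pow_iota; rewrite mpow1E.
have [|c hc] := stable_filtration mI noethA hG _ Gm; first by move=> k a [].
(* Each generator [a] of [G k] is lifted to an element of [J]; a combination with coefficients in
   [m^j] then lifts up to [M (j + k + 1)], one order better than its own. *)
have lifts k (as_ : seq A) : (forall a, a \in as_ -> G k a) ->
   exists zs, (forall z, z \in zs -> J z) /\ forall j a, span (mpow m j) as_ a ->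
     exists2 y, span (M j) zs y & M (j + k.+1)%N (y - iota a).
  elim: as_ => [|a0 as_ IH] has.
    by exists [::]; split=> // j a ->; exists 0 => //; rewrite rmorph0 subr0; apply: ideal0.
  have [|zs [hzs hspan]] := IH; first by move=> a h; apply: has; rewrite inE h orbT.
  have [_ [z Jz hz]] := has a0 (mem_head _ _).
  exists (z :: zs); split; first by move=> w; rewrite inE => /orP[/eqP->|/hzs].
  move=> j a [_ [b [[s hs ->] hb ->]]]; have [y hy hyb] := hspan j b hb.
  have hsM : M j (iota s) by apply/closed_pow_iota.
  exists (iota s * z + y); first by exists (iota s * z), y; split=> //; exists (iota s).
  rewrite rmorphD rmorphM (_ : _ - _ = iota s * (z - iota a0) + (y - iota b)); last by ring.
  by apply: idealD => //; apply: closed_powM.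
have inG k x : J x -> M k x -> exists2 a, G k a & M k.+1 (x - iota a).
  move=> Jx hx; have [a ha] := closed_pow_dense k.+1 x; exists a => //.
  split; last by exists x.
  apply/closed_pow_iota; rewrite -(subKr x (iota a)); apply: idealB => //.
  exact: closed_pow_anti ha.
have finite_part k : exists gs, (forall g, g \in gs -> J g) /\
    forall x, J x -> exists2 y, span setT gs y & M k (x - y).
  elim: k => [|k [gs [hgs IH]]].
    by exists [::]; split=> // x _; exists 0 => //; apply: closed_pow0.
  have [as_ eas] := noetherian_fg noethA (hG k).
  have [|zs [hzs hspan]] := lifts k as_.
    by move=> a ha; rewrite eas; apply: span_mem.
  exists (gs ++ zs); split; first by move=> g; rewrite mem_cat => /orP[/hgs|/hzs].
  move=> x Jx; have [y hy hxy] := IH x Jx.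
  have Jy : J y by apply: span_sub hy => //; apply/smodT.
  have [a Ga ha] := inG k (x - y) (idealB hJ Jx Jy) hxy.
  have [|w hw hwa] := hspan 0%N a; first by rewrite mpow0T -eas.
  exists (y + w).
    rewrite (@span_cat _ setT) //; exists y, w; split=> //.
    exact: (spanS (J' := setT)) hw.
  rewrite (_ : _ - _ = (x - y - iota a) - (w - iota a)); last by ring.
  exact: idealB.
have [gs [hgs hfin]] := finite_part c.
have [as_ eas] := noetherian_fg noethA (hG c).
have [|zs [hzs hspan]] := lifts c as_.
  by move=> a ha; rewrite eas; apply: span_mem.
exists (gs ++ zs); apply/predeqP => x; split; last first.
  apply: span_sub; first exact/smodT.
  by move=> g; rewrite mem_cat => /orP[/hgs|/hzs].
move=> Jx; have [y hy hxy] := hfin x Jx.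
rewrite (@span_cat _ setT) //; exists y, (x - y); split=> //; last by ring.
have Jy : J y by apply: span_sub hy => //; apply/smodT.
apply: (@approximation_span _ M M setT hM closed_pow_sep closed_pow_complete _ (fun n z => J z /\ M (c + n)%N z)).
- move=> n z [Jz hz]; have [a Ga ha] := inG (c + n)%N z Jz hz.
  have ha' : span (mpow m n) as_ a.
    by apply: idmul_span => //; rewrite -eas; apply: hc.
  have [w hw hwa] := hspan n a ha'; exists w => //; split.
    apply: idealB => //; apply: span_sub (spanS (J' := setT) _ hw) => //; exact/smodT.
  rewrite (_ : _ - _ = (z - iota a) - (w - iota a)); last by ring.
  by rewrite addnS; apply: idealB => //; move: hwa; rewrite addnS addnC.
- by move=> n z [_]; apply: closed_pow_anti; apply: leq_addl.
- by split; [apply: idealB | rewrite addn0].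
Qed.

Lemma completion_local : local_with_max (M 1).
Proof.
have n1 : ~ M 1 1.
  by rewrite -(rmorph1 iota) => /closed_pow_iota; rewrite mpow1E //; apply: (local_not1 hL).
split; first by split.
move=> I [hI nI] x Ix; apply: contrapT => nx; apply: nI.
have [a ha] := closed_pow_dense 1 x.
have [|r er] := local_unit hL (x := a).
  move=> ma; apply: nx; rewrite -(subrK (iota a) x); apply: idealD => //.
  by apply/closed_pow_iota; rewrite mpow1E.
pose mu := 1 - iota r * x.
have hmu : M 1 mu.
  rewrite (_ : mu = iota r * (iota a - x)); first by apply: idealMl => //; rewrite -opprB; apply: idealN.
  by rewrite mulrBr -rmorphM er rmorph1.
have hmun n : M n (mu ^+ n) by rewrite closed_pow_mpow; apply: mpow_exp.
(* The sum of the geometric series in [mu], an inverse of [1 - mu]. *)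
have [b _ hb] := closed_pow_complete hmun.
suff e : b * (1 - mu) = 1 by rewrite -e; apply: idealMl => //; rewrite /mu subKr; apply: idealMl.
apply/eqP; rewrite -subr_eq0; apply/eqP; apply: closed_pow_sep => n.
have eg : (\sum_(i < n) mu ^+ i) * (1 - mu) = 1 - mu ^+ n.
  elim: n => [|n IHn]; first by rewrite big_ord0 expr0 mul0r subrr.
  by rewrite big_ord_recr /= mulrDl IHn exprS; ring.
rewrite (_ : _ - 1 = (b - \sum_(i < n) mu ^+ i) * (1 - mu) - mu ^+ n); last by rewrite mulrBl eg; ring.
by apply: idealB => //; apply: idealMr.
Qed.

Lemma completion_complete : complete_wrt (M 1).
Proof.
move=> r hr; have [|x _ hx] := closed_pow_complete (r := r).
  by move=> n; rewrite closed_pow_mpow.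
by exists x => n; rewrite -closed_pow_mpow.
Qed.

(** Density makes [A] surject onto [B/M k], so [A/(J ∩ A)] and [B/J] have the same ideals. *)
Lemma colen_contraction (J : B -> Prop) k : is_ideal J -> M k `<=` J ->
  is_ideal (fun a => J (iota a)) /\ (fincol (fun a => J (iota a)) /\ fincol J /\
  colen (fun a => J (iota a)) = colen J).
Proof.
move=> hJ MJ; pose J' a := J (iota a).
have hJ' : is_ideal J'.
  rewrite /J'; split; first by rewrite rmorph0; apply: ideal0.
  split=> [a b Ja Jb|r a Ja]; first by rewrite rmorphD; apply: idealD.
  by rewrite rmorphM; apply: idealMl.
have mJ' : mpow m k `<=` J' by move=> a /closed_pow_iota /MJ.
have h : forall n, lge setT n J' setT <-> lge setT n J setT.
  move=> n; split=> [h|h]; last first.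
    have : lge setT n (fun a => setT a /\ J (iota a)) setT.
      apply: lge_pull h => //; [exact: rmorphD | exact/smodT | |].
        by move=> s x _ _; exists (iota s); rewrite ?rmorphM.
      move=> y _; have [a ha] := closed_pow_dense k y; exists a => //; exact: MJ.
    by apply: lge_anti => a Ja.
  (* A scalar of [B] agrees with one of [A] only modulo [M k], which is more than [lge_push]
     tolerates; hence the explicit map on ideals. *)
  pose Phi (K : A -> Prop) := addm (fun b => exists2 a, K a & b = iota a) (M k).
  apply: (@lge_anti _ _ _ (Phi J')).
    move=> y Jy; have [a ha] := closed_pow_dense k y.
    exists (iota a), (y - iota a); split=> //; last by ring.
    exists a => //; rewrite /J' -(subKr y (iota a)); apply: idealB => //; exact: MJ.
  apply: lge_strict_map h => [K hK J'K _|K K' hK hK' J'K _ [KK' [x [K'x nKx]]]].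
    split=> //; split; first by exists 0, 0; rewrite addr0; split=> //; [exists 0; [apply: smod0 hK | rewrite rmorph0] | exact: ideal0].
    split=> [_ _ [_ [u [[a Ka ->] hu ->]]] [_ [v [[b Kb ->] hv ->]]]|s _ _ [_ [u [[a Ka ->] hu ->]]]].
      exists (iota (a + b)), (u + v); split; [|exact: idealD | by rewrite rmorphD; ring].
      by exists (a + b) => //; apply: (smodD hK).
    have [c hc] := closed_pow_dense k s.
    exists (iota (c * a)), ((s - iota c) * iota a + s * u); split.
    - by exists (c * a) => //; apply: (smodM hK).
    - by apply: idealD => //; [apply: idealMr | apply: idealMl].
    - by rewrite rmorphM; ring.
  have {}hK : smod setT K by case: hK => [->|//]; apply/smodT.
  split; first by apply: addmS => // _ [a Ka ->]; exists a => //; apply: KK'.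
  exists (iota x); split; first by exists (iota x), 0; rewrite addr0; split=> //; [exists x | exact: ideal0].
  move=> [_ [u [[a Ka ->] hu e]]]; apply: nKx.
  rewrite -(subrK a x); apply: (smodD hK) => //; apply: J'K; apply: mJ'.
  by apply/closed_pow_iota; rewrite rmorphB e addrC addKr.
have [h1 h2] := len_lge_iff h.
have f1 : fincol J' by apply: fincol_le (fincol_mpow noethA hL k).
by split=> //; split=> //; split; [apply/h1 | apply: h2].
Qed.

End CompletionTheory.

(** * Spans over subrings containing the p-th powers *)

Section Monomials.
Local Open Scope ring_scope.
Local Open Scope classical_set_scope.
Variable R : comNzRingType.
Implicit Types (I J K : R -> Prop).

Fixpoint monomial (ts : seq R) (g : seq nat) : R :=
  match ts, g with t :: ts', i :: g' => t ^+ i * monomial ts' g' | _, _ => 1 end.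

Lemma mpow_add_principal t J n K : is_ideal J -> is_ideal K ->
  (forall i j y, (i + j = n)%N -> mpow J j y -> K (t ^+ i * y)) ->
  mpow (addm (pid t) J) n `<=` K.
Proof.
move=> hJ; elim: n K => [|n IH] K hK h.
  by rewrite mpow0T => x _; have := h 0%N 0%N x erefl; rewrite mul1r mpow0T; apply.
apply: mpowS_sub => // a b [_ [c [[r _ ->] Jc ->]]] hb.
have hKa : is_ideal (colon K (r * t + c)) by apply: ideal_colon.
suff [_] : colon K (r * t + c) b by rewrite mulrC.
apply: IH hb => // i j y hij hy; split=> //.
rewrite (_ : _ * _ = r * (t ^+ i.+1 * y) + t ^+ i * (c * y)); last by rewrite exprS; ring.
apply: idealD => //.
  by apply: idealMl => //; apply: h hy; rewrite addSn hij.
by apply: (h i j.+1); [rewrite addnS hij | apply: mpow_mul].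
Qed.

Lemma mpow_monomials ts n K : is_ideal K ->
  (forall g, size g = size ts -> sumn g = n -> K (monomial ts g)) ->
  mpow (span setT ts) n `<=` K.
Proof.
elim: ts n K => [|t ts IH] n K hK h.
  case: n h => [|n] h; first by rewrite (ideal1 hK) //; apply: (h [::]).
  by apply: mpowS_sub => //= a b -> _; rewrite mul0r; apply: ideal0.
apply: mpow_add_principal => //; first exact: ideal_span.
move=> i j y hij hy.
suff [_] : colon K (t ^+ i) y by rewrite mulrC.
apply: IH hy; first exact: ideal_colon.
by move=> g hs hsum; split=> //; rewrite mulrC; apply: (h (i :: g)) => /=; [rewrite hs | rewrite hsum].
Qed.

Lemma monomial_mpow J ts g : (forall t, t \in ts -> J t) -> is_ideal J ->
  size g = size ts -> mpow J (sumn g) (monomial ts g).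
Proof.
move=> hts hJ; elim: ts g hts => [|t ts IH] [|i g] hts //= => [_|[hs]]; first by constructor.
apply: mpowD_mul => //; first by apply: mpow_exp; apply: hts; rewrite mem_head.
by apply: IH => // t' h; apply: hts; rewrite inE h orbT.
Qed.

(** Some exponent must reach [q]. The boolean summand makes the hypothesis fail for the empty list,
    whose monomial is 1. *)
Lemma monomial_pigeonhole ts g q K : is_ideal K -> (forall t, t \in ts -> K (t ^+ q)) ->
  size g = size ts -> (size ts * q < sumn g + (0 < size ts))%N -> K (monomial ts g).
Proof.
move=> hK; elim: ts g => [|t ts IH] [|i g] // hts [hs] /= hlt.
have [hq|hq] := leqP q i.
  rewrite -(subnK hq) exprD mulrAC mulrC; apply: idealMr => //.
  by apply: hts; rewrite mem_head.
apply: idealMl => //; apply: IH => //; first by move=> t' h; apply: hts; rewrite inE h orbT.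
by rewrite mulSn in hlt; case: (size ts) hlt => [|k] /=; lia.
Qed.

Lemma mpow_pigeonhole ts q K : is_ideal K -> (forall t, t \in ts -> K (t ^+ q)) ->
  mpow (span setT ts) (size ts * q).+1 `<=` K.
Proof.
move=> hK hts; apply: mpow_monomials => // g hs e; apply: (monomial_pigeonhole hK hts hs).
by rewrite e; apply: leq_addr.
Qed.

Lemma monomial_div ts g q : size g = size ts -> exists r,
  monomial ts g = (monomial ts [seq (i %/ q)%N | i <- g]) ^+ q * r.
Proof.
elim: ts g => [|t ts IH] [|i g] // => [_|[hs]]; first by exists 1; rewrite expr1n mulr1.
have [r e] := IH g hs; exists (t ^+ (i %% q) * r).
by rewrite /= e {1}(divn_eq i q) exprD exprM exprMn; ring.
Qed.

Lemma sumn_div g q : (0 < q)%N -> (sumn g <= q * sumn [seq (i %/ q)%N | i <- g] + size g * q)%N.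
Proof.
move=> hq; elim: g => //= i g IH; rewrite mulnDr mulSn.
have := divn_eq i q; have := ltn_pmod i hq; lia.
Qed.

End Monomials.

(** * Purely inseparable elements of degree p *)

Section FieldLemma.
Local Open Scope ring_scope.

(* A monic polynomial over [F] killing [y] of minimal degree [j < p] divides [X^p - y^p = (X - y)^p], hence is [(X - y)^j], and its subleading coefficient puts [y] in [F]. *)
Lemma purely_inseparable_indep (K : fieldType) (p : nat) (F : K -> Prop) (y : K) :
  p \in [pchar K] -> is_subring F -> (forall x, F x -> F x^-1) -> F (y ^+ p) -> ~ F y ->
  forall a : nat -> K, (forall i, F (a i)) -> \sum_(i < p) a i * y ^+ i = 0 ->
  forall i, (i < p)%N -> a i = 0.
Proof.
move=> pK hF hV Fyp nFy a Fa ha.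
have pp : prime p by apply: pcharf_prime pK.
pose PF (q : {poly K}) := forall i, F q`_i.
pose P n := `[< exists q : {poly K}, [/\ PF q, q \is monic, root q y & (size q = n.+1)%N ] >].
pose g := \poly_(i < p) a i.
have gF : PF g by move=> i; rewrite coef_poly; case: ifP => _ //; apply: subring0.
have gy : root g y by rewrite /root horner_poly ha.
have [g0|gn0] := eqVneq g 0.
  by move=> i hi; have := congr1 (fun q : {poly K} => q`_i) g0; rewrite coef_poly hi coef0.
have Pg : P (size g).-1.
  apply/asboolP; exists ((lead_coef g)^-1 *: g); split.
  - by move=> i; rewrite coefZ; apply: subringM => //; apply: hV; apply: gF.
  - by rewrite monicE lead_coefZ mulVf // lead_coef_eq0.
  - by rewrite rootZ // invr_eq0 lead_coef_eq0.
  - by rewrite size_scale ?invr_eq0 ?lead_coef_eq0 // prednK // size_poly_gt0.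
have exP : exists n, P n by exists (size g).-1.
case: (ex_minnP exP) => j /asboolP[h [hPF hmon hy hsz]] hmin.
have jp : (j < p)%N.
  by apply: leq_ltn_trans (hmin _ Pg) _; rewrite -ltnS prednK ?size_poly_gt0 // ltnS size_poly.
(* Dividing over an abstract copy of [F] keeps the remainder's coefficients in [F], so minimality of
   the degree applies to it. *)
have [F' [f [finj fF]]] := subring_ring_exists hF.
have lift q : PF q -> exists q', map_poly f q' = q.
  move=> Fq; have [c hc] := choice_ex (fun i => (fF _).1 (Fq i)).
  exists (\poly_(i < size q) c i); apply/polyP => i; rewrite coef_map coef_poly.
  case: ltnP => hi; first exact: hc.
  by rewrite raddf0 nth_default.
have sz (q : {poly F'}) : size (map_poly f q) = size q.
  by apply: size_map_inj_poly => //; apply: raddf0.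
have [h' eh] := lift h hPF.
have h'mon : h' \is monic.
  rewrite monicE; apply/eqP; apply: finj.
  have := monicP hmon; rewrite -eh lead_coefE sz coef_map.
  by rewrite -lead_coefE rmorph1.
have [c hc] := (fF _).1 Fyp.
pose Q : {poly F'} := 'X^p - c%:P.
have eQ : map_poly f Q = ('X - y%:P) ^+ p.
  have pKP : p \in [pchar {poly K}] by apply: (rmorph_pchar (polyC : {rmorphism K -> {poly K}})).
  rewrite /Q rmorphB /= map_polyXn map_polyC /= hc polyC_exp.
  have pn : [pchar {poly K}].-nat p by rewrite pnatE.
  by rewrite exprDn_pchar // exprNn_pchar.
have hr := Pdiv.RingMonic.rdivp_eq h'mon Q.
set r := Pdiv.CommonRing.rmodp Q h' in hr; set s := Pdiv.CommonRing.rdivp Q h' in hr.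
have hrs : (size r < j.+1)%N.
  by rewrite -hsz -eh sz Pdiv.CommonRing.ltn_rmodp monic_neq0.
have r0 : map_poly f r = 0.
  apply/eqP; apply: contraT => rn0.
  have hry : root (map_poly f r) y.
    have := congr1 (fun q => (map_poly f q).[y]) hr.
    rewrite /= eQ rmorphD rmorphM /= eh hornerD hornerM (rootP hy) mulr0 add0r.
    rewrite horner_exp !hornerE subrr expr0n (gtn_eqF (prime_gt0 pp)) => e.
    by apply/rootP; rewrite -e.
  have Pr : P (size (map_poly f r)).-1.
    apply/asboolP; exists ((lead_coef (map_poly f r))^-1 *: map_poly f r); split.
    - move=> i; rewrite coefZ; apply: subringM => //; last by rewrite coef_map; apply/fF; exists r`_i.
      by apply: hV; rewrite lead_coefE coef_map; apply/fF; eexists.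
    - by rewrite monicE lead_coefZ mulVf // lead_coef_eq0.
    - by rewrite rootZ // invr_eq0 lead_coef_eq0.
    - by rewrite size_scale ?invr_eq0 ?lead_coef_eq0 // prednK // size_poly_gt0.
  have hpos : (0 < size (map_poly f r))%N by rewrite size_poly_gt0.
  have := hmin _ Pr; rewrite -ltnS prednK // sz => hlt.
  by have := leq_trans hlt hrs; rewrite ltnn.
have hdvd : h %| ('X - y%:P) ^+ p.
  by rewrite -eQ hr rmorphD rmorphM /= r0 addr0 eh dvdp_mull.
have /dvdp_exp_XsubCP[k hk] := hdvd.
rewrite eqp_monic ?monic_exp ?monicXsubC // => /eqP eh'.
have ekj : k = j by have := hsz; rewrite eh' size_exp_XsubC => -[].
subst k; case: j jp hmin hsz hrs hk eh' => [|j] jp _ _ _ _ eh'.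
  by have := rootP hy; rewrite eh' expr0 hornerC => /eqP; rewrite oner_eq0.
have sub n : (('X - y%:P) ^+ n.+1)`_n = - (y *+ n.+1).
  elim: n => [|n IHn]; first by rewrite expr1 coefB coefX coefC sub0r.
  rewrite exprS mulrBl coefB coefXM /= IHn coefCM.
  have -> : (('X - y%:P) ^+ n.+1)`_n.+1 = 1.
    have : ('X - y%:P) ^+ n.+1 \is monic by rewrite monic_exp ?monicXsubC.
    by move/monicP; rewrite lead_coefE size_exp_XsubC.
  by rewrite mulr1 (mulrSr y n.+1) opprD.
have hj : (j.+1%:R : K) != 0.
  by rewrite -(dvdn_pcharf pK); apply/negP => /(dvdn_leq (ltn0Sn j)); rewrite leqNgt jp.
have FN n : F n%:R by elim: n => [|n IHn]; [exact: subring0 | rewrite mulrSr; apply: subringD => //; apply: subring1].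
case: nFy; have := hPF j; rewrite eh' sub => Fj.
rewrite -[y]mulr1 -(mulfV hj) mulrA mulr_natr; apply: subringM => //; last by apply: hV.
by rewrite -[_ *+ _]opprK; apply: subringN.
Qed.

End FieldLemma.

(** * Subrings containing the p-th powers, and Frobenius powers *)

Section FrobeniusSpans.
Local Open Scope ring_scope.
Local Open Scope classical_set_scope.
Variables (R : comNzRingType) (p : nat).
Hypothesis pR : p \in [pchar R].
Implicit Types (I J K V U X : R -> Prop).

Let pp : prime p := pcharf_prime pR.
Let pgt0 : (0 < p)%N := prime_gt0 pp.
Let pn : [pchar R].-nat p. Proof. by rewrite pnatE. Qed.

Lemma frobD (x y : R) : (x + y) ^+ p = x ^+ p + y ^+ p.
Proof. exact: exprDn_pchar. Qed.

Lemma frobN (x : R) : (- x) ^+ p = - x ^+ p.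
Proof. exact: exprNn_pchar. Qed.

Lemma frobB (x y : R) : (x - y) ^+ p = x ^+ p - y ^+ p.
Proof. by rewrite frobD frobN. Qed.

Lemma frob0 : (0 : R) ^+ p = 0.
Proof. by rewrite expr0n gtn_eqF. Qed.

Lemma ideal_frob I x : is_ideal I -> I x -> I (x ^+ p).
Proof. by move=> hI Ix; rewrite -(prednK pgt0) exprS; apply: idealMr. Qed.

Definition psub V : Prop := is_subring V /\ forall x, V (x ^+ p).

Lemma psubT : psub setT. Proof. by []. Qed.

(** Negatives come for free because [-1] is a p-th power. *)
Inductive gen X : R -> Prop :=
| gen_pow x : gen X (x ^+ p)
| gen_var x : X x -> gen X x
| gen_add x y : gen X x -> gen X y -> gen X (x + y)
| gen_mul x y : gen X x -> gen X y -> gen X (x * y).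

Lemma gen_psub X : psub (gen X).
Proof.
split=> [|x]; last exact: gen_pow.
have h1 : gen X 1 by rewrite -(expr1n _ p); apply: gen_pow.
split=> // [x y hx hy|x y]; last exact: gen_mul.
apply: gen_add => //; rewrite -mulN1r; apply: gen_mul => //.
by rewrite (_ : -1 = (-1) ^+ p); [apply: gen_pow | rewrite frobN expr1n].
Qed.

Lemma gen_sub X V : psub V -> X `<=` V -> gen X `<=` V.
Proof.
move=> [hV Vp] XV x; elim=> {x} [x|x|x y _ hx _ hy|x y _ hx _ hy] //; first exact: XV.
  exact: subringD.
exact: subringM.
Qed.

Lemma gen_mono X X' : X `<=` X' -> gen X `<=` gen X'.
Proof. by move=> h; apply: gen_sub (gen_psub _) _ => x /h; apply: gen_var. Qed.

Lemma gen_finite X x : gen X x ->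
  exists l : seq R, [/\ uniq l, forall c, c \in l -> X c & gen (fun c => c \in l) x].
Proof.
have join (l l' : seq R) : (forall c, c \in l -> X c) -> (forall c, c \in l' -> X c) ->
    exists l0 : seq R, [/\ uniq l0, forall c, c \in l0 -> X c & forall c, (c \in l) || (c \in l') -> c \in l0].
  move=> h h'; exists (undup (l ++ l')); split; first exact: undup_uniq.
    by move=> c; rewrite mem_undup mem_cat => /orP[/h|/h'].
  by move=> c; rewrite mem_undup mem_cat.
elim=> {x} [x|x Xx|x y _ [l [_ hl hx]] _ [l' [_ hl' hy]]|x y _ [l [_ hl hx]] _ [l' [_ hl' hy]]].
- by exists [::]; split=> //; apply: gen_pow.
- by exists [:: x]; split=> // [c|]; [rewrite inE => /eqP-> | apply: gen_var; rewrite /= inE].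
- have [l0 [hu h0 hs]] := join l l' hl hl'; exists l0; split=> //; apply: gen_add.
    by apply: gen_mono hx => c hc; apply: hs; rewrite hc.
  by apply: gen_mono hy => c hc; apply: hs; rewrite hc orbT.
- have [l0 [hu h0 hs]] := join l l' hl hl'; exists l0; split=> //; apply: gen_mul.
    by apply: gen_mono hx => c hc; apply: hs; rewrite hc.
  by apply: gen_mono hy => c hc; apply: hs; rewrite hc orbT.
Qed.

Definition cpow (c : R) : seq R := [seq c ^+ i | i <- iota 0 p].

Lemma size_cpow c : size (cpow c) = p.
Proof. by rewrite size_map size_iota. Qed.

Lemma mem_cpow c i : (i < p)%N -> c ^+ i \in cpow c.
Proof. by move=> h; apply: map_f; rewrite mem_iota. Qed.

(** Coefficients vanish outside the window from [j] to [j + k], so a relation among some of the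
    powers of [c] can be read as one among all of them. *)
Lemma span_cpowP V c j k n : V 0 -> (j + k <= n)%N -> forall x,
  span V [seq c ^+ i | i <- iota j k] x ->
  exists a : nat -> R, [/\ forall i, V (a i) \/ a i = 0, forall i, (i < j)%N || (j + k <= i)%N -> a i = 0
    & x = \sum_(i < n) a i * c ^+ i].
Proof.
move=> V0; elim: k j => [|k IH] j hn x.
  by move=> ->; exists (fun=> 0); split=> //; [left | rewrite big1 // => i _; rewrite mul0r].
move=> [_ [b [[s Vs ->] hb ->]]]; have [|a [Va a0 eb]] := IH j.+1 _ b hb; first by lia.
exists (fun i => if i == j then s else a i); split.
- by move=> i; case: eqP => // _; left.
- by move=> i hi; case: eqP => [e|_]; [move: hi; rewrite e; lia | apply: a0; lia].
have jn : (j < n)%N by lia.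
rewrite (bigD1 (Ordinal jn)) //= eqxx; congr (_ + _); rewrite eb (bigD1 (Ordinal jn)) //=.
rewrite a0 ?ltnSn // mul0r add0r; apply: eq_bigr => i.
by rewrite -val_eqE /= => /negPf ->.
Qed.

Lemma cpow_expand V c x : V 0 -> span V (cpow c) x ->
  exists a : nat -> R, (forall i, V (a i)) /\ x = \sum_(i < p) a i * c ^+ i.
Proof.
move=> V0 /(span_cpowP V0 (leqnn _))[a [Va a0 ->]]; exists a; split=> // i.
by case: (Va i) => // ->.
Qed.

Lemma span_bigsum S V gs (n : nat) (a : nat -> R) (F : nat -> R) : smod S V ->
  (forall i, V (a i)) -> (forall i, (i < n)%N -> F i \in gs) ->
  span V gs (\sum_(i < n) a i * F i).
Proof.
move=> hV Va hF; have hs : smod S (span V gs) by apply: smod_span.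
have one g s : g \in gs -> V s -> span V gs (s * g).
  elim: gs {hF hs} => // g' gs IH; rewrite inE => /orP[/eqP ->|hg] Vs.
    exists (s * g'), 0; rewrite addr0; split=> //; first by exists s.
    by apply: smod0 (smod_span gs hV).
  exists 0, (s * g); rewrite add0r; split=> //; last exact: IH.
  by exists 0; rewrite ?mul0r //; apply: smod0 hV.
elim: n hF => [|n IH] hF; first by rewrite big_ord0; apply: smod0 hs.
rewrite big_ord_recr /=; apply: (smodD hs); last by apply: one => //; apply: hF.
by apply: IH => i hi; apply: hF; apply: ltnW.
Qed.

Lemma span_one V gs g s : smod V V -> g \in gs -> V s -> span V gs (s * g).
Proof.
move=> hV hg Vs; have := @span_bigsum V V gs 1 (fun=> s) (fun=> g) hV.
by rewrite big_ord_recl big_ord0 addr0; apply.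
Qed.

(* The powers [c^i], [i < p], span a subring because [c^p] is a scalar. *)
Lemma span_cpow_subring V c : psub V -> is_subring (span V (cpow c)).
Proof.
move=> [hV Vp]; have hVs := smod_self hV; have hs := smod_span (cpow c) hVs.
split.
- by rewrite -[1]mul1r -{2}(expr0 c); apply: span_one => //; [apply: mem_cpow | apply: subring1].
- by move=> x y; apply: (smodB hV hs).
have powi n : span V (cpow c) (c ^+ n).
  rewrite (divn_eq n p) exprD exprM.
  apply: span_one => //.
  by apply: mem_cpow; rewrite ltn_mod.
move=> x y /(cpow_expand (subring0 hV))[a [Va ->]] /(cpow_expand (subring0 hV))[b [Vb ->]].
rewrite mulr_suml; apply: (smod_sum (F := fun i => a i * c ^+ i * _) hs) => i _.
rewrite mulr_sumr; apply: (smod_sum (F := fun j => a i * c ^+ i * (b j * c ^+ j)) hs) => j _.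
rewrite (_ : _ * _ = (a i * b j) * c ^+ (i + j)); last by rewrite exprD; ring.
by apply: (smodM hs) => //; apply: subringM.
Qed.

Lemma gen_split X c : gen X `<=` span (gen (fun x => X x /\ x <> c)) (cpow c).
Proof.
set V := gen (fun _ => _ /\ _); have [hV Vp] : psub V := gen_psub _.
have hsr := span_cpow_subring c (conj hV Vp).
have emb v : V v -> span V (cpow c) v.
  move=> Vv; rewrite -[v]mulr1 -(expr0 c); apply: span_one => //; first exact: smod_self.
  exact: mem_cpow.
apply: gen_sub; first by split=> // x; apply: emb.
move=> x Xx; have [->|nxc] := pselect (x = c); last by apply: emb; apply: gen_var.
rewrite -[c in X in _ X]mul1r -{2}(expr1 c); apply: span_one; [exact: smod_self | | exact: subring1].
by apply: mem_cpow; apply: prime_gt1.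
Qed.

(** For [V] the whole ring this is the Frobenius power [I^[p]]; for [V = U] it is the ideal [I^p U]
    of the overview. *)
Inductive pspan I V : R -> Prop :=
| pspan0 : pspan I V 0
| pspan_cons s v x : I s -> V v -> pspan I V x -> pspan I V (s ^+ p * v + x).

Lemma pspan_mem I V s v : I s -> V v -> pspan I V (s ^+ p * v).
Proof. by move=> Is Vv; rewrite -[X in pspan _ _ X]addr0; apply: pspan_cons => //; apply: pspan0. Qed.

Lemma smod_pspan I V : is_subring V -> smod V (pspan I V).
Proof.
move=> hV; split; first exact: pspan0.
split=> [x y|v x Vv]; elim=> {x} [|s w x Is Vw _ IH]; rewrite ?add0r ?mulr0 //.
- by move=> /IH h; rewrite -addrA; apply: pspan_cons.
- exact: pspan0.
- by rewrite mulrDr mulrCA; apply: pspan_cons => //; apply: subringM.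
Qed.

Lemma pspan_sub S I V K : smod S K -> (forall s v, I s -> V v -> K (s ^+ p * v)) -> pspan I V `<=` K.
Proof.
move=> hK h x; elim=> {x} [|s v x Is Vv _ Kx]; first exact: smod0 hK.
by apply: (smodD hK) => //; apply: h.
Qed.

Lemma pspan_mono I I' V V' : I `<=` I' -> V `<=` V' -> pspan I V `<=` pspan I' V'.
Proof.
move=> h h' x; elim=> {x} [|s v x Is Vv _ Kx]; first exact: pspan0.
by apply: pspan_cons => //; [apply: h | apply: h'].
Qed.

Lemma ideal_pspan I : is_ideal (pspan I setT).
Proof. by apply/smodT/smod_pspan. Qed.

Lemma pspan_sub_ideal I : is_ideal I -> pspan I setT `<=` I.
Proof.
move=> hI; apply: (pspan_sub (S := setT)); first exact/smodT.
by move=> s v Is _; apply: idealMr => //; apply: ideal_frob.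
Qed.

Lemma pspanT V : psub V -> pspan setT V = V.
Proof.
move=> [hV Vp]; apply/predeqP => x; split.
  by apply: (pspan_sub (smod_self hV)) => s v _ Vv; apply: subringM.
by move=> Vx; rewrite -[x]mul1r -(expr1n _ p); apply: pspan_mem.
Qed.

Lemma pspanM I J K V x y : is_subring V -> (forall a b, I a -> J b -> K (a * b)) ->
  pspan I V x -> pspan J V y -> pspan K V (x * y).
Proof.
move=> hV h hx hy; have hK := smod_pspan K hV.
elim: hx => {x} [|s v x Is Vv _ IH]; first by rewrite mul0r; apply: pspan0.
rewrite mulrDl; apply: (smodD hK) => //.
elim: hy {IH} => {y} [|t w y Jt Vw _ IH]; first by rewrite mulr0; apply: pspan0.
rewrite mulrDr; apply: (smodD hK) => //.
rewrite (_ : _ * _ = (s * t) ^+ p * (v * w)); last by rewrite exprMn; ring.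
by apply: pspan_mem; [apply: h | apply: subringM].
Qed.

Lemma pspan_add I J V : pspan (addm I J) V `<=` addm (pspan I V) (pspan J V).
Proof.
move=> x; elim=> {x} [|_ v x [a [b [Ia Jb ->]]] Vv _ [u [w [hu hw ->]]]].
  by exists 0, 0; rewrite addr0; split=> //; apply: pspan0.
exists (a ^+ p * v + u), (b ^+ p * v + w); split; try exact: pspan_cons.
by rewrite frobD; ring.
Qed.

Lemma pspan_span I V V' gs : is_subring V' -> V `<=` span V' gs ->
  pspan I V `<=` span (pspan I V') gs.
Proof.
move=> hV' h; have hs := smod_span gs (smod_pspan I hV').
apply: (pspan_sub hs) => s v Is /h; elim: gs v {h hs} => [v ->|g gs IH v [_ [b [[w Vw ->] hb ->]]]] /=; first by rewrite mulr0.
exists (s ^+ p * w * g), (s ^+ p * b); split; [|exact: IH | by ring].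
by exists (s ^+ p * w) => //; apply: pspan_mem.
Qed.

Lemma pspan_finite I X x : pspan I (gen X) x ->
  exists l : seq R, [/\ uniq l, forall c, c \in l -> X c & pspan I (gen (fun c => c \in l)) x].
Proof.
elim=> {x} [|s v x Is /gen_finite[l [_ hl hv]] _ [l' [_ hl' hx]]].
  by exists [::]; split=> //; apply: pspan0.
exists (undup (l ++ l')); split; first exact: undup_uniq.
  by move=> c; rewrite mem_undup mem_cat => /orP[/hl|/hl'].
apply: pspan_cons => //; first by apply: gen_mono hv => c hc /=; rewrite mem_undup mem_cat hc.
apply: pspan_mono hx => //; apply: gen_mono => c hc /=; by rewrite mem_undup mem_cat hc orbT.
Qed.

Lemma gen_nil x : gen (fun c => c \in [::]) x -> exists r, x = r ^+ p.
Proof.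
elim=> {x} [x|//|_ _ _ [a ->] _ [b ->]|_ _ _ [a ->] _ [b ->]]; first by exists x.
  by exists (a + b); rewrite frobD.
by exists (a * b); rewrite exprMn.
Qed.

Lemma pspan_gen_nil I x : is_ideal I -> pspan I (gen (fun c => c \in [::])) x ->
  exists2 t, I t & x = t ^+ p.
Proof.
move=> hI; elim=> {x} [|s v x Is /gen_nil[r ->] _ [t It ->]].
  by exists 0; rewrite ?frob0 //; apply: ideal0.
exists (s * r + t); last by rewrite frobD exprMn.
by apply: idealD => //; apply: idealMr.
Qed.

End FrobeniusSpans.

(** * Closures of such subrings, and p-bases of the residue field *)

Section ClosedSubrings.
Local Open Scope ring_scope.
Local Open Scope classical_set_scope.
Variables (R : comNzRingType) (p : nat) (m : R -> Prop).
Hypotheses (pR : p \in [pchar R]) (noethR : noetherian R) (hL : local_with_max m).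
Hypothesis complR : complete_wrt m.
Implicit Types (I J K V U X : R -> Prop).

Let pp : prime p := pcharf_prime pR.
Let pgt0 : (0 < p)%N := prime_gt0 pp.
Let mI := local_ideal hL.
Let hpow k : is_ideal (mpow m k) := mpow_is_ideal mI k.
Let sepm := krull_intersection noethR hL.
Local Notation psub := (psub p).
Local Notation pspan := (pspan p).
Local Notation cpow := (cpow p).
Local Notation gen := (gen p).

(* Limits of sequences of [V] that are Cauchy for the ideal generated in [V] by p-th powers of [m]. *)
Definition hat V x : Prop := exists v : nat -> R,
  [/\ forall n, V (v n), forall n, pspan (mpow m n) V (v n.+1 - v n) & forall n, mpow m n (x - v n)].

Lemma pspan_in I V : psub V -> pspan I V `<=` V.
Proof. by move=> hV x /(pspan_mono (I' := setT) (fun _ _ => Logic.I) (fun _ h => h)); rewrite pspanT. Qed.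

Lemma pspan_mpow n V : pspan (mpow m n) V `<=` mpow m n.
Proof. by move=> x hx; apply: (pspan_sub_ideal pR (hpow n)); apply: pspan_mono hx. Qed.

Lemma hat_lim V (r : nat -> R) : psub V -> (forall n, pspan (mpow m n) V (r n)) ->
  exists2 x, hat V x & forall n, mpow m n (x - \sum_(i < n) r i).
Proof.
move=> hV hr; have [|x hx] := complR (r := r); first by move=> n; apply: pspan_mpow (hr n).
exists x => //; exists (fun n => \sum_(i < n) r i); split=> // n.
  by apply: (smod_sum (smod_self hV.1)) => i _; apply: pspan_in (hr i).
by rewrite big_ord_recr /= addrAC subrr add0r.
Qed.

Lemma sub_hat V : psub V -> V `<=` hat V.
Proof.
move=> hV x Vx; exists (fun=> x); split=> // n; rewrite subrr; last exact: ideal0.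
exact: pspan0.
Qed.

Lemma hat_psub V : psub V -> psub (hat V).
Proof.
move=> hV; have hVr := hV.1; split; last by move=> x; apply: sub_hat => //; apply: hV.2.
have hps n := smod_pspan p (mpow m n) hVr.
split; first by apply: sub_hat => //; apply: subring1.
  move=> x y [v [Vv iv cv]] [w [Vw iw cw]]; exists (fun n => v n - w n); split=> n.
  - by case: hVr => _ hB _; apply: hB.
  - rewrite (_ : _ - _ = (v n.+1 - v n) - (w n.+1 - w n)); last by ring.
    exact: (smodB hVr (hps n)).
  - rewrite (_ : _ - _ = (x - v n) - (y - w n)); last by ring.
    exact: idealB.
move=> x y [v [Vv iv cv]] [w [Vw iw cw]]; exists (fun n => v n * w n); split=> n.
- exact: subringM.
- rewrite (_ : _ - _ = w n.+1 * (v n.+1 - v n) + v n * (w n.+1 - w n)); last by ring.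
  by apply: (smodD (hps n)); apply: (smodM (hps n)).
- rewrite (_ : _ - _ = (x - v n) * y + v n * (y - w n)); last by ring.
  by apply: idealD => //; [apply: idealMr | apply: idealMl].
Qed.

Lemma hat_mono V V' : V `<=` V' -> hat V `<=` hat V'.
Proof.
move=> h x [v [Vv iv cv]]; exists v; split=> // n; first exact: h.
exact: pspan_mono (iv n).
Qed.

Lemma hat_series V gs (v : nat -> R) x : psub V ->
  (forall n, span (pspan (mpow m n) V) gs (v n)) ->
  (forall n, mpow m n (x - \sum_(i < n) v i)) -> span (hat V) gs x.
Proof.
by move=> hV; apply: (@series_span R (mpow m)) => // r hr; apply: hat_lim.
Qed.

Lemma hat_span V V' gs : psub V -> psub V' -> V `<=` span V' gs -> hat V `<=` span (hat V') gs.
Proof.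
move=> hV hV' hgs x [v [Vv iv cv]].
pose y n := if n is n'.+1 then v n'.+2 - v n'.+1 else v 1%N.
apply: (@hat_series V' gs y) => // n.
  apply: (pspan_span hV'.1 hgs); case: n => [|n] /=; last exact: iv.
  by rewrite mpow0T pspanT.
case: n => [|n]; first by rewrite mpow0T.
rewrite (_ : \sum_(i < n.+1) _ = v n.+1) //; elim: n => [|n IH]; first by rewrite big_ord1.
by rewrite big_ord_recr /= IH; ring.
Qed.

Lemma frob_span I V ts s v : psub V -> V v -> span I ts s -> span (pspan I V) [seq t ^+ p | t <- ts] (s ^+ p * v).
Proof.
move=> hV Vv; elim: ts s => [s ->|t ts IH s [_ [b [[r Ir ->] hb ->]]]] /=; first by rewrite frob0 ?mul0r.
exists (r ^+ p * v * t ^+ p), (b ^+ p * v); split; [|exact: IH | by rewrite (frobD pR) exprMn; ring].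
by exists (r ^+ p * v) => //; apply: pspan_mem.
Qed.

(** Density in the finer topology. The tail of the series of [u] has terms in [(m^(n+j))^p V];
    splitting off the p-th powers of generators of [m^n] leaves coefficient series that converge in
    [hat V]. *)
Lemma hat_approx V u n : psub V -> hat V u -> exists2 v, V v & pspan (mpow m n) (hat V) (u - v).
Proof.
move=> hV [v [Vv iv cv]]; exists (v n) => //.
have [ts ets] := noetherian_fg noethR (hpow n).
have hhV := hat_psub hV.
suff : span (hat V) [seq t ^+ p | t <- ts] (u - v n).
  apply: span_sub; first exact: (smod_pspan p _ hhV.1).
  move=> _ /mapP[t ht ->]; rewrite -[_ ^+ _]mulr1; apply: pspan_mem; last exact: subring1 hhV.1.
  by rewrite ets; apply: span_mem.
apply: (@hat_series V _ (fun j => v (n + j).+1 - v (n + j)%N)) => // j.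
  have hs : smod V (span (pspan (mpow m j) V) [seq t ^+ p | t <- ts]).
    by apply: smod_span; apply: smod_pspan; case: hV.
  apply: (pspan_sub hs) (iv (n + j)%N) => s w hs' Vw; apply: frob_span => //.
  have hK : is_ideal (span (mpow m j) ts) by apply/smodT/smod_span/smodT.
  rewrite addnC in hs'; apply: (mpowD_sub hK _ hs') => a b ha hb.
  by apply: idmul_span => //; apply: idmul_gen => //; rewrite -ets.
have -> : \sum_(i < j) (v (n + i).+1 - v (n + i)%N) = v (n + j)%N - v n.
  elim: j => [|j IH]; first by rewrite big_ord0 addn0 subrr.
  by rewrite big_ord_recr /= IH addnS; ring.
rewrite (_ : _ - _ = u - v (n + j)%N); last by ring.
exact: (mpow_anti mI (leq_addl n j) (cv _)).
Qed.

(** A Nakayama lemma for complete modules: generators modulo [m^[p]] generate, by approximation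
    along the ideals [(m^n)^[p]]. *)
Lemma hat_generators V gs : psub V -> (forall x, addm (span V gs) (pspan m setT) x) ->
  forall x, span (hat V) gs x.
Proof.
move=> hV hgs x.
apply: (@approximation_span R (mpow m) (fun n => pspan (mpow m n) V) (hat V) _ _ _ gs (fun n => pspan (mpow m n) setT)) => //.
- by move=> r hr; apply: hat_lim.
- move=> n z; elim=> {z} [|s r z hs _ _ [y hy hyz]].
    exists 0; last by rewrite subrr; apply: pspan0.
    by apply: smod0 (smod_span gs (smod_pspan p (mpow m n) hV.1)).
  have [w [u [hw hu er]]] := hgs r.
  have hsp := smod_span gs (smod_pspan p (mpow m n) hV.1).
  exists (s ^+ p * w + y).
    apply: (smodD hsp) => //.
    elim: gs w hw {hgs er hsp hy} => [w ->|g gs IH w [_ [b [[c Vc ->] hb ->]]]] /=; first by rewrite mulr0.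
    exists (s ^+ p * c * g), (s ^+ p * b); split; [|exact: IH | by ring].
    by exists (s ^+ p * c) => //; apply: pspan_mem.
  rewrite er (_ : _ - _ = s ^+ p * u + (z - y)); last by ring.
  apply: (smodD (smod_pspan p (mpow m n.+1) (@subringT R))) => //.
  have : pspan (mpow m n) setT (s ^+ p * 1) by apply: pspan_mem.
  rewrite mulr1 => h; apply: (pspanM (I := mpow m n) (J := m)) h hu => // a b ha mb.
  by rewrite mulrC; apply: mpow_mul.
- by move=> n z hz; apply: pspan_mpow hz.
- by rewrite mpow0T pspanT.
Qed.

Lemma psub_unit V u : psub V -> V u -> ~ m u -> exists2 r, V r & r * u = 1.
Proof.
(* The inverse of [u] is the p-th power of itself times [u^(p-1)], hence lies in [V]. *)
move=> [hV Vp] Vu /(local_unit hL)[r e]; exists (r ^+ p * u ^+ p.-1).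
  by apply: subringM => //; apply: subringX.
by rewrite -mulrA -exprSr prednK // -exprMn e expr1n.
Qed.

Lemma psub_simple V : psub V -> simple V (capm V m) V.
Proof.
move=> hV; split.
  split; first by move=> x [].
  exists 1; split; first exact: subring1 hV.1.
  by move=> [_]; apply: local_not1.
move=> y Vy ny x Vx; have [|r Vr e] := @psub_unit V y hV Vy; first by move=> my; apply: ny.
exists 0, x; rewrite add0r; split=> //.
  by split; [apply: subring0 hV.1 | apply: ideal0].
by exists (x * r); [apply: (subringM hV.1) | rewrite -mulrA e mulr1].
Qed.

Lemma smod_capm V : is_subring V -> smod V (capm V m).
Proof. by move=> hV; apply: smod_cap; [apply: smod_self | apply: (smod_scal (S := setT)) => //; apply/smodT]. Qed.

Lemma psub_len V : psub V -> fin V (capm V m) V /\ len V (capm V m) V = 1%N.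
Proof.
move=> hV; apply: fin_len_simple (psub_simple hV); first exact: hV.1.
  exact: smod_capm hV.1.
exact: smod_self hV.1.
Qed.

(** The residue of [c] has degree [p] over the residue field of [V], expressed without forming
    residue fields. *)
Definition pind V c : Prop := forall a : nat -> R, (forall i, V (a i)) ->
  m (\sum_(i < p) a i * c ^+ i) -> forall i, (i < p)%N -> m (a i).

Lemma residue_independence V y : psub V -> ~ addm V m y -> pind V y.
Proof.
move=> hV nVy a Va ha i hi.
have [k [f [fsurj fker]]] := quotient_ring_exists (proj1 hL).
have kinv (x : k) : exists z, (x != 0 -> z * x = 1) /\ (x = 0 -> z = 0).
  have [->|xn0] := eqVneq x 0; first by exists 0.
  have [b eb] := fsurj x; have [|r er] := local_unit hL (x := b).
    by move=> mb; move/eqP: xn0; apply; rewrite -eb; apply/fker.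
  exists (f r); split=> [_|e]; first by rewrite -eb -rmorphM er rmorph1.
  by rewrite e eqxx in xn0.
have [inv hinv] := choice_ex kinv.
pose fm := GRing.ComNzRing_isField.Build k (fun x hx => (hinv x).1 hx) ((hinv 0).2 erefl).
pose K : fieldType := HB.pack k fm.
pose F (x : K) := exists2 v, V v & f v = x :> k.
have pK : p \in [pchar K] by apply: (rmorph_pchar f).
have hF : is_subring F.
  split; first by exists 1; [apply: subring1 hV.1 | rewrite rmorph1].
    move=> _ _ [v Vv <-] [w Vw <-]; exists (v - w); last by rewrite rmorphB.
    by case: (hV.1) => _ hB _; apply: hB.
  by move=> _ _ [v Vv <-] [w Vw <-]; exists (v * w); [apply: (subringM hV.1) | rewrite rmorphM].
apply/fker.
apply: (@purely_inseparable_indep K p F (f y) pK hF _ _ _ (fun i => f (a i))) => //.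
- move=> _ [v Vv <-]; have [mv|nmv] := pselect (m v).
    by exists v => //; rewrite (fker v).2 // (invr0 K).
  have [r Vr er] := psub_unit hV Vv nmv; exists r => //.
  have fe : (f r : K) * (f v : K) = 1 by rewrite -rmorphM er rmorph1.
  have fv0 : (f v : K) != 0 by apply/eqP => /fker.
  by apply: (mulIf fv0); rewrite fe mulVf.
- by exists (y ^+ p); [apply: hV.2 | rewrite rmorphXn].
- move=> [v Vv e]; apply: nVy; exists v, (y - v); split=> //; last by ring.
  by apply/fker; rewrite rmorphB e subrr.
- by move=> j; exists (a j).
- move/fker: ha; rewrite rmorph_sum => e; apply: etrans e.
  by apply: eq_bigr => j _; rewrite rmorphM rmorphXn.
Qed.

Definition pbasis X : Prop :=
  (forall c, X c -> pind (gen (fun x => X x /\ x <> c)) c) /\ forall y, addm (gen X) m y.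

Lemma pind_mono V V' c : V' `<=` V -> pind V c -> pind V' c.
Proof. by move=> h hV a ha; apply: hV => i; apply: h. Qed.

Lemma pbasis_exists : exists X, pbasis X.
Proof.
pose P X := forall c, X c -> pind (gen (fun x => X x /\ x <> c)) c.
have [F FP Ftot|X [PX Xmax]] := @Zorn_bigcup R P.
  move=> c [X0 FX0 X0c] a Va ha i hi.
  (* A dependence over the union has [p] coefficients, each involving finitely many elements, so it
     already occurs in one member of the chain. *)
  suff hq q : exists X, [/\ F X, X0 `<=` X & forall j, (j < q)%N -> gen (fun x => X x /\ x <> c) (a j)].
    have [X [FX X0X hX]] := hq p.
    pose a' j := if (j < p)%N then a j else 0.
    have -> : a i = a' i by rewrite /a' hi.
    apply: (FP X FX c (X0X _ X0c)) hi.
      move=> j; rewrite /a'; case: ifP => [/hX //|_]; exact: subring0 (gen_psub pR _).1.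
    rewrite (_ : \sum_(j < p) _ = \sum_(j < p) a j * c ^+ j) //.
    by apply: eq_bigr => j _; rewrite /a' ltn_ord.
  have fink (l : seq R) Y : F Y -> (forall x, x \in l -> exists2 X, F X & X x) ->
      exists X, [/\ F X, Y `<=` X & forall x, x \in l -> X x].
    move=> FY; elim: l => [|x l IH] hl; first by exists Y; split=> // z.
    have [|X [FX YX hX]] := IH; first by move=> z hz; apply: hl; rewrite inE hz orbT.
    have [X' FX' X'x] := hl x (mem_head _ _).
    have [XX'|X'X] := Ftot X X' FX FX'.
      exists X'; split=> //; first by move=> z /YX /XX'.
      by move=> z; rewrite inE => /orP[/eqP->//|/hX /XX'].
    by exists X; split=> // z; rewrite inE => /orP[/eqP->|/hX //]; apply: X'X.
  elim: q => [|q [X [FX X0X hX]]]; first by exists X0; split=> // z.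
  have [l [_ hl hgl]] := gen_finite pR (Va q).
  have [|X' [FX' XX' hX']] := fink l X FX; first by move=> x /hl[[Z FZ Zx] _]; exists Z.
  exists X'; split=> //; first by move=> z /X0X /XX'.
  move=> j; rewrite ltnS leq_eqVlt => /orP[/eqP->|/hX].
    by apply: gen_mono hgl => // x hx; split; [apply: hX' | case: (hl x hx)].
  by apply: gen_mono => // x [/XX' ? ?].
exists X; split=> // y; apply: contrapT => ny.
have hgX := gen_psub pR X.
have nXy : ~ X y.
  move=> Xy; apply: ny; exists y, 0; rewrite addr0; split=> //; last exact: ideal0.
  exact: gen_var.
have iy : pind (gen X) y by apply: residue_independence.
pose Y x := X x \/ x = y.
apply: (Xmax Y).
  split; first by move=> x Xx; left.
  by move=> YX; apply: nXy; apply: YX; right.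
move=> c [Xc|->]; last by apply: pind_mono iy; apply: gen_mono => // x [[]].
have hcy : c <> y by move=> e; apply: nXy; rewrite -e.
set V0 := gen (fun x => X x /\ x <> c).
have hV0 : psub V0 by apply: gen_psub.
have hsplit : gen (fun x => Y x /\ x <> c) `<=` span V0 (cpow y).
  move=> x /(gen_split pR y); apply: spanS; apply: gen_mono => // z [[[Xz|->//]] hz _] => //.
move=> a Va ha i hi.
(* Exchange argument: expand the coefficients in powers of [y] and swap the sums. Independence of
   [y] over [gen X], which contains [c], leaves relations among the powers of [c] over [V0], and
   these are trivial by independence of [X]. *)
have [b hb] : exists b : nat -> nat -> R, forall i, (forall j, V0 (b i j)) /\ a i = \sum_(j < p) b i j * y ^+ j.
  apply: (choice_ex (P := fun i (b : nat -> R) => (forall j, V0 (b j)) /\ a i = \sum_(j < p) b j * y ^+ j)) => k.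
  have [b hb] := cpow_expand pR (subring0 hV0.1) (hsplit _ (Va k)).
  by exists b.
have hsum : m (\sum_(j < p) (\sum_(k < p) b k j * c ^+ k) * y ^+ j).
  rewrite (_ : \sum_(j < p) _ = \sum_(k < p) a k * c ^+ k) //.
  rewrite [RHS](eq_bigr (fun k : 'I_p => \sum_(j < p) b k j * y ^+ j * c ^+ k)).
    by rewrite exchange_big /=; apply: eq_bigr => j _; rewrite mulr_suml; apply: eq_bigr => k _; ring.
  by move=> k _; rewrite (hb k).2 mulr_suml.
have hgc k j : gen X (b k j) by apply: gen_mono (( hb k).1 j) => // x [].
have hj j : (j < p)%N -> m (\sum_(k < p) b k j * c ^+ k).
  move=> hjp; apply: (iy (fun j => \sum_(k < p) b k j * c ^+ k)) hjp => // l.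
  apply: (smod_sum (F := fun k => b k l * c ^+ k) (smod_self hgX.1)) => k _.
  by apply: (subringM hgX.1) => //; apply: (subringX _ hgX.1); apply: gen_var.
rewrite (hb i).2; apply: (smod_sum (S := setT) (F := fun j => b i j * y ^+ j)); first exact/smodT.
move=> j hjp; apply: idealMr => //.
by apply: (PX c Xc (fun k => b k j)) hi; [move=> k; apply: (hb k).1 | apply: hj].
Qed.

End ClosedSubrings.

(** * Lower bounds for lengths of spans *)

Section SpanLengths.
Local Open Scope ring_scope.
Local Open Scope classical_set_scope.
Variable R : comNzRingType.
Implicit Types (S N M J : R -> Prop).

(** Triangular independence modulo [N], with coefficients only known to fall in [J]. It is what a
    chain adding one generator at a time needs; for [N = J = 0] it is linear independence. *)
Fixpoint sindep S N J (gs : seq R) : Prop :=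
  if gs is g :: gs' then
    (forall u, S u -> addm N (span S gs') (u * g) -> J u) /\ sindep S N J gs'
  else True.

Lemma sindep_sub S N N' J J' gs : N' `<=` N -> J `&` S `<=` J' -> sindep S N J gs -> sindep S N' J' gs.
Proof.
move=> hN hJ; elim: gs => //= g gs IH [h /IH h']; split=> // u Su hu; apply: hJ; split=> //.
by apply: h => //; move: hu; apply: addmS.
Qed.

Lemma lge_span S' S N J gs : is_subring S' -> smod S' S -> smod S' N -> fin S' J S ->
  sindep S N J gs -> lge S' (size gs * len S' J S) N (addm N (span S gs)).
Proof.
move=> h1 h2 h3 hf; elim: gs => [|g gs IH] //= [hg /IH hl].
have hT : smod S' (addm N (span S gs)) by apply: smod_add => //; apply: smod_span.
have -> : addm N (addm (cyc S g) (span S gs)) = addm (addm N (span S gs)) (cyc S g).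
  by rewrite (addmC (cyc S g)) addmA.
rewrite mulSn addnC; apply: (lge_cat _ _ hl).
- exact: (addmP1 (smod_span gs h2)).
- exact: (addmP1 (smod_cyc g h2)).
- apply/lge_cyc => //; apply: lge_anti (len_lge hf) => u [Su hu]; exact: hg.
Qed.

Lemma span_mul S V gs hs x y : is_subring S -> smod S V -> span S gs x -> span V hs y ->
  span V [seq g * h | g <- gs, h <- hs] (x * y).
Proof.
move=> hS hV; elim: gs x => [x -> _|g gs IH x [_ [b [[s Ss ->] hb ->]]] hy] /=; first by rewrite mul0r.
rewrite (span_cat _ _ hV) mulrDl; exists (s * g * y), (b * y); split=> //; last exact: IH.
have := span_mulr g (smodM (smod_span hs hV) Ss hy).
rewrite (_ : s * y * g = s * g * y); last by ring.
by congr span; apply: eq_map => h; rewrite mulrC.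
Qed.

End SpanLengths.

(** * The Frobenius inequality for complete local domains *)

Section BasisSubrings.
Local Open Scope ring_scope.
Local Open Scope classical_set_scope.
Variables (R : comNzRingType) (p : nat) (m : R -> Prop).
Hypotheses (pR : p \in [pchar R]) (noethR : noetherian R) (hL : local_with_max m).
Hypothesis complR : complete_wrt m.
Variable X : R -> Prop.
Hypothesis hX : pbasis p m X.
Implicit Types (I J K N M : R -> Prop) (e l : seq R).

Let pp : prime p := pcharf_prime pR.
Let pgt0 : (0 < p)%N := prime_gt0 pp.
Let mI := local_ideal hL.
Let hpow k : is_ideal (mpow m k) := mpow_is_ideal mI k.
Local Notation psub := (psub p).
Local Notation pspan := (pspan p).
Local Notation cpow := (cpow p).
Local Notation gen := (gen p).
Local Notation hat := (hat p m).
Local Notation pind := (pind p m).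

Definition basis_off e : R -> Prop := gen (fun x => X x /\ x \notin e).
Definition closed_off e : R -> Prop := hat (basis_off e).
Local Notation V := basis_off.
Local Notation U := closed_off.

Lemma basis_psub e : psub (V e). Proof. exact: gen_psub. Qed.
Lemma closed_psub e : psub (U e). Proof. by apply: hat_psub => //; apply: gen_psub. Qed.
Lemma closed_subring e : is_subring (U e). Proof. by case: (closed_psub e). Qed.

Lemma basis_sub_closed e : V e `<=` U e.
Proof. by apply: sub_hat => //; apply: gen_psub. Qed.

Lemma basis_off_split c e : V e `<=` span (V (c :: e)) (cpow c).
Proof.
move=> x /(gen_split pR c); apply: spanS; apply: gen_mono => // z [[Xz hz] hzc]; split=> //.
by rewrite inE negb_or hz andbT; apply/eqP.
Qed.

Lemma closed_off_split c e : U e `<=` span (U (c :: e)) (cpow c).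
Proof. by apply: hat_span; [exact: pR|exact: noethR|exact: hL|exact: complR|exact: basis_psub|exact: basis_psub|exact: basis_off_split]. Qed.

Lemma closed_off_sub c e : U (c :: e) `<=` U e.
Proof.
apply: hat_mono; apply: gen_mono => // x [Xx]; rewrite inE negb_or => /andP[_ h]; by split.
Qed.

Lemma closed_off_var c e : X c -> c \notin e -> U e c.
Proof. by move=> Xc hc; apply: basis_sub_closed; apply: gen_var. Qed.

Lemma closed_off_span c e : X c -> c \notin e -> span (U (c :: e)) (cpow c) = U e.
Proof.
move=> Xc hc; apply/predeqP => x; split; last exact: closed_off_split.
move=> h; apply: (span_sub (smod_self (closed_subring e))) (spanS (@closed_off_sub c e) h).
move=> _ /mapP[i _ ->]; apply: subringX; first exact: closed_subring.
exact: closed_off_var.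
Qed.

Lemma closed_residue e u : U e u -> exists2 v, V e v & pspan m (U e) (u - v).
Proof.
move=> hu; have [|v Vv hv] := hat_approx pR noethR hL complR 1 _ hu; first exact: basis_psub.
by exists v => //; rewrite mpow1E in hv.
Qed.

Lemma pspan_m_sub W : pspan m W `<=` m.
Proof. by move=> x hx; apply: (pspan_sub_ideal pR mI); apply: pspan_mono hx. Qed.

Lemma closed_pind c e : X c -> pind (U (c :: e)) c.
Proof.
move=> Xc a Ua ha i hi.
have [v hv] := choice_ex (fun j => let: ex_intro2 v h1 h2 := closed_residue (Ua j) in ex_intro (fun v => V (c :: e) v /\ pspan m (U (c :: e)) (a j - v)) v (conj h1 h2)).
rewrite -(subrK (v i) (a i)); apply: idealD => //; first by apply: pspan_m_sub (hv i).2.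
apply: (hX.1 c Xc) hi.
  move=> j; apply: gen_mono (hv j).1 => // x [Xx]; rewrite inE negb_or => /andP[/eqP h _]; by split.
rewrite -(subKr (\sum_(j < p) a j * c ^+ j) (\sum_(j < p) _)); apply: idealB => //.
rewrite -sumrB; apply: (smod_sum (S := setT) (F := fun j => a j * c ^+ j - v j * c ^+ j)); first exact/smodT.
by move=> j _; rewrite -mulrBl; apply: idealMr => //; apply: pspan_m_sub (hv j).2.
Qed.

(** Expand [v] in powers of a basis element: p-independence puts every coefficient in [m], and
    induction applies to them. At the end [v = r^p], and [r^p] in [m] forces [r] in [m]. *)
Lemma gen_residue l v : uniq l -> (forall c, c \in l -> X c) -> gen (fun c => c \in l) v ->
  m v -> pspan m (gen (fun c => c \in l)) v.
Proof.
elim: l v => [|c l IH] v.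
  move=> _ _ /(gen_nil pR)[r ->] mr.
  rewrite -[_ ^+ _]mulr1; apply: pspan_mem; last exact: subring1 (gen_psub pR _).1.
  apply: contrapT => nr; have [r' e] := local_unit hL nr; apply: (local_not1 hL).
  by rewrite -(expr1n _ p) -e exprMn; apply: idealMl.
move=> /= /andP[hc hu] hl hv mv.
have Xc : X c by apply: hl; rewrite mem_head.
have sub1 : gen (fun x => x \in c :: l /\ x <> c) `<=` gen (fun x => x \in l).
  by apply: gen_mono => // x [+ hxc]; rewrite inE => /orP[/eqP|].
have [a [Va ea]] := cpow_expand pR (subring0 (gen_psub pR _).1) (gen_split pR c hv).
rewrite ea; rewrite ea in mv.
have hps := smod_pspan p m (gen_psub pR (fun x => x \in c :: l)).1.
have sub2 : gen (fun x => x \in l) `<=` gen (fun x => x \in c :: l).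
  by apply: gen_mono => // x h; rewrite inE h orbT.
apply: (smod_sum (F := fun i => a i * c ^+ i) hps) => i hi.
have mai : m (a i).
  apply: (hX.1 c Xc) hi => // j; apply: gen_mono (Va j) => // x [hx hxc]; split=> //; exact: hl.
rewrite mulrC; apply: (smodM hps).
  by apply: (subringX _ (gen_psub pR _).1); apply: gen_var; rewrite mem_head.
apply: (pspan_mono (I := m) (V := gen (fun x => x \in l))) => //; apply: IH => //.
  by move=> x h; apply: hl; rewrite inE h orbT.
exact: sub1.
Qed.

(** Hence the ideal [m^p U] has colength one in [U], which is why p-th powers turn a simple step of
    [R] into a step of length at most one. *)
Lemma closed_maximal e : capm (U e) m = pspan m (U e).
Proof.
apply/predeqP => u; split; last first.
  by move=> h; split; [exact: (pspan_in (closed_psub e) h) | apply: pspan_m_sub h].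
move=> [hu mu]; have [v Vv hv] := closed_residue hu.
rewrite -(subrK v u); apply: (smodD (smod_pspan p m (closed_subring e))) => //.
have mv : m v by rewrite -(subKr u v); apply: idealB => //; apply: pspan_m_sub hv.
have [l [hul hl hgl]] := gen_finite pR Vv.
have := gen_residue hul (fun c hc => (hl c hc).1) hgl mv.
apply: pspan_mono => // x hx; apply: basis_sub_closed; apply: gen_mono hx => // z; exact: hl.
Qed.

Lemma pind_sindep W c : is_subring W -> pind W c -> sindep W m m (cpow c).
Proof.
move=> hW hc; rewrite /cpow.
suff h k j : (j + k)%N = p -> sindep W m m [seq c ^+ i | i <- iota j k] by apply: h.
elim: k j => [//|k IH] j hjk /=; split; last by apply: IH; rewrite -hjk addnS.
move=> u Wu [mu [b [hmu hb eu]]].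
have [|a [Wa a0 eb]] := span_cpowP pR (n := p) (subring0 hW) _ hb; first by rewrite addSn -addnS hjk.
have hjp : (j < p)%N by rewrite -hjk addnS ltnS leq_addr.
pose d i := if i == j then u else - a i.
have -> : u = d j by rewrite /d eqxx.
apply: (hc d _ _ j hjp).
  move=> i; rewrite /d; case: eqP => // _; apply: subringN => //.
  by case: (Wa i) => // ->; apply: subring0.
rewrite (_ : \sum_(i < p) _ = u * c ^+ j - b); first by rewrite eu addrK.
rewrite eb [in LHS](bigD1 (Ordinal hjp)) //= /d eqxx; congr (_ + _).
rewrite [in RHS](bigD1 (Ordinal hjp)) //= a0 ?ltnSn // mul0r add0r -sumrN.
by apply: eq_bigr => i; rewrite -val_eqE /= => /negPf ->; rewrite mulNr.
Qed.

(** The powers of [c] span [U e] over the smaller ring, giving at most [p], and their residues are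
    independent, giving at least [p]. *)
Lemma len_closed_step c e : X c -> c \notin e ->
  fin (U (c :: e)) (capm (U e) m) (U e) /\ len (U (c :: e)) (capm (U e) m) (U e) = p.
Proof.
move=> Xc hc; set U' := U (c :: e).
have hU' := closed_subring (c :: e); have hU := closed_subring e.
have hUU' : U' `<=` U e by apply: closed_off_sub.
have hN : smod U' (capm (U e) m) by apply: smod_scal hUU' _; apply: smod_capm.
have hJ : smod U' (capm U' m) by apply: smod_capm.
have [f1 l1] := psub_len pR hL (closed_psub (c :: e)).
have eU : addm (capm (U e) m) (span U' (cpow c)) = U e.
  rewrite closed_off_span //; apply/predeqP => x; split.
    by apply: (addm_sub (smod_self hU)) => // y [].
  exact: (addmP2 (smod_capm hL hU)).
have [|f2 l2] := fin_span_le hU' (smod_self hU') hN hJ (fun _ h => h.1) _ f1 (gs := cpow c).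
  move=> _ s /mapP[i _ ->] [Us ms]; split; last exact: idealMr.
  by apply: subringM => //; [apply: hUU' | apply: subringX => //; apply: closed_off_var].
rewrite eU l1 muln1 size_cpow in f2 l2; split=> //; apply/eqP; rewrite eqn_leq l2 /=.
apply/(lenP f2); rewrite -[X in lge _ _ _ X]eU.
have := @lge_span R U' U' (capm (U e) m) (capm U' m) (cpow c) hU' (smod_self hU') hN f1.
rewrite l1 muln1 size_cpow; apply.
apply: sindep_sub (pind_sindep hU' (@closed_pind c e Xc)); first by move=> x [].
by move=> x [].
Qed.

(* Each simple [S]-module has length [len S' (capm S m) S] over [S']. *)
Lemma len_scalars S' S N M : is_subring S' -> psub S -> S' `<=` S ->
  fin S' (capm S m) S -> smod S N -> smod S M -> N `<=` M -> fin S N M ->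
  fin S' N M /\ len S' N M = (len S' (capm S m) S * len S N M)%N.
Proof.
move=> hS' hS S'S f1 hN hM NM hf.
pose Q (N : R -> Prop) := fin S' N M /\ len S' N M = (len S' (capm S m) S * len S N M)%N.
apply: (@fin_ind R S Q M hS.1 hM _ _ N hN NM hf).
  by split; [apply: finxx | rewrite !lenxx muln0].
move=> {hN NM hf}N K hN hK sK KM hf [fK lK].
have [f2 l2] := fin_len_simple hS.1 hN hK sK.
case: sK => -[NK [y [Ky nNy]]] hs.
have eK : addm N (cyc S y) = K.
  by apply/predeqP => x; split; [apply: (addm_sub hK) => //; apply: cyc_sub | apply: hs].
have eann : ann S N y = capm S m.
  apply/predeqP => s; split=> [[Ss Nsy]|[Ss ms]]; split=> //.
    apply: contrapT => nms; have [r Sr e] := psub_unit pR hL hS Ss nms.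
    by apply: nNy; rewrite -[y]mul1r -e -mulrA; apply: (smodM hN).
  apply: contrapT => nNsy; have Ksy : K (s * y) by apply: (smodM hK).
  have [a [_ [Na [t St ->] e]]] := hs _ Ksy nNsy y Ky.
  have [||r Sr er] := @psub_unit _ _ _ pR hL S (1 - t * s) hS.
  - by case: (hS.1) => h1 hB hMu; apply: hB => //; apply: hMu.
  - move=> h; apply: (local_not1 hL); rewrite -(subrK (t * s) 1).
    by apply: (idealD mI) => //; apply: (idealMl _ mI).
  apply: nNy; rewrite -[y]mul1r -er -mulrA; apply: (smodM hN) => //.
  by rewrite mulrBl mul1r {1}e -mulrA addrK.
have hN' := smod_scal S'S hN; have hSS : smod S' S by apply: smod_scal S'S _; apply: smod_self hS.1.
have fNK : fin S' N K by rewrite -eK; apply/fin_cyc => //; rewrite eann.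
have hK' := smod_scal S'S hK; have hM' := smod_scal S'S hM.
have fNM : fin S' N M by apply: (fin_cat hS' hN' hK' hM' NK KM).
split=> //; rewrite (len_cat hS' hN' hK' hM' NK KM fNM) lK (len_cat hS.1 hN hK hM NK KM hf) l2.
by rewrite -{1}eK len_cyc ?eann // mulnDr muln1.
Qed.

(** With nothing removed, [U] has the full residue field by p-generation; each removed basis element
    contributes a residue extension of degree [p]. *)
Lemma len_closed_residue e : uniq e -> (forall c, c \in e -> X c) ->
  fin (U e) m setT /\ len (U e) m setT = (p ^ size e)%N.
Proof.
elim: e => [|c e IH] /=.
  move=> _ _; have hU := closed_subring [::].
  have hm : smod (U [::]) m by apply: (smod_scal (S := setT)) => //; apply/smodT.
  rewrite expn0; apply: fin_len_simple => //.
  split; first by split=> //; exists 1; split=> //; apply: local_not1.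
  move=> y _ ny x _; have [r er] := local_unit hL ny.
  have [v [mu [hv hmu e]]] := hX.2 (x * r).
  exists (mu * y), (v * y); split; first exact: idealMr.
    by exists v => //; apply: basis_sub_closed; apply: gen_mono hv => // z Xz; split.
  by rewrite -mulrDl addrC -e -mulrA er mulr1.
move=> /andP[hc hu] hl; have Xc : X c by apply: hl; rewrite mem_head.
have [|f l] := IH hu; first by move=> x h; apply: hl; rewrite inE h orbT.
have [f1 l1] := len_closed_step Xc hc.
have hm : smod (U e) m by apply: (smod_scal (S := setT)) => //; apply/smodT.
have [] := len_scalars (closed_subring (c :: e)) (closed_psub e) (@closed_off_sub c e) f1 hm _ _ f => //.
by move=> f2 ->; split=> //; rewrite l1 l expnS.
Qed.

Lemma len_closed e I K : uniq e -> (forall c, c \in e -> X c) -> is_ideal I -> is_ideal K ->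
  I `<=` K -> fin setT I K ->
  fin (U e) I K /\ len (U e) I K = (p ^ size e * len setT I K)%N.
Proof.
move=> hu hl /smodT hI /smodT hK IK hf; have [f l] := len_closed_residue hu hl.
have eT : capm setT m = m by apply/predeqP => x; split=> [[]|].
have := len_scalars (closed_subring e) (psubT R p) (fun x _ => Logic.I) _ hI hK IK hf.
by rewrite eT l; apply.
Qed.

(* Raise a composition series of [R/I] to p-th powers. *)
Lemma len_pspan_le e I : is_ideal I -> fincol I ->
  fin (U e) (pspan I (U e)) (U e) /\ (len (U e) (pspan I (U e)) (U e) <= colen I)%N.
Proof.
move=> hI hf; have hU := closed_subring e; have hUs := smod_self hU.
pose Q (I : R -> Prop) := fin (U e) (pspan I (U e)) (U e) /\ (len (U e) (pspan I (U e)) (U e) <= colen I)%N.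
apply: (@fin_ind R setT Q setT _ _ _ _ I) => //; last exact/smodT.
  by rewrite /Q pspanT //; [rewrite lenxx; split=> //; apply: finxx | exact: closed_psub].
move=> {hI hf}I K hI hK sK KM hf [fK lK].
have [f2 l2] := fin_len_simple (@subringT R) hI hK sK.
case: sK => -[NK [y [Ky nNy]]] hs.
have hI' : is_ideal I by apply/smodT.
have my s : m s -> I (s * y).
  move=> ms; apply: contrapT => nNsy; have Ksy : K (s * y) by apply: (smodM hK).
  have [a [_ [Na [t St ->] e']]] := hs _ Ksy nNsy y Ky.
  have [|r er] := local_unit hL (x := 1 - t * s).
    move=> h; apply: (local_not1 hL); rewrite -(subrK (t * s) 1).
    by apply: idealD => //; apply: idealMl.
  apply: nNy; rewrite -[y]mul1r -er -mulrA; apply: idealMl => //.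
  by rewrite mulrBl mul1r {1}e' -mulrA addrK.
have [f1 l1] := psub_len pR hL (closed_psub e).
have hpI := smod_pspan p I hU; have hpK := smod_pspan p K hU.
have [|f3 l3] := fin_cyc_le (y := y ^+ p) hU hUs hpI (smod_capm hL hU) (fun _ h => h.1) _ f1.
  rewrite closed_maximal; apply: (pspan_sub (S := U e)).
    split; first by rewrite mul0r; apply: pspan0.
    split=> [a b ha hb|s a Us ha]; first by rewrite mulrDl; apply: (smodD hpI).
    by rewrite -mulrA; apply: (smodM hpI).
  move=> s v ms Uv; rewrite (_ : _ * _ = (s * y) ^+ p * v); last by rewrite exprMn; ring.
  by apply: pspan_mem => //; apply: my.
have KI : pspan K (U e) `<=` addm (pspan I (U e)) (cyc (U e) (y ^+ p)).
  have hadd : smod (U e) (addm (pspan I (U e)) (cyc (U e) (y ^+ p))) by apply: smod_add => //; apply: smod_cyc.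
  apply: (pspan_sub hadd) => s v Ks Uv.
  have [a [_ [Ia [t _ ->] ->]]] : addm I (cyc setT y) s by apply: hs.
  exists (a ^+ p * v), (t ^+ p * v * y ^+ p); split; first exact: pspan_mem.
    by exists (t ^+ p * v) => //; apply: subringM => //; apply: (closed_psub e).2.
  by rewrite (frobD pR) exprMn; ring.
have IK : pspan I (U e) `<=` pspan K (U e) by apply: pspan_mono.
have KU : pspan K (U e) `<=` U e by apply: pspan_in; exact: closed_psub.
have f4 : fin (U e) (pspan I (U e)) (pspan K (U e)) by apply: (fin_le _ KI f3).
have f5 := fin_cat hU hpI hpK hUs IK KU f4 fK.
split=> //; rewrite (len_cat hU hpI hpK hUs IK KU f5) /colen (len_cat (@subringT R) hI hK _ NK KM hf) // l2.
apply: leq_add lK; apply: leq_trans (len_le _ KI f3) _ => //.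
by rewrite -l1.
Qed.

End BasisSubrings.

(** * Generic rank over a subring of a domain *)

Section TorsionRank.
Local Open Scope ring_scope.
Local Open Scope classical_set_scope.
Variable R : comNzRingType.
Hypothesis domR : forall x y : R, x * y = 0 -> x = 0 \/ y = 0.
Implicit Types (S J : R -> Prop) (gs : seq R).

Definition zero_set : R -> Prop := fun x => x = 0.

(** A common denominator [c] replaces the fraction field of [S]; the least size of such a list is
    the generic rank. *)
Definition spans_up_to_torsion S gs : Prop :=
  exists c, [/\ S c, c <> 0 & forall h, span S gs (c * h)].

Lemma addm0l S : addm zero_set S = S.
Proof.
apply/predeqP => x; split=> [[_ [b [-> Sb ->]]]|Sx]; first by rewrite add0r.
by exists 0, x; rewrite add0r.
Qed.

(** A relation with nonzero coefficient [u] at [g] allows [g] to be dropped after replacing the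
    denominator [c] by [u c]. *)
Lemma minimal_span_indep S gs : is_subring S -> spans_up_to_torsion S gs ->
  (forall gs', spans_up_to_torsion S gs' -> (size gs <= size gs')%N) ->
  sindep S zero_set zero_set gs.
Proof.
move=> hS [c [Sc c0 hc]] hmin; have hSs := smod_self hS.
suff h l1 l2 : gs = l1 ++ l2 -> sindep S zero_set zero_set l2 by apply: (h [::]).
elim: l2 l1 => [//|g l2 IH] l1 e /=; split; last by apply: (IH (rcons l1 g)); rewrite cat_rcons.
rewrite addm0l => u Su hu; apply: contrapT => u0.
have /hmin : spans_up_to_torsion S (l1 ++ l2).
  exists (u * c); split; [exact: subringM | by move=> /domR[] |].
  move=> h; rewrite -mulrA; have := hc h; rewrite e !(span_cat _ _ hSs).
  move=> [a [_ [ha [_ [b [[s Ss ->] hb ->]]] ->]]].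
  exists (u * a), (s * (u * g) + u * b); split; last by ring.
    exact: (smodM (smod_span l1 hSs)).
  by apply: (smodD (smod_span l2 hSs)); apply: (smodM (smod_span l2 hSs)).
by rewrite e !size_cat /= addnS ltnn.
Qed.

Lemma torsion_rank_exists S gs0 : is_subring S -> spans_up_to_torsion S gs0 ->
  exists gs, [/\ spans_up_to_torsion S gs, sindep S zero_set zero_set gs
    & forall gs', spans_up_to_torsion S gs' -> (size gs <= size gs')%N].
Proof.
move=> hS h0; pose P n := `[< exists2 gs, size gs = n & spans_up_to_torsion S gs >].
have exP : exists n, P n by exists (size gs0); apply/asboolP; exists gs0.
case: (ex_minnP exP) => n /asboolP[gs egs hgs] hmin.
have hm gs' : spans_up_to_torsion S gs' -> (size gs <= size gs')%N.
  by move=> h; rewrite egs; apply: hmin; apply/asboolP; exists gs'.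
by exists gs; split=> //; apply: minimal_span_indep.
Qed.

Lemma span_indep_coef S J gs : is_subring S -> smod S J -> J `<=` S ->
  sindep S zero_set zero_set gs ->
  forall l1 g l2 u, gs = l1 ++ g :: l2 -> S u ->
  addm (span J gs) (span S l2) (u * g) -> J u.
Proof.
move=> hS hJ JS; elim: gs => [|g0 gs IH]; first by move=> _ [|? ?].
rewrite [sindep _ _ _ _]/= addm0l => -[h0 hgs] [|h l1] g l2 u [].
  move=> <- <- Su [_ [y [[_ [x [[j Jj ->] hx ->]]] hy e]]].
  suff hz : span S gs ((u - j) * g0).
    have Suj : S (u - j) by case: (hS) => _ hB _; apply: hB => //; apply: JS.
    by have /eqP := h0 _ Suj hz; rewrite subr_eq0 => /eqP ->.
  rewrite mulrBl e (_ : _ - _ = x + y); last by ring.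
  by apply: (smodD (smod_span gs (smod_self hS))) => //; apply: spanS hx.
move=> _ egs Su [_ [y [[_ [x [[j Jj ->] hx ->]]] hy e]]].
have hss l := smod_span l (smod_self hS).
have hl2 z : span S l2 z -> span S gs z.
  rewrite egs -cat_rcons (span_cat _ _ (smod_self hS)) => hz.
  by apply: (addmP2 (hss _)).
have hg : span S gs g by apply: span_mem => //; rewrite egs mem_cat mem_head orbT.
have j0 : j * g0 = 0.
  have : zero_set j.
    apply: h0; first exact: JS.
    rewrite (_ : j * g0 = u * g - x - y); last by rewrite e; ring.
    have hx' : span S gs x := spanS JS hx.
    by apply: (smodB hS (hss gs)); [apply: (smodB hS (hss gs)) => //; apply: (smodM (hss gs)) | exact: hl2].
  by move=> ->; rewrite mul0r.
apply: (IH hgs l1 g l2 u egs Su); exists x, y; split=> //.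
by rewrite e j0 add0r.
Qed.

(** The span is free on [gs], so modulo [J] it is a direct sum of copies of [S/J]. *)
Lemma len_span_multiple S J gs : is_subring S -> smod S J -> J `<=` S ->
  sindep S zero_set zero_set gs -> fin S J S ->
  fin S (span J gs) (span S gs) /\ (size gs * len S J S <= len S (span J gs) (span S gs))%N.
Proof.
move=> hS hJ JS hgs hf; have hSs := smod_self hS.
have hJs := smod_span gs hJ.
have eS : addm (span J gs) (span S gs) = span S gs.
  apply/predeqP => x; split; last exact: (addmP2 hJs).
  by apply: (addm_sub (smod_span gs hSs)) => //; apply: spanS.
have [|f _] := fin_span_le hS hSs hJs hJ JS _ hf (gs := gs).
  move=> g s hg Js; elim: gs hg {hgs hJs eS} => // g' gs IH.
  rewrite inE => /orP[/eqP ->|/IH h].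
    by exists (s * g'), 0; rewrite addr0; split=> //; [exists s | apply: (smod0 (smod_span gs hJ))].
  by exists 0, (s * g); rewrite add0r; split=> //; exists 0; rewrite ?mul0r //; apply: (smod0 hJ).
rewrite eS in f; split=> //; apply/(lenP f); rewrite -[X in lge _ _ _ X]eS.
apply: lge_span => //.
suff h l1 l2 : gs = l1 ++ l2 -> sindep S (span J gs) J l2 by apply: (h [::]).
elim: l2 l1 => [//|g l2 IH] l1 e /=; split; last by apply: (IH (rcons l1 g)); rewrite cat_rcons.
by move=> u Su hu; apply: (span_indep_coef hS hJ JS hgs e Su).
Qed.

Lemma span_trans S V gs hs : smod V V -> S `<=` span V hs ->
  span S gs `<=` span V [seq h * g | g <- gs, h <- hs].
Proof.
move=> hV h; elim: gs => [//|g gs IH] _ [_ [b [[s Ss ->] hb ->]]] /=.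
rewrite (span_cat _ _ hV); exists (s * g), b; split=> //; last exact: IH.
by apply: span_mulr; apply: h.
Qed.

End TorsionRank.

(** * Comparison of Frobenius powers over [R] and over [U] *)

Section FrobeniusColength.
Local Open Scope ring_scope.
Local Open Scope classical_set_scope.
Variables (R : comNzRingType) (p : nat) (m : R -> Prop).
Hypotheses (pR : p \in [pchar R]) (noethR : noetherian R) (hL : local_with_max m).
Hypothesis complR : complete_wrt m.
Hypothesis domR : forall x y : R, x * y = 0 -> x = 0 \/ y = 0.
Variable d : nat.
Hypothesis upR : forall s : R, s <> 0 ->
  exists C, forall n, (n * colen (addm (pid s) (mpow m n)) <= C * n ^ d)%N.
Variable X : R -> Prop.
Hypothesis hX : pbasis p m X.
Implicit Types (I J K N M : R -> Prop) (e l gs : seq R).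

Let pp : prime p := pcharf_prime pR.
Let pgt0 : (0 < p)%N := prime_gt0 pp.
Let mI := local_ideal hL.
Let hpow k : is_ideal (mpow m k) := mpow_is_ideal mI k.
Local Notation pspan := (pspan p).
Local Notation cpow := (cpow p).
Local Notation gen := (gen p).
Local Notation V := (basis_off p X).
Local Notation U := (closed_off p m X).

Let hU e : is_subring (U e) := closed_subring pR hL X e.
Let hUp e : psub p (U e) := closed_psub pR hL X e.

(** With [s] generators of [m], dividing the exponents of a monomial by [p] with remainder loses at
    most [s p] in degree, so a p-th power of a monomial of degree at least [n] splits off. *)
Lemma mpow_frob : exists s, forall n, mpow m (p * (n + s)) `<=` pspan (mpow m n) setT.
Proof.
have [ts ets] := noetherian_fg noethR mI; exists (size ts) => n.
have mts t : t \in ts -> m t by move=> h; rewrite ets; apply: span_mem.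
rewrite {1}ets; apply: mpow_monomials; first exact: ideal_pspan.
move=> g hs hsum; have [r ->] := monomial_div p hs.
apply: pspan_mem => //.
have hs' : size [seq (i %/ p)%N | i <- g] = size ts by rewrite size_map.
apply: mpow_anti (monomial_mpow mts mI hs') => //.
have := sumn_div g pgt0; rewrite hsum hs.
by rewrite mulnDr mulnC [(size ts * p)%N]mulnC leq_add2r mulnC leq_pmul2l.
Qed.

Lemma fincol_pspan I n : mpow m n `<=` I -> fincol (pspan I setT).
Proof.
move=> h; have [s hs] := mpow_frob; apply: fincol_le (fincol_mpow noethR hL (p * (n + s))).
by move=> x /hs; apply: pspan_mono.
Qed.

(** Products of powers of the removed elements span modulo [m], hence finitely many elements span
    modulo any [m^n]. Some power of [m] lies in [m^[p]], and [hat_generators] finishes. *)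
Lemma closed_generated e : exists gs, forall x, span (U e) gs x.
Proof.
have hV e' : psub p (V e') by apply: gen_psub.
have hVs e' : smod (V e') (V e') := smod_self (hV e').1.
have [ts ets] := noetherian_fg noethR mI.
have step1 : exists gs, forall x, addm (span (V e) gs) m x.
  elim: e => [|c e [gs hgs]].
    exists [:: 1] => x; have [v [mu [hv hmu ->]]] := hX.2 x.
    exists v, mu; split=> //; exists (v * 1), 0; rewrite addr0 mulr1; split=> //; exists v; rewrite ?mulr1 //.
    by apply: gen_mono hv => // z Xz; split.
  exists [seq h * g | g <- gs, h <- cpow c] => x.
  apply: addmS (hgs x) => //; apply: span_trans => //; exact: basis_off_split.
have step2 n : exists gs, forall x, addm (span (V e) gs) (mpow m n) x.
  elim: n => [|n [gs hgs]].
    by exists [::] => x; exists 0, x; rewrite add0r mpow0T.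
  have [ks eks] := noetherian_fg noethR (hpow n); have [gs1 hgs1] := step1.
  exists (gs ++ [seq h * g | h <- gs1, g <- ks]) => x.
  have [a [b [ha hb ->]]] := hgs x; rewrite (span_cat _ _ (hVs e)) -addmA.
  exists a, b; split=> //; rewrite eks in hb.
  have hsm : smod (V e) (addm (span (V e) [seq h * g | h <- gs1, g <- ks]) (mpow m n.+1)).
    by apply: smod_add; [apply: smod_span | apply: (smod_scal (S := setT)) => //; apply/smodT].
  have mks k : k \in ks -> mpow m n k by move=> hk; rewrite eks; apply: span_mem.
  have sub k : k \in ks -> forall r, span (V e) gs1 r ->
      span (V e) [seq h * g | h <- gs1, g <- ks] (r * k).
    move=> hk r hr; apply: (span_mul (hV e).1 (hVs e) hr).
    by apply: span_mem => //; case: (hV e).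
  suff h ks' : {subset ks' <= ks} -> forall b, span setT ks' b ->
      addm (span (V e) [seq h * g | h <- gs1, g <- ks]) (mpow m n.+1) b by apply: (h ks).
  elim: ks' => [_ _ ->|k ks' IH hks' _ [_ [b' [[r _ ->] hb' ->]]]]; first exact: smod0 hsm.
  have hk : k \in ks by apply: hks'; rewrite mem_head.
  apply: (smodD hsm); last by apply: IH => // z hz; apply: hks'; rewrite inE hz orbT.
  have [w [u [hw hu er]]] := hgs1 r; exists (w * k), (u * k); split; last by rewrite er mulrDl.
    exact: sub.
  by apply: mpow_mul => //; apply: mks.
have hK : is_ideal (pspan m setT) by apply: ideal_pspan.
have tK t : t \in ts -> pspan m setT (t ^+ p).
  by move=> ht; rewrite -[_ ^+ _]mulr1; apply: pspan_mem => //; rewrite ets; apply: span_mem.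
have := mpow_pigeonhole hK tK; rewrite -ets => hpig.
have [gs hgs] := step2 (size ts * p).+1.
exists gs; apply: (hat_generators pR noethR hL complR (hV e)) => x.
by apply: addmS (hgs x).
Qed.

Lemma closed_spans e : exists gs, spans_up_to_torsion (U e) gs.
Proof.
have [gs hgs] := closed_generated e; exists gs, 1; split=> //; first exact: subring1.
exact/eqP/oner_neq0.
Qed.

Let fin_len_pspan e I : uniq e -> (forall c, c \in e -> X c) -> is_ideal I ->
  fincol (pspan I setT) -> fin (U e) (pspan I setT) setT /\
  len (U e) (pspan I setT) setT = (p ^ size e * colen (pspan I setT))%N.
Proof. by move=> hu hl hI hf; apply: (len_closed pR noethR hL complR hX) => //; apply: ideal_pspan. Qed.

(* The error terms are colengths of ideals containing [m^n] and a fixed nonzero element. *)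
Let error_bound c : c <> 0 -> exists C, forall n I, is_ideal I -> mpow m n `<=` I ->
  (n * colen (addm I (pid c)) <= C * n ^ d)%N.
Proof.
move=> c0; have [C hC] := upR c0; exists C => n I hI hn; apply: leq_trans (hC n).
rewrite leq_mul2l; apply/orP; right; apply: colen_le; last first.
  by apply: fincol_le (fincol_mpow noethR hL n); apply: idealP2; apply: ideal_pid.
apply: ideal_add_sub; first by apply: ideal_add => //; apply: ideal_pid.
  exact: idealP2.
by move=> x /hn; apply: idealP1; apply: ideal_pid.
Qed.

(** Let [L] be [I^[p]] plus the [U]-span of [gs]. The quotient of [L] by [I^[p]] is an image of
    copies of [U/I^p U], one for each element of [gs]. The rest [R/L] is finitely generated over [U]
    and killed by [(I + (c))^p U], so it only contributes an error. *)
Lemma frob_upper e gs : uniq e -> (forall c, c \in e -> X c) -> spans_up_to_torsion (U e) gs ->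
  exists C, forall n I, is_ideal I -> mpow m n `<=` I ->
  (n * (p ^ size e * colen (pspan I setT)) <= n * (size gs * colen I) + C * n ^ d)%N.
Proof.
move=> hu hl [c [Uc c0 hc]]; have [hs hhs] := closed_generated e.
have [C hC] := error_bound c0; exists (size hs * C)%N => n I hI hn.
have fI : fincol I by apply: fincol_le hn (fincol_mpow noethR hL n).
have fP := fincol_pspan hn.
have [fUP <-] := fin_len_pspan hu hl hI fP.
have hUs := smod_self (hU e).
set N := pspan I setT; have hNi : is_ideal N by apply: ideal_pspan.
have hN : smod (U e) N by apply: (smod_scal (S := setT)) => //; apply/smodT.
have [f1 l1] := len_pspan_le pR noethR hL complR hX e hI fI.
have hp1 := smod_pspan p I (hU e).
have [||f2 l2] := fin_span_le (hU e) hUs hN hp1 _ _ f1 (gs := gs).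
- by apply: pspan_in; apply: hUp.
- by move=> g s _ hs'; apply: idealMr => //; apply: pspan_mono hs'.
set L := addm N (span (U e) gs) in f2 l2.
have hLs : smod (U e) L by apply: smod_add => //; apply: smod_span.
set I' := addm I (pid c); have hI' : is_ideal I' by apply: ideal_add => //; apply: ideal_pid.
have fI' : fincol I' by apply: fincol_le fI; apply: idealP1; apply: ideal_pid.
have [f3 l3] := len_pspan_le pR noethR hL complR hX e hI' fI'.
have hp3 := smod_pspan p I' (hU e).
have [||f4 l4] := fin_span_le (hU e) hUs hLs hp3 _ _ f3 (gs := hs).
- by apply: pspan_in; apply: hUp.
- move=> h s _ hs'.
  have {hs'} [a [b [ha hb ->]]] := pspan_add pR hs'.
  rewrite mulrDl; apply: (smodD hLs).
    by apply: (addmP1 (smod_span gs hUs)); apply: idealMr => //; apply: pspan_mono ha.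
  apply: (addmP2 hN); have hsg := smod_span gs hUs.
  elim: hb => {b} [|_ v b [r _ ->] Uv _ IH]; first by rewrite mul0r; apply: smod0 hsg.
  rewrite mulrDl; apply: (smodD hsg) => //.
  rewrite (_ : _ * _ = (r ^+ p * v * c ^+ p.-1) * (c * h)).
    apply: (smodM hsg) => //; apply: subringM => //; last exact: subringX.
    by apply: subringM => //; apply: (hUp e).2.
  by rewrite exprMn -[in c ^+ p](prednK pgt0) exprS; ring.
have eT : addm L (span (U e) hs) = setT.
  apply/predeqP => x; split=> // _; apply: (addmP2 hLs); exact: hhs.
rewrite eT in f4 l4.
have NL : N `<=` L by apply: (addmP1 (smod_span gs hUs)).
have hT : smod (U e) (setT : set R) by [].
rewrite (len_cat (hU e) hN hLs hT NL (fun _ _ => Logic.I) fUP) mulnDr.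
apply: leq_add.
  by rewrite leq_mul2l (leq_trans l2) ?orbT // leq_mul2l l1 orbT.
apply: leq_trans (leq_mul (leqnn n) l4) _.
rewrite mulnCA -mulnA leq_mul2l; apply/orP; right.
by apply: leq_trans (hC n I hI hn); rewrite leq_mul2l l3 orbT.
Qed.

(** Let [F] be the free span of [gs] and [J = I^p U], and insert [L = JF + cR] between [JF] and [F].
    Since [cR] lies in [F], the product of [I^[p]] and [cR] lies in [JF], so [L/JF] is an image of
    [R/I^[p]]; [F/L] is killed by [(I + (c))^p U] and is an error term. *)
Lemma frob_lower e gs : uniq e -> (forall c, c \in e -> X c) -> spans_up_to_torsion (U e) gs ->
  sindep (U e) (@zero_set R) (@zero_set R) gs ->
  exists C, forall n I, is_ideal I -> mpow m n `<=` I ->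
  (n * (size gs * len (U e) (pspan I (U e)) (U e)) <=
   n * (p ^ size e * colen (pspan I setT)) + C * n ^ d)%N.
Proof.
move=> hu hl [c [Uc c0 hc]] hgs.
have [C hC] := error_bound c0; exists (size gs * C)%N => n I hI hn.
have fI : fincol I by apply: fincol_le hn (fincol_mpow noethR hL n).
have fP := fincol_pspan hn.
have [fUP <-] := fin_len_pspan hu hl hI fP.
have hUs := smod_self (hU e).
have [f1 l1] := len_pspan_le pR noethR hL complR hX e hI fI.
have hp1 := smod_pspan p I (hU e).
have JS : pspan I (U e) `<=` U e by apply: pspan_in; apply: hUp.
have [f2 l2] := len_span_multiple (hU e) hp1 JS hgs f1.
set J := pspan I (U e) in f1 l1 hp1 JS f2 l2 *.
have hJF := smod_span gs hp1; have hF := smod_span gs hUs.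
set JF := span J gs in f2 l2 hJF; set F := span (U e) gs in f2 l2 hF.
have hT : smod (U e) (setT : set R) by [].
pose L := addm JF (cyc setT c).
have hLs : smod (U e) L by apply: smod_add => //; apply: smod_cyc.
have JFF : JF `<=` F by apply: spanS.
have LF : L `<=` F by apply: (addm_sub hF) => // _ [s _ ->]; rewrite mulrC; apply: hc.
have JFL : JF `<=` L by apply: (addmP1 (smod_cyc c hT)).
have Pann : pspan I setT `<=` ann setT JF c.
  move=> x hx; split=> //; elim: hx => {x} [|s r x Is _ _ IH]; first by rewrite mul0r; apply: smod0 hJF.
  rewrite mulrDl; apply: (smodD hJF) => //.
  rewrite (_ : _ * c = s ^+ p * (c * r)); last by ring.
  have := hc r; rewrite /JF; elim: (gs) (c * r) => [_ ->|g gs' IHg _ [_ [b [[t Ut ->] hb ->]]]] /=; first by rewrite mulr0.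
  exists (s ^+ p * t * g), (s ^+ p * b); split; [|exact: IHg | by ring].
  by exists (s ^+ p * t) => //; apply: pspan_mem.
have fann : fin (U e) (ann setT JF c) setT by apply: (fin_le Pann _ fUP).
have lL : (len (U e) JF L <= len (U e) (pspan I setT) setT)%N.
  by rewrite len_cyc //; apply: len_le.
set I' := addm I (pid c); have hI' : is_ideal I' by apply: ideal_add => //; apply: ideal_pid.
have fI' : fincol I' by apply: fincol_le fI; apply: idealP1; apply: ideal_pid.
have [f3 l3] := len_pspan_le pR noethR hL complR hX e hI' fI'.
have hp3 := smod_pspan p I' (hU e).
have [||f4 l4] := fin_span_le (hU e) hUs hLs hp3 _ _ f3 (gs := gs).
- by apply: pspan_in; apply: hUp.
- move=> g s hg hs'.
  have {hs'} [a [b [ha hb ->]]] := pspan_add pR hs'.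
  rewrite mulrDl; apply: (smodD hLs).
    by apply: JFL; apply: span_one => //; apply: (smod_scal JS).
  apply: (addmP2 hJF); elim: hb => {b} [|_ v b [r _ ->] Uv _ [t _ et]]; first by exists 0; rewrite ?mul0r.
  exists (r ^+ p * c ^+ p.-1 * v * g + t) => //; rewrite mulrDl et mulrDl; congr (_ + _).
  by rewrite exprMn -[in c ^+ p](prednK pgt0) exprS; ring.
have eF : addm L (span (U e) gs) = F.
  by apply/predeqP => x; split; [apply: (addm_sub hF) | apply: (addmP2 hLs)].
rewrite eF in f4 l4.
apply: leq_trans (leq_mul (leqnn n) l2) _.
rewrite (len_cat (hU e) hJF hLs hF JFL LF f2) mulnDr; apply: leq_add.
  by rewrite leq_mul2l lL orbT.
apply: leq_trans (leq_mul (leqnn n) l4) _.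
rewrite mulnCA -mulnA leq_mul2l; apply/orP; right.
by apply: leq_trans (hC n I hI hn); rewrite leq_mul2l l3 orbT.
Qed.

End FrobeniusColength.

(** Bernoulli's inequality for [(1 + 1/x)^b] with denominators cleared. *)
Lemma bernoulli_expn x b : (x ^ b * (x + b) <= x * x.+1 ^ b)%N.
Proof.
elim: b => [|b IH]; first by rewrite !expn0 mul1n muln1 addn0.
have h : (x * x ^ b * b <= x ^ b * (x + b) * x)%N by nia.
rewrite !expnS; nia.
Qed.

Lemma expn_ratio_unbounded x B : (0 < x)%N -> ~ forall i, (x.+1 ^ i <= B * x ^ i)%N.
Proof.
move=> hx h; pose i := (x * B).+1.
have h1 := bernoulli_expn x i; have h2 := h i.
have hp : (0 < x ^ i)%N by rewrite expn_gt0 hx.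
have : (x ^ i * (x + i) <= x ^ i * (x * B))%N.
  apply: leq_trans h1 _; apply: leq_trans (leq_mul (leqnn x) h2) _.
  by rewrite mulnA mulnC.
by rewrite leq_pmul2l // /i; lia.
Qed.

(** * Bounding the generic rank *)

Section FrobeniusInequality.
Local Open Scope ring_scope.
Local Open Scope classical_set_scope.
Variables (R : comNzRingType) (p : nat) (m : R -> Prop).
Hypotheses (pR : p \in [pchar R]) (noethR : noetherian R) (hL : local_with_max m).
Hypothesis complR : complete_wrt m.
Hypothesis domR : forall x y : R, x * y = 0 -> x = 0 \/ y = 0.
Variable d : nat.
Hypothesis upR : forall s : R, s <> 0 ->
  exists C, forall n, (n * colen (addm (pid s) (mpow m n)) <= C * n ^ d)%N.
Hypothesis upR0 : exists C, forall n, (colen (mpow m n) <= C * n ^ d)%N.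
Hypothesis lowR : exists K, forall n, (0 < n)%N -> (n ^ d <= K * colen (mpow m n))%N.
Variable X : R -> Prop.
Hypothesis hX : pbasis p m X.
Implicit Types (I J M : R -> Prop) (e l gs : seq R).

Let pp : prime p := pcharf_prime pR.
Let pgt0 : (0 < p)%N := prime_gt0 pp.
Let mI := local_ideal hL.
Let hpow k : is_ideal (mpow m k) := mpow_is_ideal mI k.
Local Notation pspan := (pspan p).
Local Notation cpow := (cpow p).
Local Notation gen := (gen p).
Local Notation V := (basis_off p X).
Local Notation U := (closed_off p m X).

Let hU e : is_subring (U e) := closed_subring pR hL X e.
Let hUp e : psub p (U e) := closed_psub pR hL X e.

Definition adm e : Prop := uniq e /\ forall c, c \in e -> X c.

Lemma adm_cons c e : adm (c :: e) -> [/\ X c, c \notin e & adm e].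
Proof.
move=> [/= /andP[hc hu] hl]; split=> //; first by apply: hl; rewrite mem_head.
by split=> // x hx; apply: hl; rewrite inE hx orbT.
Qed.

Lemma dom_expr (x : R) n : x <> 0 -> x ^+ n <> 0.
Proof.
move=> hx; elim: n => [|n IH]; first by rewrite expr0; apply/eqP/oner_neq0.
by rewrite exprS => /domR[].
Qed.

(** Apply [frob_upper] to [m^n], whose Frobenius power has at least its colength. A smaller rank
    would bound [n] times that colength by [C n^d], contradicting growth of order [n^d] at
    [n = K C + 1]. Crude as it is, this bounds the number of bad steps. *)
Lemma torsion_rank_ge e gs : adm e -> spans_up_to_torsion (U e) gs -> (p ^ size e <= size gs)%N.
Proof.
move=> [hu hl] hgs.
have [C hC] := frob_upper pR noethR hL complR upR hX hu hl hgs.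
have [K hK] := lowR; rewrite leqNgt; apply/negP => hlt.
pose n := (K * C).+1; have hn : (0 < n)%N by [].
have := hC n (mpow m n) (hpow n) (fun _ h => h).
have := colen_le (pspan_sub_ideal pR (hpow n)) (fincol_pspan pR noethR hL (fun _ h => h)).
have := hK n hn.
move: (colen (pspan (mpow m n) setT)) (colen (mpow m n)) => b' b h1 h2 h3.
have h4 : (n * b <= C * n ^ d)%N.
  have h5 : (n * ((size gs).+1 * b) <= n * (p ^ size e * b'))%N.
    by rewrite leq_mul2l; apply/orP; right; apply: leq_mul.
  move: (leq_trans h5 h3); rewrite mulSn mulnDr addnC leq_add2l //.
have h5 : (n * n ^ d <= (K * C) * n ^ d)%N.
  by rewrite -mulnA; apply: leq_trans (leq_mul (leqnn n) h1) _; rewrite mulnCA leq_mul2l h4 orbT.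
have hpos : (0 < n ^ d)%N by rewrite expn_gt0.
by move: h5; rewrite leq_pmul2r // /n ltnn.
Qed.

(** Where [pind] concerns residues, here the powers of [c] are independent over the ring itself.
    Failure lets the rank grow by a factor of only [p - 1] when [c] is removed. *)
Definition good e c : Prop := forall a : nat -> R, (forall i, U (c :: e) (a i)) ->
  \sum_(i < p) a i * c ^+ i = 0 -> forall i, (i < p)%N -> a i = 0.

(** A denominator in [U e] may be lost when [U] shrinks; its p-th power belongs to every [U]. *)
Let spans_frob e gs : spans_up_to_torsion (U e) gs -> exists c, c <> 0 /\
  (forall e', U e' (c ^+ p)) /\ forall h, span (U e) gs (c ^+ p * h).
Proof.
move=> [c [Uc c0 hc]]; exists c; split=> //; split; first by move=> e'; apply: (hUp e').2.
by move=> h; rewrite -[in c ^+ p](prednK pgt0) exprS -mulrA; apply: hc.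
Qed.

Lemma torsion_rank_step c e gs : spans_up_to_torsion (U e) gs ->
  exists gs', spans_up_to_torsion (U (c :: e)) gs' /\ size gs' = (size gs * p)%N.
Proof.
move=> /spans_frob[s [s0 [Us hs]]]; exists [seq h * g | g <- gs, h <- cpow c].
split; last by rewrite size_allpairs size_cpow.
exists (s ^+ p); split=> //; first exact: dom_expr.
move=> h; apply: (@span_trans _ (U e)) => //; first exact: smod_self.
exact: closed_off_split.
Qed.

Lemma torsion_rank_ext e1 e gs : spans_up_to_torsion (U e) gs ->
  exists gs', spans_up_to_torsion (U (e1 ++ e)) gs' /\ size gs' = (size gs * p ^ size e1)%N.
Proof.
move=> hgs; elim: e1 => [|c e1 [gs1 [h1 e1s]]]; first by exists gs; rewrite muln1.
have [gs2 [h2 e2s]] := torsion_rank_step c h1.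
by exists gs2; split=> //; rewrite e2s e1s /= expnSr mulnA.
Qed.

Lemma span_scale S gs (b x : R) : span S gs x ->
  span (fun y => exists2 s, S s & y = b * s) gs (b * x).
Proof.
elim: gs x => [x ->|g gs IH x [_ [y [[s Ss ->] hy ->]]]] /=; first by rewrite mulr0.
exists (b * s * g), (b * y); split; [|exact: IH | by rewrite mulrDr mulrA].
by exists (b * s) => //; exists s.
Qed.

Lemma torsion_rank_bad_step c e gs : ~ good e c -> spans_up_to_torsion (U e) gs ->
  exists gs', spans_up_to_torsion (U (c :: e)) gs' /\ size gs' = (size gs * p.-1)%N.
Proof.
move=> /existsNP[a /not_implyP[Ua /not_implyP[ha /existsNP[j /not_implyP[hj aj0]]]]].
move=> /spans_frob[s [s0 [Us hs]]].
pose cs := [seq c ^+ i | i <- rem j (iota 0 p)].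
have hUs := smod_self (hU (c :: e)); have hsp := smod_span cs hUs.
exists [seq h * g | g <- gs, h <- cs]; split; last first.
  by rewrite size_allpairs size_map size_rem ?size_iota // mem_iota.
exists (a j * s ^+ p); split.
- by apply: subringM.
- by move=> /domR[//|]; apply: dom_expr.
move=> h; rewrite -mulrA; apply: span_trans (span_scale (a j) (hs h)) => //.
move=> _ [u Uu ->].
have [b [Ub ->]] := cpow_expand pR (subring0 (hU (c :: e))) (closed_off_split pR noethR hL complR c Uu).
(* Subtracting [b j] times the relation kills the coefficient of [c^j], so that power can be left
   out at the cost of the denominator [a j]. *)
rewrite (_ : a j * _ = \sum_(i < p) (a j * b i - b j * a i) * c ^+ i).
  apply: (smod_sum (F := fun i => (a j * b i - b j * a i) * c ^+ i) hsp) => i hi.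
  have [->|nij] := eqVneq i j; first by rewrite (mulrC (b j)) subrr mul0r; apply: smod0 hsp.
  apply: span_one => //.
    by apply: map_f; rewrite mem_rem_uniq ?iota_uniq // inE nij mem_iota.
  by case: (hU (c :: e)) => _ hB hM; apply: hB; apply: hM.
transitivity (a j * (\sum_(i < p) b i * c ^+ i) - b j * (\sum_(i < p) a i * c ^+ i)).
  by rewrite ha mulr0 subr0.
by rewrite !mulr_sumr -sumrB; apply: eq_bigr => i _; ring.
Qed.

(** Otherwise [b] bad steps produce spanning lists of size at most a constant times
    [p^|e| ((p-1)/p)^b], while the rank is at least [p^|e|]; this is absurd for large [b]. *)
Lemma good_basis_exists : exists e0, adm e0 /\
  forall e1 c, adm (c :: e1 ++ e0) -> good (e1 ++ e0) c.
Proof.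
apply: contrapT => hno.
have bad e : adm e -> exists e1 c, adm (c :: e1 ++ e) /\ ~ good (e1 ++ e) c.
  move=> he; apply: contrapT => h; apply: hno; exists e; split=> // e1 c hc.
  by apply: contrapT => ng; apply: h; exists e1, c.
have [gs0 hgs0] := closed_spans pR noethR hL complR hX [::].
have p1 : (0 < p.-1)%N by rewrite -subn1 subn_gt0 prime_gt1.
apply: (@expn_ratio_unbounded p.-1 (size gs0) p1) => b; rewrite prednK //.
have [e [gs [he hgs hle]]] : exists e gs, [/\ adm e, spans_up_to_torsion (U e) gs &
   (size gs * p ^ b <= size gs0 * p ^ size e * p.-1 ^ b)%N].
  elim: b => [|b [e [gs [he hgs hle]]]].
    by exists [::], gs0; split=> //; rewrite !expn0 !muln1.
  have [e1 [c [hc ng]]] := bad e he.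
  have [gs1 [h1 s1]] := torsion_rank_ext e1 hgs.
  have [gs2 [h2 s2]] := torsion_rank_bad_step ng h1.
  exists (c :: e1 ++ e), gs2; split=> //; rewrite s2 s1 /= size_cat !expnS expnD.
  move: hle; move: (p ^ size e1)%N (p ^ size e)%N (p ^ b)%N (p.-1 ^ b)%N => u v w z hle.
  rewrite (_ : _ * _ = (size gs * w) * (u * p.-1 * p))%N; last by ring.
  rewrite (_ : (size gs0 * _ * _ = (size gs0 * v * z) * (u * p.-1 * p))%N); last by ring.
  by rewrite leq_mul2r hle orbT.
have hr := torsion_rank_ge he hgs.
have hpos : (0 < p ^ size e)%N by rewrite expn_gt0 pgt0.
rewrite -(leq_pmul2l hpos); apply: leq_trans (leq_mul hr (leqnn _)) _.
by apply: leq_trans hle _; apply: eq_leq; ring.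
Qed.

(* Chevalley's theorem for the decreasing ideals [{x | x^p in m^N}], whose intersection is zero. *)
Lemma frob_chevalley n : exists N, forall x, mpow m N (x ^+ p) -> mpow m n x.
Proof.
pose Z N x := mpow m N (x ^+ p).
have hZ N : is_ideal (Z N).
  rewrite /Z; split; first by rewrite frob0 //; apply: ideal0.
  by split=> [x y hx hy|r x hx]; [rewrite (frobD pR); apply: idealD | rewrite exprMn; apply: idealMl].
have Zanti N N' : (N <= N')%N -> Z N' `<=` Z N by move=> h x; apply: mpow_anti.
(* The colengths of [Z N + m^j] grow with [N] and are bounded by that of [m^j]; an [N] attaining the
   maximum works. *)
have stab j : exists N, (j <= N)%N /\ forall N', Z N `<=` addm (Z N') (mpow m j).
  pose D N := addm (Z N) (mpow m j).
  have hD N : is_ideal (D N) by apply: ideal_add.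
  have fD N : fincol (D N) by apply: fincol_le (fincol_mpow noethR hL j); apply: idealP2.
  pose P k := `[< exists N, (j <= N)%N /\ colen (D N) = k >].
  have exP : exists k, P k by exists (colen (D j)); apply/asboolP; exists j.
  have bP k : P k -> (k <= colen (mpow m j))%N.
    by move=> /asboolP[N [_ <-]]; apply: colen_le (fincol_mpow noethR hL j); apply: idealP2.
  case: (ex_maxnP exP bP) => k /asboolP[N [hjN hN]] hmax; exists N; split=> // N' x Zx.
  have [hle|hgt] := leqP N' N; first by apply: idealP1 => //; apply: Zanti Zx.
  have DD : D N' `<=` D N by apply: addmS => //; apply: Zanti; apply: ltnW.
  have h1 : (colen (D N) <= colen (D N'))%N by apply: colen_le.
  have h2 : (colen (D N') <= k)%N.
    by apply: hmax; apply/asboolP; exists N'; split=> //; apply: leq_trans hjN (ltnW hgt).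
  have h3 := colen_split (hD N') (hD N) DD (fD N').
  have h0 : len setT (D N') (D N) = 0%N by lia.
  have eD : D N = D N'.
    apply: len_eq0 h0 => //; first by apply/smodT.
    by apply: (fin_le _ _ (fD N')).
  by rewrite -/(D N') -eD; apply: idealP1.
have [N hN] := choice_ex stab.
apply: contrapT => hno.
have [x0 [Zx0 nx0]] : exists x, Z (N n) x /\ ~ mpow m n x.
  apply: contrapT => h; apply: hno; exists (N n) => x Zx; apply: contrapT => nx.
  by apply: h; exists x.
have [f hf] : exists f : nat * R -> R, forall q, Z (N q.1) q.2 ->
    Z (N q.1.+1) (f q) /\ mpow m q.1 (q.2 - f q).
  apply: (choice_ex (P := fun q y => Z (N q.1) q.2 -> Z (N q.1.+1) y /\ mpow m q.1 (q.2 - y))) => -[j x] /=.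
  have [Zx|nZ] := pselect (Z (N j) x); last by exists 0.
  have [a [b [Za hb e]]] := (hN j).2 (N j.+1) x Zx.
  by exists a => _; split=> //; rewrite e addrC addKr.
pose xs := fix xs j := if j is j'.+1 then f ((n + j')%N, xs j') else x0.
have Zxs j : Z (N (n + j)%N) (xs j).
  elim: j => [|j IH] /=; first by rewrite addn0.
  by have [h _] := hf ((n + j)%N, xs j) IH; rewrite addnS.
have dxs j : mpow m (n + j) (xs j - xs j.+1) by have [_ h] := hf ((n + j)%N, xs j) (Zxs j).
have [|y hy] := complR (r := fun j => xs j - xs j.+1).
  by move=> j; apply: mpow_anti (dxs j) => //; apply: leq_addl.
have hsum j : \sum_(i < j) (xs i - xs i.+1) = x0 - xs j.
  elim: j => [|j IH]; first by rewrite big_ord0 subrr.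
  by rewrite big_ord_recr /= IH; ring.
have hyx j : mpow m j (x0 - y - xs j).
  by have := hy j; rewrite hsum => /(idealN (hpow j)); congr mpow; ring.
(* [x0 - y] is the limit of the [xs]. Its p-th power lies in every power of [m], so it vanishes by
   Krull's theorem and the absence of zero divisors. *)
have z0 : x0 - y = 0.
  apply: contrapT => nz; apply: (dom_expr (n := p) nz).
  apply: (krull_intersection noethR hL) => k.
  rewrite -(subrK (xs k) (x0 - y)) (frobD pR); apply: idealD => //; first by apply: ideal_frob.
  by apply: Zanti (Zxs k); apply: leq_trans (leq_addl n k) (hN _).1.
have {}hyx j : mpow m j (xs j) by have := hyx j; rewrite z0 sub0r => /(idealN (hpow j)); rewrite opprK.
apply: nx0; have -> : x0 = (x0 - xs n) + xs n by ring.
apply: idealD => //; rewrite -hsum.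
apply: (smod_sum (S := setT) (F := fun i => xs i - xs i.+1)); first exact/smodT.
by move=> i _; apply: mpow_anti (dxs i) => //; apply: leq_addr.
Qed.

Section Descent.
Variable e0 : seq R.
Hypotheses (adm0 : adm e0) (good0 : forall e1 c, adm (c :: e1 ++ e0) -> good (e1 ++ e0) c).

(** The elements of [l] are moved one by one into the removed set. Each time, goodness permits
    comparing the coefficients of [c^0] alone, which replaces [z] by an element involving fewer
    basis elements. When [l] is empty [z] is a p-th power [t^p] with [t] in [I]. *)
Lemma frob_descent l e1 I N y z : is_ideal I -> adm (l ++ e1 ++ e0) ->
  pspan I (gen (fun c => c \in l)) z -> pspan (mpow m N) (U (e1 ++ e0)) (y ^+ p - z) ->
  exists2 t, I t & mpow m N ((y - t) ^+ p).
Proof.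
move=> hI; elim: l e1 z => [|c l IH] e1 z hadm.
  move=> /(pspan_gen_nil pR hI)[t It ->] h; exists t => //.
  by rewrite (frobB pR); apply: pspan_mpow h.
move=> hz hyz.
have [Xc hcn hadm'] := adm_cons hadm.
have hcl : c \notin l by move: hcn; rewrite mem_cat negb_or => /andP[].
have hce : adm (c :: e1 ++ e0).
  case: hadm => hu hl; split.
    by move: hu; rewrite /= mem_cat negb_or cat_uniq => /andP[/andP[_ ->] /and3P[_ _ ->]].
  by move=> x hx; apply: hl; move: hx; rewrite !inE !mem_cat => /orP[->|->]; rewrite ?orbT.
have hg : gen (fun x => x \in c :: l) `<=` span (gen (fun x => x \in l)) (cpow c).
  move=> v /(gen_split pR c); apply: spanS; apply: gen_mono => // x [+ hxc].
  by rewrite inE => /orP[/eqP|].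
have [a [Ga ea]] := cpow_expand pR (pspan0 _ _ _) (pspan_span (gen_psub pR _).1 hg hz).
have hUU := @closed_off_split _ _ _ pR noethR hL complR X c (e1 ++ e0).
have [b [Gb eb]] := cpow_expand pR (pspan0 _ _ _) (pspan_span (hU _) hUU hyz).
pose U' := U (c :: e1 ++ e0).
have GU : gen (fun x => x \in l) `<=` U'.
  apply: gen_sub => //; first exact: hUp.
  move=> x hx; apply: closed_off_var => //.
    by case: hadm => _ hl; apply: hl; rewrite inE mem_cat hx orbT.
  rewrite inE negb_or; apply/andP; split; first by apply: contraNneq hcl => <-.
  by case: hadm' => + _; rewrite cat_uniq => /and3P[_ /hasPn h _]; apply: contraL hx => /h.
have hB : forall u v, U' u -> U' v -> U' (u - v) by case: (hU (c :: e1 ++ e0)).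
(* These are the coefficients, over the smaller ring, of the relation [y^p - z - (y^p - z) = 0];
   goodness of [c] makes them vanish, and [q 0 = 0] says that [y^p - a 0] equals [b 0]. *)
pose q i := (if i == 0%N then y ^+ p else 0) - a i - b i.
have q0 : q 0%N = 0.
  apply: (good0 hce (a := q)) pgt0.
    move=> i; apply: (hB); first apply: (hB).
    - by case: eqP => _; [apply: (hUp _).2 | apply: subring0; apply: hU].
    - exact: (pspan_in (hUp _) (pspan_mono (fun _ h => h) GU (Ga i))).
    - by apply: (pspan_in (hUp _) (Gb i)).
  rewrite /q; under eq_bigr => i _ do rewrite !mulrBl.
  rewrite !sumrB -ea -eb (bigD1 (Ordinal pgt0)) //= big1 => [|i].
    by rewrite mulr1; ring.
  by rewrite -val_eqE /= => /negPf ->; rewrite mul0r.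
apply: (IH (c :: e1) (a 0%N)) => //; last first.
  by rewrite (_ : _ - _ = b 0%N) //; apply/eqP; rewrite -subr_eq0; apply/eqP.
case: hadm => hu hl; split.
  rewrite (perm_uniq (s2 := [:: c] ++ l ++ e1 ++ e0)) //.
  by apply/permPl; apply: (perm_catCA l [:: c]).
by move=> x hx; apply: hl; move: hx; rewrite !mem_cat !inE => /or3P[->|/orP[->|->]|->]; rewrite ?orbT.
Qed.

(** Approximate [y^p] by an element involving finitely many basis elements, with error in
    [(m^N)^p U] and [N] given by Chevalley's theorem for [n]. The descent yields [t] in [I] with
    [y - t] in [m^n], hence in [I]. *)
Lemma pspan_strict I n y : is_ideal I -> mpow m n `<=` I ->
  pspan I (U e0) (y ^+ p) -> I y.
Proof.
move=> hI hn hy; have [N hN] := frob_chevalley n.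
have hps := smod_pspan p (mpow m N) (hU e0).
have [z hz hyz] : exists2 z, pspan I (V e0) z & pspan (mpow m N) (U e0) (y ^+ p - z).
  elim: hy => {y} [|s u y Is Uu _ [z hz hyz]].
    by exists 0; rewrite ?subrr; apply: pspan0.
  have [|v Vv hv] := hat_approx pR noethR hL complR N _ Uu; first exact: basis_psub.
  exists (s ^+ p * v + z); first exact: pspan_cons.
  rewrite (_ : _ - _ = s ^+ p * (u - v) + (y - z)); last by ring.
  by apply: (smodD hps) => //; apply: (smodM hps) => //; apply: (hUp e0).2.
have [l [hu hl hlz]] := pspan_finite pR hz.
have [|t It ht] := @frob_descent l [::] I N y z hI _ hlz hyz.
  split=> [|c]; last by rewrite mem_cat => /orP[/hl[]|]; [| case: adm0 => _; apply].
  rewrite cat_uniq hu /=; case: adm0 => -> _; rewrite andbT.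
  by apply/hasPn => c hc; apply/negP => /hl[_]; rewrite hc.
by rewrite -(subrK t y); apply: idealD => //; apply/hn/hN.
Qed.

Lemma colen_le_pspan I n : is_ideal I -> mpow m n `<=` I ->
  (colen I <= len (U e0) (pspan I (U e0)) (U e0))%N.
Proof.
move=> hI hn; have fI : fincol I by apply: fincol_le hn (fincol_mpow noethR hL n).
have [f _] := len_pspan_le pR noethR hL complR hX e0 hI fI.
apply/(lenP f); apply: (lge_strict_map (Phi := fun K => pspan K (U e0)) _ _ (len_lge fI)).
  by move=> K hK IK _; split; [apply: smod_pspan | apply: pspan_in].
move=> K K' hK hK' IK _ [KK' [y [K'y nKy]]]; split; first exact: pspan_mono.
exists (y ^+ p); split; first by rewrite -[_ ^+ _]mulr1; apply: pspan_mem => //; apply: subring1.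
move=> h; apply: nKy; apply: (@pspan_strict K n) h; last by move=> x /hn /IK.
by case: hK => [->//|]; move/smodT.
Qed.

(** With [f = |e0|] and [b n] the colength of [m^n], [frob_lower], [colen_le_pspan] and [mpow_frob]
    give [rank * b(n) <= p^f b(p(n+s))] up to error. A rank above [p^(f+d)] would make [b] grow by a
    fixed factor larger than [p^d] at each step of [n -> p(n+s)], contradicting [b(n) = O(n^d)]. *)
Lemma torsion_rank_le gs : spans_up_to_torsion (U e0) gs ->
  sindep (U e0) (@zero_set R) (@zero_set R) gs -> (size gs <= p ^ (size e0 + d))%N.
Proof.
move=> hgs hind; have [hu hl] := adm0.
have [C hC] := frob_lower pR noethR hL complR upR hX hu hl hgs hind.
have [s hs] := mpow_frob pR noethR hL.
have [C' hC'] := upR0; have [K hK] := lowR.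
set f := size e0; pose b n := colen (mpow m n).
have bpos n : (0 < n)%N -> (0 < b n)%N.
  move=> hn; have := hK n hn; have : (0 < n ^ d)%N by rewrite expn_gt0 hn.
  by rewrite /b; case: colen => //; rewrite muln0; lia.
have main n : (n * (size gs * b n) <= n * (p ^ f * b (p * (n + s))) + C * n ^ d)%N.
  have h1 := hC n (mpow m n) (hpow n) (fun _ h => h).
  have h2 := colen_le_pspan (hpow n) (fun _ h => h).
  have h3 := colen_le (hs n) (fincol_mpow noethR hL _).
  apply: leq_trans (_ : n * (size gs * len (U e0) (pspan (mpow m n) (U e0)) (U e0)) <= _)%N.
    by rewrite leq_mul2l leq_mul2l h2 !orbT.
  apply: leq_trans h1 _; rewrite leq_add2r leq_mul2l leq_mul2l; apply/orP; right; apply/orP; right.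
  exact: h3.
rewrite leqNgt; apply/negP => hlt.
(* The doubling leaves room for the error: the rank is at least [p^(f+d) + 1], and for [n > 2CK] the
   error costs at most half of [b n]. *)
pose x := (2 * p ^ (f + d))%N.
have step n : (2 * (C * K) < n)%N -> (x.+1 * b n <= 2 * p ^ f * b (p * (n + s)))%N.
  move=> hn; have h1 := main n; have h2 := hK n (leq_ltn_trans (leq0n _) hn).
  rewrite -/(b n) in h2; move: h1 h2; rewrite /x.
  move: (b n) (b (p * (n + s))%N) (n ^ d)%N hlt; rewrite -/f.
  move: (p ^ f)%N (p ^ (f + d))%N (size gs) => P Q r b1 b2 nd hlt h1 h2.
  have npos : (0 < n)%N by lia.
  rewrite -(leq_pmul2l npos).
  have h3 : (2 * (C * nd) <= n * b1)%N by nia.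
  have h4 : (n * (Q.+1 * b1) <= n * (r * b1))%N by rewrite leq_mul2l leq_mul2r hlt !orbT.
  nia.
pose n0 := (2 * (C * K)).+1.
pose ns := fix ns i := if i is i'.+1 then (p * (ns i' + s))%N else n0.
have nsge i : (n0 <= ns i)%N.
  elim: i => //= i IH; apply: leq_trans IH _; nia.
(* The shift [2 s] is absorbed because [p >= 2] gives [p(n+s) + 2s <= p(n+2s)]. *)
have nsle i : (ns i + 2 * s <= p ^ i * (n0 + 2 * s))%N.
  elim: i => [|i IH] /=; first by rewrite expn0 mul1n.
  have p2 := prime_gt1 pp.
  rewrite expnS -mulnA; apply: leq_trans (_ : p * (ns i + 2 * s) <= _)%N; last by rewrite leq_mul2l IH orbT.
  nia.
have iter i : (x.+1 ^ i * b n0 <= (2 * p ^ f) ^ i * b (ns i))%N.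
  elim: i => [|i IH]; first by rewrite !expn0.
  rewrite !expnS -!mulnA; apply: leq_trans (leq_mul (leqnn _) IH) _.
  rewrite mulnCA [X in (_ <= X)%N](_ : _ = (2 * p ^ f) ^ i * (2 * p ^ f * b (ns i.+1)))%N; last by ring.
  by rewrite leq_mul2l step ?orbT //; apply: leq_ltn_trans (nsge i).
have xpos : (0 < x)%N by rewrite muln_gt0 expn_gt0 pgt0.
apply: (@expn_ratio_unbounded x (C' * (n0 + 2 * s) ^ d) xpos) => i.
apply: leq_trans (_ : x.+1 ^ i * b n0 <= _)%N; first by rewrite leq_pmulr // bpos.
apply: leq_trans (iter i) _.
have h1 : (b (ns i) <= C' * (p ^ i * (n0 + 2 * s)) ^ d)%N.
  apply: leq_trans (hC' _) _; rewrite leq_mul2l leq_exp2r_weak ?orbT //.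
  by apply: leq_trans (nsle i); apply: leq_addr.
apply: leq_trans (leq_mul (leqnn _) h1) _.
have -> : (x = 2 * p ^ f * p ^ d)%N by rewrite /x expnD mulnA.
rewrite !expnMn -!expnM [(i * d)%N]mulnC; apply: eq_leq; ring.
Qed.

End Descent.

End FrobeniusInequality.

Theorem frobenius_colength (R : comNzRingType) (p : nat) (m : R -> Prop) (d : nat) :
  p \in GRing.pchar R -> noetherian R -> local_with_max m -> complete_wrt m ->
  (forall x y : R, (x * y = 0)%R -> x = 0%R \/ y = 0%R) ->
  (forall s : R, s <> 0%R -> exists C, forall n, (n * colen (addm (pid s) (mpow m n)) <= C * n ^ d)%N) ->
  (exists C, forall n, (colen (mpow m n) <= C * n ^ d)%N) ->
  (exists K, forall n, (0 < n)%N -> (n ^ d <= K * colen (mpow m n))%N) ->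
  exists C, forall n (I : R -> Prop), is_ideal I -> (forall x, mpow m n x -> I x) ->
    (n * colen (pspan p I setT) <= n * (p ^ d * colen I) + C * n ^ d)%N.
Proof.
move=> pR noethR hL complR domR upR upR0 lowR.
have [X hX] := pbasis_exists pR hL.
have [e0 [adm0 good0]] := good_basis_exists pR noethR hL complR domR upR lowR hX.
have [gs0 hgs0] := closed_spans pR noethR hL complR hX e0.
have hU := closed_subring pR hL X e0.
have [gs [hgs hind _]] := torsion_rank_exists domR hU hgs0.
have hr := torsion_rank_le pR noethR hL complR domR upR upR0 lowR hX adm0 good0 hgs hind.
have [hu hl] := adm0.
have [C hC] := frob_upper pR noethR hL complR upR hX hu hl hgs.
exists C => n I hI hn; have := hC n I hI hn.
have pf : (0 < p ^ size e0)%N by rewrite expn_gt0 prime_gt0 ?(pcharf_prime pR).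
move: hr; rewrite expnD.
move: (p ^ size e0)%N (p ^ d)%N (size gs) (colen (pspan p I setT)) (colen I) (n ^ d)%N pf => P D r a b nd pf h1 h2.
have h3 : (n * (r * b) <= P * (n * (D * b)))%N.
  by rewrite [leqRHS]mulnCA leq_mul2l [leqRHS]mulnA leq_mul2r h1 !orbT.
rewrite -(leq_pmul2l pf) mulnCA; apply: leq_trans h2 _.
by rewrite mulnDr; apply: leq_add => //; rewrite leq_pmull.
Qed.

(** * Decomposition along the primes of maximal dimension *)

Section QuotientTransport.
Local Open Scope ring_scope.
Local Open Scope classical_set_scope.
Variables (B R : comNzRingType) (f : {rmorphism B -> R}) (T : B -> Prop).
Hypotheses (fsurj : forall r, exists b, f b = r) (fker : forall x, f x = 0 <-> T x).
Hypothesis hT : is_ideal T.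
Implicit Types (I : B -> Prop) (J : R -> Prop).

Definition image_set I : R -> Prop := fun r => exists2 b, I b & f b = r.

Lemma preimage_ideal J : is_ideal J -> is_ideal (fun b => J (f b)).
Proof.
move=> hJ; split; first by rewrite rmorph0; apply: ideal0.
split=> [a b Ja Jb|r a Ja]; first by rewrite rmorphD; apply: idealD.
by rewrite rmorphM; apply: idealMl.
Qed.

Lemma image_ideal I : is_ideal I -> is_ideal (image_set I).
Proof.
move=> hI; split; first by exists 0; rewrite ?rmorph0 //; apply: ideal0.
split=> [_ _ [a Ia <-] [b Ib <-]|r _ [a Ia <-]].
  by exists (a + b); rewrite ?rmorphD //; apply: idealD.
by have [b <-] := fsurj r; exists (b * a); rewrite ?rmorphM //; apply: idealMl.
Qed.

Lemma preimage_image I : (fun b => image_set I (f b)) = addm I T.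
Proof.
apply/predeqP => b; split=> [[a Ia e]|[a [t [Ia Tt ->]]]].
  by exists a, (b - a); split=> //; [apply/fker; rewrite rmorphB e subrr | ring].
by exists a => //; rewrite rmorphD (fker t).2 // addr0.
Qed.

Lemma image_preimage J : image_set (fun b => J (f b)) = J.
Proof.
apply/predeqP => r; split=> [[b Jb <-] //|Jr].
by have [b e] := fsurj r; exists b; rewrite ?e.
Qed.

Lemma colen_preimage J : is_ideal J ->
  (fincol J <-> fincol (fun b => J (f b))) /\ (fincol J -> colen J = colen (fun b => J (f b))).
Proof.
move=> hJ; have hJ' := preimage_ideal hJ; apply: len_lge_iff => n; split=> h.
  have : lge setT n (fun b => setT b /\ J (f b)) setT.
    apply: lge_pull h => //; [exact: rmorphD | exact/smodT | |].
      by move=> s x _ _; exists (f s); rewrite ?rmorphM.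
    by move=> y _; have [b e] := fsurj y; exists b => //; rewrite e subrr; apply: ideal0.
  by apply: lge_anti => b Jb; split.
apply: (@lge_push _ _ setT (fun b => J (f b)) setT setT J setT f) h => //; try exact/smodT.
- exact: rmorphD.
- by move=> s x _ _; have [b <-] := fsurj s; exists b; rewrite ?rmorphM.
Qed.

Lemma fincol_image I : is_ideal I -> fincol I -> fincol (image_set I).
Proof.
move=> hI hf; have [h _] := colen_preimage (image_ideal hI); apply/h.
by rewrite preimage_image; apply: fincol_le hf; apply: idealP1.
Qed.

Lemma colen_image I : is_ideal I -> fincol I -> colen (image_set I) = colen (addm I T).
Proof.
move=> hI hf; have [_ h] := colen_preimage (image_ideal hI).
by rewrite h ?preimage_image //; apply: fincol_image.
Qed.

Lemma image_mpow (m : B -> Prop) n : mpow (image_set m) n = image_set (mpow m n).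
Proof.
apply/predeqP => r; split.
  elim=> {n r} [r|k|k _ _ [a ma <-] _ [b hb <-]|k _ _ _ [a ha <-] _ [b hb <-]].
  - by have [b e] := fsurj r; exists b => //; constructor.
  - by exists 0; rewrite ?rmorph0 //; constructor.
  - by exists (a * b); rewrite ?rmorphM //; apply: mpow_mul.
  - by exists (a + b); rewrite ?rmorphD //; apply: mpow_add.
move=> [b hb <-]; elim: hb => {n b} [b|k|k a b ma hb IH|k a b _ ha _ hb].
- by constructor.
- by rewrite rmorph0; constructor.
- by rewrite rmorphM; apply: mpow_mul => //; exists a.
- by rewrite rmorphD; apply: mpow_add.
Qed.

Lemma quotient_noetherian : noetherian B -> noetherian R.
Proof.
move=> hN; apply: noetherian_of_fg => J hJ.
have [gs e] := noetherian_fg hN (preimage_ideal hJ).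
exists [seq f g | g <- gs]; rewrite -(image_preimage J) e; apply/predeqP => r; split.
  move=> [b hb <-]; elim: gs b hb {e} => [b ->|g gs IH b [_ [c [[s _ ->] hc ->]]]] /=; first by rewrite rmorph0.
  by exists (f (s * g)), (f c); split; [exists (f s); rewrite ?rmorphM | exact: IH | rewrite rmorphD].
apply: span_sub; first by apply/smodT/image_ideal/ideal_span.
by move=> _ /mapP[g hg ->]; exists g => //; apply: span_mem.
Qed.

Lemma quotient_local (m : B -> Prop) : local_with_max m -> T `<=` m -> local_with_max (image_set m).
Proof.
move=> hL Tm; have mI := local_ideal hL; split.
  split; first exact: image_ideal.
  move=> [b mb e]; apply: (local_not1 hL); rewrite -(subrK b 1); apply: idealD => //.
  by apply: Tm; apply/fker; rewrite rmorphB rmorph1 e subrr.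
move=> J [hJ nJ] r Jr; have [b e] := fsurj r; exists b => //.
apply: (local_proper hL (preimage_ideal hJ)); first by rewrite rmorph1.
by rewrite e.
Qed.

Lemma quotient_complete (m : B -> Prop) : complete_wrt m -> complete_wrt (image_set m).
Proof.
move=> hc r hr.
have [b hb] : exists b : nat -> B, forall n, mpow m n (b n) /\ f (b n) = r n.
  apply: (choice_ex (P := fun n b => mpow m n b /\ f b = r n)) => n.
  by have := hr n; rewrite image_mpow => -[b h1 h2]; exists b.
have [|x hx] := hc b; first by move=> n; case: (hb n).
exists (f x) => n; rewrite image_mpow; exists (x - \sum_(i < n) b i) => //.
by rewrite rmorphB rmorph_sum; congr (_ - _); apply: eq_bigr => i _; case: (hb i).
Qed.

End QuotientTransport.

(** * Quotients by the primes of maximal dimension *)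

Section PrimeQuotient.
Local Open Scope ring_scope.
Local Open Scope classical_set_scope.
Variables (B : comNzRingType) (p : nat) (m : B -> Prop) (d : nat).
Hypotheses (pB : p \in [pchar B]) (noethB : noetherian B) (hL : local_with_max m).
Hypothesis complB : complete_wrt m.
Hypothesis dimB : ~ exists P : nat -> B -> Prop, prime_chain P d.+1.
Implicit Types (I J T : B -> Prop).

Let mI := local_ideal hL.
Let hpow k : is_ideal (mpow m k) := mpow_is_ideal mI k.

Lemma prime_proper_sub T : is_prime T -> T `<=` m.
Proof. by move=> [[hT nT] _]; apply: local_proper. Qed.

Lemma colen_mpow_upper : exists C, forall n, (colen (mpow m n) <= C * n ^ d)%N.
Proof.
have h0 : is_ideal (fun x : B => x = 0) := @ideal_span B [::].
have [|C hC] := colen_upper noethB hL (d := d.+1) h0.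
  by move=> [P [hP _]]; apply: dimB; exists P.
exists C => -[|n]; first by rewrite mpow0T /colen lenxx.
have := hC n.+1; rewrite addm0l expnS mulnCA leq_pmul2l //.
Qed.

Definition top_prime T : Prop := exists P : nat -> B -> Prop, prime_chain P d /\ P 0%N = T.

Lemma top_prime_prime T : top_prime T -> is_prime T.
Proof. by move=> [P [[hP _] <-]]; apply: hP. Qed.

Lemma top_prime_minimal Q T : is_prime Q -> top_prime T -> Q `<=` T -> Q = T.
Proof.
move=> hQ [P [hP eT]] QT; apply/predeqP => x; split; first exact: QT.
move=> Tx; apply: contrapT => nQx; apply: dimB.
have [|P' [hP' _]] := has_chain_cons hQ (fun _ h => h) _ hP; last by exists P'.
by rewrite eT; split=> //; exists x.
Qed.

Lemma top_prime_quotient_bound T b : top_prime T -> ~ T b ->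
  exists C, forall n, (n * colen (addm (addm T (pid b)) (mpow m n)) <= C * n ^ d)%N.
Proof.
move=> hT nTb; have [[hTi _] _] := top_prime_prime hT.
have hTb : is_ideal (addm T (pid b)) by apply: ideal_add => //; apply: ideal_pid.
apply: (colen_upper noethB hL hTb) => -[P [hP hsub]].
have TP : T `<=` P 0%N by move=> x Tx; apply: hsub; apply: idealP1 => //; apply: ideal_pid.
have htop : top_prime (P 0%N) by exists P.
apply: nTb; rewrite (top_prime_minimal (top_prime_prime hT) htop TP).
by apply: hsub; apply: idealP2 => //; apply: pid_mem.
Qed.

(** The Frobenius inequality in the domain [B/T]. The image of [I'] contains the Frobenius power of
    the image of [I], so its colength is no larger. *)
Theorem prime_frobenius_colength T : top_prime T ->
  exists C, forall n I I', is_ideal I -> is_ideal I' -> mpow m n `<=` I -> mpow m n `<=` I' \/ fincol I' ->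
    (forall x, I x -> I' (x ^+ p)) ->
    (n * colen (addm I' T) <= n * (p ^ d * colen (addm I T)) + C * n ^ d)%N.
Proof.
move=> hT; have hTp := top_prime_prime hT; have [[hTi nT1] hTM] := hTp.
have [R [f [fsurj fker]]] := quotient_ring_exists (conj hTi nT1).
have fT x : T x -> f x = 0 by move/fker.
pose mR := image_set f m.
have hLR : local_with_max mR := quotient_local fsurj fker hL (prime_proper_sub hTp).
have noethR : noetherian R := quotient_noetherian fsurj noethB.
have complR : complete_wrt mR := quotient_complete fsurj complB.
have pR : p \in [pchar R] := rmorph_pchar f pB.
have eM n : mpow mR n = image_set f (mpow m n) by apply: image_mpow.
have fM n : fincol (mpow m n) := fincol_mpow noethB hL n.
have cM n : colen (mpow mR n) = colen (addm T (mpow m n)).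
  by rewrite eM (colen_image fsurj fker) // addmC.
have domR (x y : R) : x * y = 0 -> x = 0 \/ y = 0.
  have [a <-] := fsurj x; have [b <-] := fsurj y; rewrite -rmorphM => /fker /hTM[]/fT; by [left|right].
have [C0 hC0] := colen_mpow_upper.
have [K hK] : exists K, forall n, (0 < n)%N -> (n ^ d <= K * colen (addm T (mpow m n)))%N.
  by case: hT => P [hP <-]; apply: colen_lower.
have [|||C hC] := @frobenius_colength R p mR d pR noethR hLR complR domR.
- move=> s s0; have [b eb] := fsurj s.
  have [|C hC] := @top_prime_quotient_bound T b hT; first by move/fT; rewrite eb.
  exists C => n; have hid : is_ideal (addm (pid b) (mpow m n)) by apply: ideal_add => //; apply: ideal_pid.
  have e : addm (pid s) (mpow mR n) = image_set f (addm (pid b) (mpow m n)).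
    rewrite eM; apply/predeqP => r; split.
      move=> [_ [_ [[u _ ->] [v hv <-] ->]]]; have [c ec] := fsurj u.
      exists (c * b + v); first by exists (c * b), v; split=> //; exists c.
      by rewrite rmorphD rmorphM eb ec.
    move=> [_ [_ [v [[c _ ->] hv ->]]] <-]; exists (f c * s), (f v); rewrite rmorphD rmorphM eb.
    by split=> //; [exists (f c) | exists v].
  rewrite e (colen_image fsurj fker) //; last by apply: fincol_le (fM n); apply: idealP2; apply: ideal_pid.
  by rewrite [X in colen X](_ : _ = addm (addm T (pid b)) (mpow m n)) // addmC addmA.
- exists C0 => n; rewrite cM; apply: leq_trans (hC0 n); apply: colen_le => //.
  exact: idealP2.
- by exists K => n hn; rewrite cM; apply: hK.
exists C => n I I' hI hI' hn hn' hp.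
have fI : fincol I by apply: fincol_le hn (fM n).
have fI' : fincol I' by case: hn' => // h; apply: fincol_le h (fM n).
have hImg := image_ideal fsurj hI.
have hnI : mpow mR n `<=` image_set f I by move=> r; rewrite eM => -[b /hn Ib <-]; exists b.
have h := hC n (image_set f I) hImg hnI.
rewrite (colen_image fsurj fker hTi hI fI) in h.
apply: leq_trans h; rewrite leq_mul2l; apply/orP; right.
rewrite -(colen_image fsurj fker hTi hI' fI'); apply: colen_le; last first.
  by apply: (fincol_pspan pR noethR hLR hnI).
apply: (pspan_sub (S := setT)); first by apply/smodT/image_ideal.
move=> _ v [x Ix <-] _; apply: idealMr; first exact: image_ideal.
by exists (x ^+ p); [apply: hp | rewrite rmorphXn].
Qed.

End PrimeQuotient.

(** * Comparison with the product of the domains [B/T] *)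

Section Decomposition.
Local Open Scope ring_scope.
Local Open Scope classical_set_scope.
Variables (B : comNzRingType) (m : B -> Prop) (d : nat).
Hypotheses (noethB : noetherian B) (hL : local_with_max m).
Hypothesis dimB : ~ exists P : nat -> B -> Prop, prime_chain P d.+1.
Implicit Types (I J T Q : B -> Prop).

Let mI := local_ideal hL.
Let hpow k : is_ideal (mpow m k) := mpow_is_ideal mI k.

Definition ann_nil (a : B) : Prop := forall x, (exists e, x ^+ e = 0) -> a * x = 0.

Hypothesis nil_dim : ~ exists P : nat -> B -> Prop, prime_chain P d /\ ann_nil `<=` P 0%N.

Lemma top_prime_factor Qs T : (forall Q, List.In Q Qs -> is_prime Q) ->
  prodin Qs (fun x => x = 0) 1 -> top_prime d T -> List.In T Qs.
Proof.
move=> hQs hprod hT; have hTp := top_prime_prime hT.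
have T0 : (fun x : B => x = 0) `<=` T by move=> x ->; case: hTp => -[h _] _; apply: ideal0.
have [|Q hQ QT] := prime_contains_factor hTp T0 hprod; first by case: hTp => -[].
by rewrite -(top_prime_minimal dimB (hQs Q hQ) hT QT).
Qed.

Lemma top_primes_finite : exists Ts, List.NoDup Ts /\ forall T, List.In T Ts <-> top_prime d T.
Proof.
have [Qs [hQs hprod]] := prime_product noethB (@ideal_span B [::]).
have hQp Q : List.In Q Qs -> is_prime Q by move=> /hQs[].
pose dec (x y : B -> Prop) := pselect (x = y).
exists (List.nodup dec (List.filter (fun T => `[< top_prime d T >]) Qs)).
split=> [|T]; first exact: List.NoDup_nodup.
split.
  by move/(proj1 (List.nodup_In dec _ _))/(proj1 (List.filter_In _ _ _)) => [_ /asboolP].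
move=> hT; apply/(proj2 (List.nodup_In dec _ _))/(proj2 (List.filter_In _ _ _)); split.
  exact: top_prime_factor hQp hprod hT.
exact/asboolP.
Qed.

(** In a vanishing product of primes, each factor other than [T] supplies an element outside [T],
    and each factor [T] supplies one [t]. *)
Lemma prod_power_kills Qs T y t : is_prime T -> T t ->
  (forall Q, List.In Q Qs -> Q = T \/ ~ Q `<=` T) -> prodin Qs (fun x => x = 0) y ->
  exists z r, ~ T z /\ z * y * t ^+ r = 0.
Proof.
move=> hT Tt; elim: Qs y => [|Q Qs IH] y hQs /=.
  by move=> ->; exists 1, 0%N; rewrite mulr0 mul0r; split=> //; case: hT => -[].
have hQs' Q' : List.In Q' Qs -> Q' = T \/ ~ Q' `<=` T by move=> h; apply: hQs; right.
move=> hprod; case: (hQs Q (or_introl erefl)) => [eQ|/not_subP[q [Qq nTq]]].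
  have [z [r [nTz e]]] := IH (t * y) hQs' (hprod t (eq_ind_r (fun Q => Q t) Tt eQ)).
  by exists z, r.+1; split=> //; rewrite exprS -e; ring.
have [z [r [nTz e]]] := IH (q * y) hQs' (hprod q Qq).
exists (z * q), r; split; last by rewrite -e; ring.
by case: hT => _ h /h[].
Qed.

(** The localization of [B] at [T] is a field. As [T] is minimal, every [t] in [T] becomes nilpotent
    there; as the annihilator of the nilradical is not inside [T], nilpotents become zero. Finite
    generation of [T] gives one common [b]. *)
Lemma top_prime_killer T : top_prime d T -> exists b, ~ T b /\ forall t, T t -> b * t = 0.
Proof.
move=> hT; have hTp := top_prime_prime hT; have [[hTi nT1] hTM] := hTp.
have [a [na nTa]] : exists a, ann_nil a /\ ~ T a.
  by apply: not_subP => h; apply: nil_dim; case: hT => P [hP e]; exists P; rewrite e.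
have [Qs [hQs hprod]] := prime_product noethB (@ideal_span B [::]).
have hQs' Q : List.In Q Qs -> Q = T \/ ~ Q `<=` T.
  move=> /hQs[hQ _]; have [QT|] := pselect (Q `<=` T); last by right.
  by left; exact: (top_prime_minimal dimB hQ hT QT).
have one t : T t -> exists b, ~ T b /\ b * t = 0.
  move=> Tt; have [z [r [nTz e]]] := prod_power_kills hTp Tt hQs' hprod.
  exists (a * z); split; first by move=> /hTM[].
  rewrite -mulrA; apply: na; exists r.+1.
  have -> : (z * t) ^+ r.+1 = z ^+ r * t * (z * 1 * t ^+ r).
    by rewrite exprMn !exprS; ring.
  by rewrite e mulr0.
have [gs egs] := noetherian_fg noethB hTi.
suff [b [nTb hb]] : exists b, ~ T b /\ forall g, g \in gs -> b * g = 0.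
  exists b; split=> // t; rewrite egs.
  suff hs : span setT gs `<=` (fun t => b * t = 0) by apply: hs.
  apply: (span_sub (S := setT)) => //; split; first by rewrite mulr0.
  by split=> [x y hx hy|s x _ hx]; [rewrite mulrDr hx hy addr0 | rewrite mulrCA hx mulr0].
have hg g : g \in gs -> T g by move=> h; rewrite egs; apply: span_mem.
elim: gs hg {egs} => [|g gs IH] hg; first by exists 1; split.
have [|b [nTb hb]] := IH; first by move=> g' h; apply: hg; rewrite inE h orbT.
have [b' [nTb' hb']] := one g (hg g (mem_head _ _)).
exists (b * b'); split; first by move=> /hTM[].
by move=> g'; rewrite inE => /orP[/eqP->|/hb e]; [rewrite -mulrA hb' mulr0 | rewrite mulrAC e mul0r].
Qed.

Lemma top_prime_separators Ts : (forall T, List.In T Ts <-> top_prime d T) ->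
  exists beta : (B -> Prop) -> B, forall T, List.In T Ts ->
    [/\ ~ T (beta T), forall t, T t -> beta T * t = 0
      & forall T', List.In T' Ts -> T' <> T -> T' (beta T)].
Proof.
move=> hTs.
apply: (choice_ex (P := fun (T : B -> Prop) b => List.In T Ts ->
    [/\ ~ T b, forall t, T t -> b * t = 0
      & forall T', List.In T' Ts -> T' <> T -> T' b])) => T.
have [hin|hin] := pselect (List.In T Ts); last by exists 0.
have hT := (hTs T).1 hin; have hTp := top_prime_prime hT.
have [b [nTb hb]] := top_prime_killer hT.
have hid Q : List.In Q Ts -> is_ideal Q by move=> /hTs/top_prime_prime[[]].
have [|c [_ nTc hc]] := @prime_separating B T Ts setT hTp _ (@ideal_setT B) hid.
  by move=> h; case: hTp => -[_ n1] _; apply: n1; apply: h.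
exists (b * c) => _; split.
- by case: hTp => _ h /h[].
- by move=> t /hb e; rewrite mulrAC e mul0r.
- move=> T' hT' neq; apply: idealMl; first exact: hid.
  apply: hc => // sub; apply: neq.
  by apply: (top_prime_minimal dimB _ hT sub); apply: top_prime_prime; apply/hTs.
Qed.

(* Up to lower order terms, [B] is the product of the domains [B/T] over the primes [T] of maximal dimension. *)
Lemma colen_decomposition : exists Ts, (forall T, List.In T Ts -> top_prime d T) /\
  exists C, forall n I, is_ideal I -> mpow m n `<=` I ->
    (n * colen I <= n * sumn [seq colen (addm I T) | T <- Ts] + C * n ^ d)%N /\
    (n * sumn [seq colen (addm I T) | T <- Ts] <= n * colen I + C * n ^ d)%N.
Proof.
have [Ts [hnd hTs]] := top_primes_finite; exists Ts; split=> [T /hTs //|].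
have [beta hbeta] := top_prime_separators hTs.
(* The ideal of all [beta T] lies in no prime of dimension [d], since such a prime omits its own
   [beta]; what remains modulo this ideal is of lower order. *)
have [|C1 hC1] := colen_upper noethB hL (d := d) (@ideal_span B [seq beta T | T <- Ts]).
  move=> [P [hP hsub]]; have hin : List.In (P 0%N) Ts by apply/hTs; exists P.
  have [nb _ _] := hbeta _ hin; apply: nb; apply: hsub.
  elim: (Ts) hin => [//|T l IH] /= [->|h].
    by apply: idealP1; [apply: ideal_span | apply: pid_mem].
  by apply: idealP2; [apply: ideal_pid | apply: IH].
have fI n I : mpow m n `<=` I -> fincol I by move=> h; apply: fincol_le h (fincol_mpow noethB hL n).
(* For the induction on the list, [I] stays fixed while the [beta T] are added to [J] one at a time;
   the step for [T] accounts for the summand of [I + T]. *)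
suff [C hC] : exists C, forall n I J, is_ideal I -> is_ideal J -> mpow m n `<=` I -> I `<=` J ->
    (forall T, List.In T Ts -> J `<=` addm I T) ->
    (n * colen J <= n * sumn [seq colen (addm I T) | T <- Ts] +
       n * colen (addm J (span setT [seq beta T | T <- Ts])))%N /\
    (n * sumn [seq colen (addm I T) | T <- Ts] <= n * colen J + C * n ^ d)%N.
  exists (maxn C C1) => n I hI hn.
  have [|h1 h2] := hC n I I hI hI hn (fun _ h => h).
    by move=> T /hTs/top_prime_prime[[hTi _] _]; apply: idealP1.
  split; last by apply: leq_trans h2 _; rewrite leq_add2l leq_mul2r leq_maxl orbT.
  apply: leq_trans h1 _; rewrite leq_add2l.
  apply: leq_trans (_ : C1 * n ^ d <= _)%N; last by rewrite leq_mul2r leq_maxr orbT.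
  apply: leq_trans (hC1 n); rewrite leq_mul2l; apply/orP; right.
  have hs := @ideal_span B [seq beta T | T <- Ts].
  apply: colen_le; last by apply: (fI n); apply: idealP2.
  apply: ideal_add_sub; first exact: ideal_add.
    exact: idealP2.
  by move=> x /hn; apply: idealP1.
have hsubl : forall T, List.In T Ts -> List.In T Ts by [].
move: hnd hsubl; elim: {1 2 4 5 6 7}Ts => [|T l IH] hnd hl.
  exists 0%N => n I J hI hJ hn IJ _; split; last by rewrite /= muln0.
  rewrite muln0 add0n leq_mul2l; apply/orP; right; apply: colen_le.
    by apply: ideal_add_sub => // _ ->; apply: ideal0.
  by apply: fincol_le (fI n I hn); apply: (fun x (h : I x) => idealP1 (@ideal_span B [::]) (IJ x h)).
have [nTl hnd'] : ~ List.In T l /\ List.NoDup l by move: hnd => /List.NoDup_cons_iff.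
have [|C hC] := IH hnd'; first by move=> T' h; apply: hl; right.
have hin : List.In T Ts by apply: hl; left.
have hT := (hTs T).1 hin; have [[hTi _] _] := top_prime_prime hT.
have [nTb hkill hother] := hbeta T hin.
have [C2 hC2] := top_prime_quotient_bound noethB hL dimB hT nTb.
exists (C + C2)%N => n I J hI hJ hn IJ hJT.
have hfI := fI n I hn; have hfJ := fincol_le IJ hfI.
set b := beta T; pose J' := addm J (pid b).
have hJ' : is_ideal J' by apply: ideal_add => //; apply: ideal_pid.
have JJ' : J `<=` J' by apply: idealP1; apply: ideal_pid.
have IJ' : I `<=` J' by move=> x /IJ /JJ'.
have [|h1 h2] := hC n I J' hI hJ' hn IJ'.
  move=> T' hT'; have hT'in : List.In T' Ts by apply: hl; right.
  have [[hT'i _] _] := top_prime_prime ((hTs T').1 hT'in).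
  apply: ideal_add_sub; [exact: ideal_add | by apply: hJT; right |].
  apply: pid_sub; first exact: ideal_add.
  apply: idealP2 => //; apply: hother => // e; apply: nTl; rewrite -e; exact: hT'.
have hIT : is_ideal (addm I T) by apply: ideal_add.
have hfIT : fincol (addm I T) by apply: fincol_le hfI; apply: idealP1.
have e1 := colen_step b hJ hfJ; have e2 := colen_step b hIT hfIT.
have hcJ : is_ideal (colon J b) by apply: ideal_colon.
have fcJ : fincol (colon J b) by apply: fincol_le hfJ => x Jx; split=> //; apply: idealMr.
(* The colon ideal [J : b] lies between [I + T] and [(I + T) : b], whose colengths differ by that of
   [I + T + (b)], a lower order term. *)
have u1 : (colen (colon J b) <= colen (addm I T))%N.
  apply: colen_le => //; apply: ideal_add_sub => // x hx; split=> //.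
    by apply: idealMr => //; apply: IJ.
  by rewrite mulrC hkill //; apply: ideal0.
have u2 : (colen (colon (addm I T) b) <= colen (colon J b))%N.
  by apply: colen_le => // x [_ hx]; split=> //; apply: (hJT T) => //; left.
have u3 : (n * colen (addm (addm I T) (pid b)) <= C2 * n ^ d)%N.
  apply: leq_trans (hC2 n); rewrite leq_mul2l; apply/orP; right.
  have hTb : is_ideal (addm T (pid b)) by apply: ideal_add => //; apply: ideal_pid.
  apply: colen_le; last by apply: (fI n); apply: idealP2.
  apply: ideal_add_sub.
  - by apply: ideal_add => //; apply: ideal_pid.
  - by apply: addmS => //; apply: idealP2.
  - by move=> x /hn Ix; apply: idealP1; [apply: ideal_pid | apply: idealP1].
have eJ : addm J' (span setT [seq beta T0 | T0 <- l]) = addm J (span setT [seq beta T0 | T0 <- T :: l]).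
  by rewrite /J' -addmA.
rewrite -eJ e1 /= -/J'; split.
  by rewrite !mulnDr -addnA; apply: leq_add => //; rewrite leq_mul2l u1 orbT.
rewrite !mulnDr mulnDl e2 mulnDr.
have u4 : (n * colen (colon (addm I T) b) <= n * colen (colon J b))%N by rewrite leq_mul2l u2 orbT.
move: u3 u4 h2; rewrite -/J'.
move: (n * colen _)%N (n * colen (colon (addm I T) b))%N (n * colen (colon J b))%N.
move=> q1 q2 q3; lia.
Qed.

End Decomposition.

(** * p-families and the completion *)

Section CompletionDictionary.
Local Open Scope ring_scope.
Local Open Scope classical_set_scope.
Variables (A : comNzRingType) (m : A -> Prop) (p d : nat).
Hypotheses (pA : p \in [pchar A]) (noethA : noetherian A) (hL : local_with_max m).
Hypothesis dimA : ~ exists P : nat -> A -> Prop, prime_chain P d.+1.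
Variables (B : comNzRingType) (iota : {rmorphism A -> B}) (lim : (nat -> A) -> B).
Hypotheses
  (limD : forall x y, cauchy m x -> cauchy m y -> lim (fun n => x n + y n) = lim x + lim y)
  (limM : forall x y, cauchy m x -> cauchy m y -> lim (fun n => x n * y n) = lim x * lim y)
  (lim_cst : forall a, lim (fun=> a) = iota a)
  (lim_eq0 : forall x, cauchy m x -> (lim x = 0 <-> null_seq m x))
  (lim_surj : forall b, exists2 x, cauchy m x & lim x = b).

Let mI := local_ideal hL.
Let M := closed_pow m lim.
Let mB : B -> Prop := M 1.
Let noethB : noetherian B := completion_noetherian noethA hL limD limM lim_cst lim_eq0 lim_surj.
Let hLB : local_with_max mB := completion_local noethA hL limD limM lim_cst lim_eq0 lim_surj.
Let complB : complete_wrt mB := completion_complete noethA hL limD limM lim_cst lim_eq0 lim_surj.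
Let eM k : M k = mpow mB k := closed_pow_mpow noethA hL limD limM lim_cst lim_eq0 lim_surj k.
Let hM k : is_ideal (M k) := closed_pow_ideal hL limD limM lim_cst lim_surj k.
Let Miota k a : M k (iota a) <-> mpow m k a := closed_pow_iota hL limD lim_cst lim_eq0 k a.
Let Mdense k b : exists a, M k (b - iota a) := closed_pow_dense hL limD lim_cst lim_surj k b.
Let pB : p \in [pchar B] := rmorph_pchar iota pA.
Let pp : prime p := pcharf_prime pA.

Lemma cauchyD x y : cauchy m x -> cauchy m y -> cauchy m (fun n => x n + y n).
Proof.
move=> hx hy; have := cauchyB hL hx (cauchyB hL (cauchy_cst hL 0) hy).
by congr cauchy; apply/funext => n; rewrite sub0r opprK.
Qed.

Lemma cauchyX x e : cauchy m x -> cauchy m (fun n => x n ^+ e).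
Proof.
move=> hx; elim: e => [|e IH]; first exact: cauchy_cst.
have := cauchyM hL hx IH; by congr cauchy; apply/funext => n; rewrite exprS.
Qed.

Lemma limX x e : cauchy m x -> lim (fun n => x n ^+ e) = lim x ^+ e.
Proof.
move=> hx; elim: e => [|e IH]; first by rewrite lim_cst rmorph1.
rewrite exprS -IH -limM //; last exact: cauchyX.
by congr lim; apply/funext => n; rewrite exprS.
Qed.

Lemma compl_nilpotentE x : compl_nilpotent m x <-> cauchy m x /\ exists e, lim x ^+ e = 0.
Proof.
split=> -[hx [e he]]; split=> //; exists e.
  by rewrite -limX //; apply/lim_eq0 => //; apply: cauchyX.
by apply/lim_eq0; [apply: cauchyX | rewrite limX].
Qed.

Lemma compl_ann_nilE a : compl_ann_nil m a <-> cauchy m a /\ ann_nil (lim a).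
Proof.
split=> -[ha h]; split=> //.
  move=> b [e hb]; have [x hx ex] := lim_surj b; rewrite -ex -limM //.
  by apply/lim_eq0; [apply: cauchyM | apply: h; apply/compl_nilpotentE; split=> //; exists e; rewrite ex].
move=> x /compl_nilpotentE[hx [e he]]; apply/lim_eq0; first exact: cauchyM.
by rewrite limM //; apply: h; exists e.
Qed.

Lemma lim_seq_eqv x y : cauchy m x -> cauchy m y -> seq_eqv m x y <-> lim x = lim y.
Proof. by move=> hx hy; rewrite (lim_eq hL limD lim_eq0). Qed.

Lemma compl_nil_dim_ltE : compl_nil_dim_lt m d <->
  ~ exists P : nat -> B -> Prop, prime_chain P d /\ @ann_nil B `<=` P 0%N.
Proof.
split=> h [P hP]; apply: h.
  case: hP => -[hP hs] hann.
  have Pmono i : (i <= d)%N -> P 0%N `<=` P i.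
    elim: i => [|i IH] hi x; first by [].
    by move=> Px0; have Px := IH (ltnW hi) x Px0; case: (hs i hi) => h1 _; apply: h1.
  exists (fun i x => cauchy m x /\ P i (lim x)); split=> i hi; last first.
    have [h1 [b [Pb nPb]]] := hs i hi; split; first by move=> x [hx /h1].
    by have [x hx ex] := lim_surj b; exists x; rewrite ex; split=> // -[].
  have [[hPi nP1] hPM] := hP i hi.
  split; last by move=> a /compl_ann_nilE[ha /hann/(Pmono i hi)].
  split; first by move=> x [].
  split.
    by move=> x y hy [hx Px] /(proj1 (lim_seq_eqv hx hy)) e; split=> //; rewrite -e.
  split; first by move=> x hx /lim_eq0 e; split=> //; rewrite e //; apply: ideal0.
  split; first by move=> x y [hx Px] [hy Py]; split; [apply: cauchyD | rewrite limD //; apply: idealD].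
  split; first by move=> r x hr [hx Px]; split; [apply: cauchyM | rewrite limM //; apply: idealMl].
  split; first by move=> [_]; rewrite lim_cst rmorph1.
  by move=> x y hx hy [_]; rewrite limM // => /hPM[]; [left|right].
case: hP => hP hs.
exists (fun i b => exists x, [/\ cauchy m x, P i x & lim x = b]).
have back i x : (i <= d)%N -> cauchy m x -> (exists y, [/\ cauchy m y, P i y & lim y = lim x]) -> P i x.
  move=> hi hx [y [hy Py e]]; have [[_ [hEq _]] _] := hP i hi.
  by apply: hEq Py _ => //; apply/lim_seq_eqv.
split; last first.
  move=> b; have [x hx <-] := lim_surj b => hb; exists x; split=> //.
  by case: (hP 0%N isT) => _; apply; apply/compl_ann_nilE.
split=> i hi; last first.
  have [h1 [x [Px nPx]]] := hs i hi; split; first by move=> b [y [hy Py ey]]; exists y; split=> //; apply: h1.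
  have hx : cauchy m x by case: (hP i.+1 hi) => -[hc _] _; apply: hc.
  by exists (lim x); split; [exists x | move=> h; apply: nPx; apply: back h => //; apply: ltnW].
have [[hc [hEq [h0 [hD [hMu [n1 hpr]]]]]] _] := hP i hi.
split; last first.
  move=> b b'; have [x hx <-] := lim_surj b; have [y hy <-] := lim_surj b'.
  rewrite -limM // => /(back i _ hi (cauchyM hL hx hy)) /(hpr _ _ hx hy)[h|h]; [left; exists x | right; exists y]; by split.
split; last first.
  by rewrite -(rmorph1 iota) -lim_cst => /(back i _ hi (cauchy_cst hL 1)).
split.
  exists (fun=> 0); split; [exact: cauchy_cst | apply: h0; first exact: cauchy_cst | by rewrite lim_cst rmorph0].
  by move=> k; exists 0%N => n _; apply: ideal0; apply: mpow_is_ideal.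
split=> [_ _ [x [hx Px <-]] [y [hy Py <-]]|r _ [x [hx Px <-]]].
  by exists (fun n => x n + y n); split; [apply: cauchyD | apply: hD | apply: limD].
have [z hz <-] := lim_surj r; exists (fun n => z n * x n); split; [exact: cauchyM | exact: hMu | exact: limM].
Qed.

Let fM n : fincol (mpow mB n) := fincol_mpow noethB hLB n.

(** A longer chain would force growth of order [n^(d+1)] for the colengths of powers of the maximal
    ideal, but these agree with those in [A], which are [O(n^d)]. *)
Lemma completion_dim : ~ exists P : nat -> B -> Prop, prime_chain P d.+1.
Proof.
move=> [P hP]; have [K hK] := colen_lower noethB hLB hP.
have [C hC] := colen_mpow_upper noethA hL dimA.
pose n := (K * C).+1; have hn : (0 < n)%N by [].
have [[hPi _] _] : is_prime (P 0%N) by case: hP => h _; apply: h.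
have h1 := hK n hn; have h2 : (colen (addm (P 0%N) (mpow mB n)) <= colen (mpow mB n))%N.
  by apply: colen_le => //; apply: idealP2.
have [_ [_ [_ e]]] := colen_contraction noethA hL limD limM lim_cst lim_eq0 lim_surj (hM n) (fun _ h => h).
have em : (fun a => M n (iota a)) = mpow m n by apply/predeqP => a; apply: Miota.
move: e; rewrite -/M em eM => e; rewrite -e in h2.
have h3 := leq_trans h1 (leq_mul (leqnn K) (leq_trans h2 (hC n))).
move: h3; rewrite expnS mulnA leq_pmul2r ?expn_gt0 //.
by rewrite /n ltnn.
Qed.
Let dimB := completion_dim.

(** The closure of [I] in [B] stands in for the extended ideal: p-th powers pass to it termwise, so
    a p-family stays a p-family. *)
Definition closure_ideal (I : A -> Prop) (b : B) : Prop :=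
  forall k, exists2 a, I a & M k (b - iota a).

Lemma closure_idealP I : is_ideal I -> is_ideal (closure_ideal I).
Proof.
move=> hI; split=> [k|]; first by exists 0; [apply: ideal0 | rewrite rmorph0 subr0; apply: ideal0].
split=> [x y hx hy k|r x hx k].
  have [a Ia ha] := hx k; have [b Ib hb] := hy k; exists (a + b); first exact: idealD.
  rewrite rmorphD (_ : _ - _ = (x - iota a) + (y - iota b)); last by ring.
  exact: idealD.
have [a Ia ha] := hx k; have [c hc] := Mdense k r; exists (c * a); first exact: idealMl.
rewrite rmorphM (_ : _ - _ = r * (x - iota a) + (r - iota c) * iota a); last by ring.
by apply: idealD => //; [apply: idealMl | apply: idealMr].
Qed.

Lemma closure_ideal_colen I n : is_ideal I -> mpow m n `<=` I ->
  M n `<=` closure_ideal I /\ (fincol (closure_ideal I) /\ colen (closure_ideal I) = colen I).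
Proof.
move=> hI hn; have hcI := closure_idealP hI.
have Mc : M n `<=` closure_ideal I.
  move=> b hb k; have [a ha] := Mdense (maxn k n) b; exists a.
    apply: hn; apply/Miota; rewrite -(subKr b (iota a)); apply: idealB => //.
    by apply: (closed_pow_anti hL _ ha); apply: leq_maxr.
  by apply: (closed_pow_anti hL _ ha); apply: leq_maxl.
split=> //.
have [_ [_ [h1 h2]]] := colen_contraction noethA hL limD limM lim_cst lim_eq0 lim_surj hcI Mc.
split=> //; rewrite -h2; congr colen; apply/predeqP => a; split=> [h|Ia k]; last by exists a => //; rewrite subrr; apply: ideal0.
have [a' Ia' ha'] := h n; rewrite -(subrK a' a); apply: idealD => //; apply: hn.
by apply/Miota; rewrite rmorphB.
Qed.

(** If [t^k] lies in the first ideal for all generators [t] of [m], then [t^(kq)] lies in [I_q], and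
    the pigeonhole principle bounds the needed power of [m] linearly in [q]. *)
Lemma m_primary_frob (I : nat -> A -> Prop) : p_family p I -> (forall e, m_primary m (I e)) ->
  exists N0, (0 < N0)%N /\ forall e, mpow m (N0 * p ^ e) `<=` I e.
Proof.
move=> [hI hp] hprim; have [ts ets] := noetherian_fg noethA mI.
have [k hk] : exists k, forall t, t \in ts -> I 0%N (t ^+ k).
  have hts t : t \in ts -> exists k, I 0%N (t ^+ k).
    by move=> ht; case: (hprim 0%N) => _ h; apply/h; rewrite ets; apply: span_mem.
  elim: ts hts {ets} => [|t ts IH] hts; first by exists 0%N.
  have [|k hk] := IH; first by move=> t' h; apply: hts; rewrite inE h orbT.
  have [k' hk'] := hts t (mem_head _ _); exists (k' + k)%N => t'; rewrite inE => /orP[/eqP->|/hk h].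
    by rewrite exprD; apply: idealMr.
  by rewrite exprD; apply: idealMl.
have hke e t : t \in ts -> I e (t ^+ (k * p ^ e)).
  move=> ht; elim: e => [|e IH]; first by rewrite muln1; apply: hk.
  by rewrite expnSr mulnA exprM; apply: hp.
exists (size ts * k).+1; split=> // e x hx.
apply: (mpow_pigeonhole (hI e) (hke e)); rewrite -ets; apply: mpow_anti hx => //.
by rewrite mulnA mulSn addnC -addn1 leq_add2l expn_gt0 prime_gt0.
Qed.

(** The sequences [xs] are the colengths of the completed family in the domains [B/T]; from here on
    only natural numbers remain. *)
Theorem p_family_recurrence (I : nat -> A -> Prop) :
  compl_nil_dim_lt m d -> p_family p I -> (forall e, m_primary m (I e)) ->
  exists (xs : seq (nat -> nat)) (C N0 : nat), [/\ (0 < N0)%N,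
    forall x, List.In x xs -> forall e,
      (N0 * p ^ e * x e.+1 <= N0 * p ^ e * (p ^ d * x e) + C * (N0 * p ^ e) ^ d)%N,
    forall e, (N0 * p ^ e * colen (I e) <=
      N0 * p ^ e * sumn [seq x e | x <- xs] + C * (N0 * p ^ e) ^ d)%N
  & forall e, (N0 * p ^ e * sumn [seq x e | x <- xs] <=
      N0 * p ^ e * colen (I e) + C * (N0 * p ^ e) ^ d)%N].
Proof.
move=> /compl_nil_dim_ltE hnil hfam hprim.
have [hI hp] := hfam.
have [N0 [N0pos hN0]] := m_primary_frob hfam hprim.
have [Ts [hTs [C1 hC1]]] := colen_decomposition noethB hLB dimB hnil.
pose J e := closure_ideal (I e).
have hJ e : is_ideal (J e) by apply: closure_idealP.
have hMJ e := (closure_ideal_colen (hI e) (hN0 e)).1.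
have fJ e : fincol (J e) := (closure_ideal_colen (hI e) (hN0 e)).2.1.
have cJ e : colen (J e) = colen (I e) := (closure_ideal_colen (hI e) (hN0 e)).2.2.
have mJ e : mpow mB (N0 * p ^ e) `<=` J e by move=> x; rewrite -eM; apply: hMJ.
have frobJ e x : J e x -> J e.+1 (x ^+ p).
  move=> hx k; have [a Ia ha] := hx k; exists (a ^+ p); first exact: hp.
  rewrite rmorphXn -(frobB pB); apply: ideal_frob => //.
have [C2 hC2] : exists C, forall T, List.In T Ts -> forall e,
    (N0 * p ^ e * colen (addm (J e.+1) T) <=
     N0 * p ^ e * (p ^ d * colen (addm (J e) T)) + C * (N0 * p ^ e) ^ d)%N.
  elim: (Ts) hTs => [|T l IH] hl; first by exists 0%N.
  have [|C hC] := IH; first by move=> T' h; apply: hl; right.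
  have [C' hC'] := prime_frobenius_colength pB noethB hLB complB dimB (hl T (or_introl erefl)).
  exists (C + C')%N => T' [<-|hin] e.
    apply: leq_trans (hC' _ _ _ (hJ e) (hJ e.+1) (mJ e) (or_intror (fJ e.+1)) (frobJ e)) _.
    by rewrite leq_add2l leq_mul2r leq_addl orbT.
  by apply: leq_trans (hC T' hin e) _; rewrite leq_add2l leq_mul2r leq_addr orbT.
exists [seq (fun e => colen (addm (J e) T)) | T <- Ts], (C1 + C2)%N, N0; split=> //.
- move=> x /List.in_map_iff[T [<- hT]] e; apply: leq_trans (hC2 T hT e) _.
  by rewrite leq_add2l leq_mul2r leq_addl orbT.
- move=> e; have [h _] := hC1 _ _ (hJ e) (mJ e); rewrite -cJ -map_comp.
  by apply: leq_trans h _; rewrite leq_add2l leq_mul2r leq_addr orbT.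
- move=> e; have [_ h] := hC1 _ _ (hJ e) (mJ e); rewrite -cJ -map_comp.
  by apply: leq_trans h _; rewrite leq_add2l leq_mul2r leq_addr orbT.
Qed.

Lemma nilpotent_witness P : is_prime P -> @ann_nil B `<=` P ->
  exists w : B, w * w = 0 /\ forall x, x * w = 0 -> P x.
Proof.
move=> hP hann; have [[hPi nP1] hPM] := hP.
have hN : is_ideal (fun x : B => exists e, x ^+ e = 0).
  (* Passing to p-power exponents lets additivity of Frobenius replace the binomial theorem. *)
  have frobn (x : B) e : x ^+ e = 0 -> x ^+ (p ^ e) = 0.
    by move=> h; rewrite -(subnK (ltnW (ltn_expl e (prime_gt1 pp)))) exprD h mulr0.
  split; first by exists 1%N.
  split=> [x y [a ha] [b hb]|r x [e he]]; last by exists e; rewrite exprMn he mulr0.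
  exists (p ^ (a + b))%N; rewrite exprDn_pchar; last first.
    by rewrite pnatX; apply/orP; left; rewrite pnatE.
  rewrite (expnD p a b) exprM (frobn _ _ ha) expr0n expn_eq0 -leqn0 leqNgt prime_gt0 //= add0r.
  by rewrite mulnC exprM (frobn _ _ hb) expr0n expn_eq0 -leqn0 leqNgt prime_gt0.
have [gs egs] := noetherian_fg noethB hN.
have [z hz annz] : exists2 z, (exists e, z ^+ e = 0) & forall x, x * z = 0 -> P x.
  apply: contrapT => hno.
  suff [r [nPr hr]] : exists r, ~ P r /\ forall g, g \in gs -> r * g = 0.
    apply: nPr; apply: hann => x hx.
    have : span setT gs x by rewrite -egs.
    suff hs : span setT gs `<=` (fun t => r * t = 0) by apply: hs.
    apply: (span_sub (S := setT)) => //; split; first by rewrite mulr0.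
    by split=> [u v hu hv|s u _ hu]; [rewrite mulrDr hu hv addr0 | rewrite mulrCA hu mulr0].
  have hg g : g \in gs -> exists r, ~ P r /\ r * g = 0.
    move=> hg; apply: contrapT => h; apply: hno; exists g.
      have : span setT gs g by apply: span_mem.
      by rewrite -egs.
    by move=> x hx; apply: contrapT => nPx; apply: h; exists x.
  elim: gs hg {egs} => [|g gs IH] hg; first by exists 1; split.
  have [|b [nb hb]] := IH; first by move=> g' h; apply: hg; rewrite inE h orbT.
  have [b' [nb' hb']] := hg g (mem_head _ _).
  exists (b * b'); split; first by move=> /hPM[].
  by move=> g'; rewrite inE => /orP[/eqP->|/hb e]; [rewrite -mulrA hb' mulr0 | rewrite mulrAC e mul0r].
(* [Q k] says that [z^k] vanishes in the localization at [P]. The least such [k] is at least 2, and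
   [w = u z^(k-1)] has square zero since [2(k-1) >= k], while minimality keeps its annihilator
   inside [P]. *)
pose Q k := `[< exists u, ~ P u /\ u * z ^+ k = 0 >].
have exQ : exists k, Q k by case: hz => e he; exists e; apply/asboolP; exists 1; rewrite he mulr0.
case: (ex_minnP exQ) => k /asboolP[u [nPu hu]] hmin.
case: k hu hmin => [|[|k]] hu hmin.
- by exfalso; apply: nPu; move: hu; rewrite expr0 mulr1 => ->; apply: ideal0.
- by exfalso; apply: nPu; apply: annz; rewrite -hu expr1.
exists (u * z ^+ k.+1); split.
  rewrite (_ : _ * _ = u * z ^+ k * (u * z ^+ k.+2)); last by rewrite !exprS; ring.
  by rewrite hu mulr0.
move=> x hx; apply: contrapT => nPx.
have /hmin : Q k.+1.
  by apply/asboolP; exists (x * u); rewrite -mulrA; split=> // /hPM[].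
by rewrite ltnn.
Qed.

(* For [w^2 = 0], any choice of adding [w] or not to the terms of [m^q] is again a p-family. *)
Definition twisted_family (w : B) (b : nat -> bool) (e : nat) : A -> Prop :=
  fun a => (if b e then addm (pid w) (M (p ^ e)) else M (p ^ e)) (iota a).

Lemma mpow_pow (R : comNzRingType) (mm : R -> Prop) k n x : is_ideal mm ->
  mpow mm k x -> mpow mm (k * n) (x ^+ n).
Proof.
move=> hm hx; elim: n => [|n IH]; first by rewrite muln0 mpow0T.
by rewrite exprS mulnS; apply: mpowD_mul.
Qed.

Section Twist.
Variable w : B.
Hypothesis w2 : w * w = 0.

Let hJ b e : is_ideal (if b : bool then addm (pid w) (M (p ^ e)) else M (p ^ e)).
Proof. by case: b => //; apply: ideal_add => //; apply: ideal_pid. Qed.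

Let MJ b e : M (p ^ e) `<=` (if b : bool then addm (pid w) (M (p ^ e)) else M (p ^ e)).
Proof. by case: b => //; apply: idealP2; apply: ideal_pid. Qed.

Let wp : w ^+ p = 0.
Proof. by rewrite -(subnK (prime_gt1 pp)) exprD expr2 w2 mulr0. Qed.

Lemma twisted_colen b e : is_ideal (twisted_family w b e) /\ (fincol (twisted_family w b e) /\
  colen (twisted_family w b e) = colen (if b e then addm (pid w) (M (p ^ e)) else M (p ^ e))).
Proof.
have [h1 [h2 [h3 h4]]] := colen_contraction noethA hL limD limM lim_cst lim_eq0 lim_surj (hJ (b e) e) (MJ (b e) (e := e)).
by split.
Qed.

(** The multiple of [w] dies under p-th powers, so these land in the power [m^(pq)], which lies in
    the next term whichever choice is made there. *)
Lemma twisted_p_family b : p_family p (twisted_family w b).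
Proof.
split=> [e|e x hx]; first by case: (twisted_colen b e).
rewrite /twisted_family rmorphXn; apply: MJ.
have frobM y : M (p ^ e) y -> M (p ^ e.+1) (y ^+ p).
  by rewrite !eM expnSr; apply: mpow_pow; apply: local_ideal.
move: hx; rewrite /twisted_family; case: (b e); last exact: frobM.
move=> [_ [y [[r _ ->] hy ->]]].
by rewrite (frobD pB) exprMn wp mulr0 add0r; apply: frobM.
Qed.

Lemma twisted_m_primary b e : m_primary m (twisted_family w b e).
Proof.
have hm x : twisted_family w b e x -> m x.
  move=> hx; rewrite -(mpow1E mI); apply/Miota.
  have pe : (0 < p ^ e)%N by rewrite expn_gt0 prime_gt0.
  have MM : M (p ^ e) `<=` mB by apply: (closed_pow_anti hL).
  move: hx; rewrite /twisted_family; case: (b e); last exact: MM.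
  apply: ideal_add_sub => //; apply: pid_sub => //.
  have [_ hpr] := local_prime hLB.
  by case: (hpr w w) => //; rewrite w2; apply: ideal0; apply: local_ideal.
have [hId _] := twisted_colen b e.
split; first by split=> // /hm; apply: local_not1.
move=> x; split=> [mx|[n /hm]].
  exists (p ^ e)%N; apply: MJ; apply/Miota; exact: mpow_exp.
elim: n => [|n IH]; first by rewrite expr0 => /(local_not1 hL).
by rewrite exprS; case: (local_prime hL) => _ h /h[//|/IH].
Qed.

(** The difference is the colength of [m^q : w]. Artin-Rees for [(w)] puts this colon ideal inside
    [P_0 + m^(q-c)], whose colength is at least of order [(q-c)^d]. *)
Lemma twisted_colen_gap P : prime_chain P d -> (forall x, x * w = 0 -> P 0%N x) ->
  exists K c, forall e, (c < p ^ e)%N ->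
    ((p ^ e - c) ^ d <= K * (colen (M (p ^ e)) - colen (addm (pid w) (M (p ^ e)))))%N.
Proof.
move=> hP hann; have [K hK] := colen_lower noethB hLB hP.
have [c hc] := artin_rees noethB (local_ideal hLB) (ideal_pid w).
exists K, c => e hlt; set q := (p ^ e)%N.
have fq : fincol (M q) by rewrite eM.
have e1 := colen_step w (hM q) fq.
have hPi : is_ideal (P 0%N) by case: hP => h _; case: (h 0%N isT) => -[].
have hsub : colon (M q) w `<=` addm (P 0%N) (mpow mB (q - c)).
  move=> x [_ hx].
  have hx' : mpow mB (c + (q - c)) (x * w) by rewrite subnKC ?(ltnW hlt) // -eM.
  have : cyc (mpow mB (q - c)) w (x * w).
    move: (hc _ _ hx' (ex_intro2 _ _ x Logic.I erefl)); apply: idmul_sub.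
      by apply/smodT/smod_cyc/smodT/mpow_is_ideal/local_ideal.
    move=> u _ hu [r _ ->]; exists (u * r); last by ring.
    by apply: idealMr => //; apply: mpow_is_ideal; apply: local_ideal.
  move=> [u hu exu]; exists (x - u), u; split=> //; last by ring.
  by apply: hann; rewrite mulrBl exu subrr.
have hcol : fincol (colon (M q) w).
  by apply: fincol_le fq => x hx; split=> //; apply: idealMr.
have h2 := colen_le hsub hcol.
rewrite e1 (addmC (pid w)) addnK; apply: leq_trans (leq_mul (leqnn K) h2).
by apply: hK; rewrite subn_gt0.
Qed.

End Twist.

End CompletionDictionary.

From Stdlib Require Import Reals Lra.

(** * Limits *)

Section RealLimits.
Local Open Scope R_scope.

Lemma natpow_expn m n : Nat.pow m n = expn m n.
Proof. by elim: n => [|n IH] //=; rewrite IH expnS. Qed.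

Lemma INR_expn m n : INR (expn m n) = INR m ^ n.
Proof. by rewrite -pow_INR natpow_expn. Qed.

Lemma INR_addn m n : INR (addn m n) = INR m + INR n.
Proof. exact: plus_INR. Qed.

Lemma INR_muln m n : INR (muln m n) = INR m * INR n.
Proof. exact: mult_INR. Qed.

Lemma INR_leq m n : leq m n -> INR m <= INR n.
Proof. by move/leP; apply: le_INR. Qed.

(** Adding the tail [2D/2^e] of the geometric error makes the sequence decreasing. *)
Lemma almost_decreasing_cv (u : nat -> R) (D : R) : (forall e, 0 <= u e) ->
  (forall e, u e.+1 <= u e + D / 2 ^ e) -> exists L, Un_cv u L.
Proof.
move=> u0 hu; pose v e := u e + (2 * D) / 2 ^ e.
have p2 e : 0 < 2 ^ e by apply: pow_lt; lra.
have step e : (2 * D) / 2 ^ e.+1 = D / 2 ^ e.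
  by rewrite /= /Rdiv Rinv_mult; lra.
have half e : (2 * D) / 2 ^ e = D / 2 ^ e + D / 2 ^ e by rewrite /Rdiv; lra.
have [||L hL] := decreasing_cv v _ _.
- by move=> e; rewrite /v step half; have := hu e; lra.
- exists (2 * Rabs D) => _ [e ->]; rewrite /opp_seq /v.
  have h1 : - (2 * D / 2 ^ e) <= 2 * Rabs D * / 2 ^ e.
    have i0 : 0 < / 2 ^ e by apply: Rinv_0_lt_compat.
    have := Rle_abs (- D); rewrite Rabs_Ropp /Rdiv => hD.
    have := Rmult_le_compat_r (/ 2 ^ e) (- D) (Rabs D) (Rlt_le _ _ i0) hD; lra.
  have h2 : / 2 ^ e <= 1.
    rewrite -Rinv_1; apply: Rinv_le_contravar; first lra.
    by apply: pow_R1_Rle; lra.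
  have h3 := Rmult_le_compat_l (2 * Rabs D) _ _ _ h2.
  have := Rabs_pos D; have := u0 e; move=> ? ?; have := h3 ltac:(lra); lra.
exists (L - 0); have := CV_minus _ _ _ _ hL (cv_pow_half (2 * D)).
by apply: Un_cv_ext => e; rewrite /v; lra.
Qed.

Section Normalization.
Variables (p d N0 : nat).
Hypotheses (pgt1 : leq 2 p) (N0pos : leq 1 N0).
Let Q e := INR (Nat.pow (Nat.pow p e) d).

Lemma normalizer_gt0 e : 0 < Q e.
Proof.
rewrite /Q !natpow_expn; apply: lt_0_INR; apply/ltP.
by rewrite !expn_gt0 (ltnW pgt1).
Qed.

(** With [q = p^e] and [n = N0 q], the error is [C n^d/(n q^d) = C N0^d/n], and [n >= q >= 2^e]. *)
Lemma normalized_le a b C e :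
  leq (N0 * expn p e * a) (N0 * expn p e * b + C * expn (N0 * expn p e) d) ->
  INR a / Q e <= INR b / Q e + (INR C * INR N0 ^ d) / 2 ^ e.
Proof.
move/INR_leq; rewrite INR_addn !INR_muln !INR_expn INR_muln INR_expn Rpow_mult_distr.
have := normalizer_gt0 e; rewrite /Q !natpow_expn !INR_expn.
set q := INR p ^ e => Qpos; have n1 : 1 <= INR N0 by have := INR_leq N0pos; rewrite /=.
have p2 : 0 < 2 ^ e by apply: pow_lt; lra.
have q2 : 2 ^ e <= q.
  apply: pow_incr; split; first lra.
  by have := INR_leq pgt1; rewrite /=; lra.
set D := INR C * INR N0 ^ d.
have D0 : 0 <= D by apply: Rmult_le_pos; [apply: pos_INR | apply: pow_le; lra].
set Qd := q ^ d in Qpos *; move=> h.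
have nq : 0 < INR N0 * q by apply: Rmult_lt_0_compat; lra.
have nq2 : 2 ^ e <= INR N0 * q.
  by have := Rmult_le_compat_r q 1 (INR N0) ltac:(lra) n1; lra.
have h' : INR N0 * q * INR a <= INR N0 * q * (INR b + D * Qd / 2 ^ e).
  apply: Rle_trans h _; rewrite Rmult_plus_distr_l; apply: Rplus_le_compat_l.
  have -> : INR C * (INR N0 ^ d * Qd) = 2 ^ e * (D * Qd / 2 ^ e).
    by rewrite /D; field; lra.
  apply: Rmult_le_compat_r => //; apply: Rmult_le_pos; last by apply/Rlt_le/Rinv_0_lt_compat.
  by apply: Rmult_le_pos => //; lra.
have h2 := Rmult_le_reg_l _ _ _ nq h'.
have -> : INR b / Qd + D / 2 ^ e = (INR b + D * Qd / 2 ^ e) / Qd by field; lra.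
by apply: Rmult_le_compat_r h2; apply/Rlt_le/Rinv_0_lt_compat.
Qed.

Lemma recurrence_cv (x : nat -> nat) C :
  (forall e, leq (N0 * expn p e * x e.+1)
     (N0 * expn p e * (expn p d * x e) + C * expn (N0 * expn p e) d)) ->
  exists L, Un_cv (fun e => INR (x e) / Q e) L.
Proof.
move=> hx; apply: (almost_decreasing_cv (D := INR C * INR N0 ^ d)) => e.
  by apply: Rmult_le_pos; [apply: pos_INR | apply/Rlt_le/Rinv_0_lt_compat/normalizer_gt0].
have := normalized_le (hx e); rewrite INR_muln INR_expn.
have Qpos := normalizer_gt0 e.
have QS : Q e.+1 = INR p ^ d * Q e.
  by rewrite /Q !natpow_expn !INR_expn -Rpow_mult_distr.
have p1 : 1 <= INR p ^ d.
  by apply: pow_R1_Rle; have := INR_leq pgt1; rewrite /=; lra.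
rewrite QS => h.
set t := INR C * INR N0 ^ d / 2 ^ e in h *.
have t0 : 0 <= t.
  apply: Rmult_le_pos; last by apply/Rlt_le/Rinv_0_lt_compat/pow_lt; lra.
  by apply: Rmult_le_pos; [apply: pos_INR | apply/pow_le/pos_INR].
have -> : INR (x e.+1) / (INR p ^ d * Q e) = (INR (x e.+1) / Q e) / INR p ^ d by field; lra.
apply: (Rmult_le_reg_l (INR p ^ d)); first lra.
have -> : INR p ^ d * (INR (x e.+1) / Q e / INR p ^ d) = INR (x e.+1) / Q e by field; lra.
have := Rmult_le_compat_r t _ _ t0 p1.
have -> : INR p ^ d * (INR (x e) / Q e + t) = INR p ^ d * INR (x e) / Q e + INR p ^ d * t.
  by field; lra.
lra.
Qed.

Lemma sumn_cv (xs : list (nat -> nat)) :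
  (forall x, List.In x xs -> exists L, Un_cv (fun e => INR (x e) / Q e) L) ->
  exists L, Un_cv (fun e => INR (sumn [seq x e | x <- xs]) / Q e) L.
Proof.
elim: xs => [|x xs IH] hxs.
  exists 0 => eps heps; exists 0%nat => n _ /=.
  by rewrite /Rdist /Rdiv Rmult_0_l Rminus_0_r Rabs_R0.
have [|L hL] := IH; first by move=> y hy; apply: hxs; right.
have [L' hL'] := hxs x (or_introl erefl); exists (L' + L).
have := CV_plus _ _ _ _ hL' hL; apply: Un_cv_ext => e /=.
by rewrite INR_addn /Rdiv Rmult_plus_distr_r.
Qed.

Lemma perturbed_cv (x y : nat -> nat) C : (exists L, Un_cv (fun e => INR (y e) / Q e) L) ->
  (forall e, leq (N0 * expn p e * x e) (N0 * expn p e * y e + C * expn (N0 * expn p e) d)) ->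
  (forall e, leq (N0 * expn p e * y e) (N0 * expn p e * x e + C * expn (N0 * expn p e) d)) ->
  exists L, Un_cv (fun e => INR (x e) / Q e) L.
Proof.
move=> [L hL] h1 h2; exists L => eps heps.
have [n1 hn1] := hL (eps / 2) ltac:(lra).
have [n2 hn2] := cv_pow_half (INR C * INR N0 ^ d) (eps / 2) ltac:(lra).
exists (Nat.max n1 n2) => n hn.
have := hn1 n ltac:(lia); have := hn2 n ltac:(lia).
have := normalized_le (h1 n); have := normalized_le (h2 n).
rewrite /Rdist Rminus_0_r => b1 b2 /Rabs_def2[b3 b4] /Rabs_def2[b5 b6].
by apply: Rabs_def1; lra.
Qed.

End Normalization.

Lemma alternating_gap_cv (f g : nat -> R) (L L' eps : R) (e0 : nat) : 0 < eps ->
  Un_cv f L -> Un_cv g L' -> (forall e, ~~ odd e -> f e = g e) ->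
  (forall e, leq e0 e -> odd e -> eps <= f e - g e) -> False.
Proof.
move=> heps hf hg hev hodd; have h := CV_minus _ _ _ _ hf hg.
have [N hN] := h (eps / 2) ltac:(lra).
have h1 := hN (2 * (N + e0))%coq_nat ltac:(lia).
have h2 := hN (2 * (N + e0) + 1)%coq_nat ltac:(lia).
move: h1 h2; rewrite /Rdist hev; last by lia.
have := hodd (2 * (N + e0) + 1)%coq_nat ltac:(lia) ltac:(lia).
by move=> b /Rabs_def2[b1 b2] /Rabs_def2[b3 b4]; lra.
Qed.

(** For [q > 2c] one has [q - c >= q/2]; this is the source of the factor [2^d]. *)
Lemma normalized_gap (p d K c S T e : nat) : leq 2 p -> leq (2 * c).+1 (expn p e) ->
  leq (expn (expn p e - c) d) (K * (S - T)) ->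
  / (2 ^ d * INR K) <= INR S / INR (Nat.pow (Nat.pow p e) d) - INR T / INR (Nat.pow (Nat.pow p e) d).
Proof.
move=> pgt1 hc h; have Qpos := normalizer_gt0 d pgt1 e.
have hpos : leq 1 (expn (expn p e - c) d) by rewrite expn_gt0; apply/orP; left; lia.
have hKS : leq 1 (K * (S - T)) by apply: leq_trans h.
have [hK hST] : (leq 1 K) /\ leq 1 (S - T) by move: hKS; rewrite muln_gt0 => /andP[].
have hle : leq (expn (expn p e) d) (expn 2 d * (K * (S - T))).
  apply: leq_trans (leq_mul (leqnn _) h); rewrite -expnMn; apply: leq_exp2r_weak; lia.
move/INR_leq: hle; rewrite !INR_muln (INR_expn 2) -!natpow_expn minus_INR; last by lia.
set Q := INR (Nat.pow _ _) in Qpos *; move=> hle.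
have K1 : 1 <= INR K by have := INR_leq hK.
have p2 : 0 < 2 ^ d by apply: pow_lt; lra.
have K2 : 0 < 2 ^ d * INR K by apply: Rmult_lt_0_compat; lra.
apply: (Rmult_le_reg_l (2 ^ d * INR K * Q)); first exact: Rmult_lt_0_compat.
have -> : 2 ^ d * INR K * Q * / (2 ^ d * INR K) = Q by field; lra.
have -> : 2 ^ d * INR K * Q * (INR S / Q - INR T / Q) = 2 ^ d * (INR K * (INR S - INR T)).
  by field; lra.
by move: hle; rewrite /=.
Qed.

End RealLimits.

Theorem mainTheorem1 (A : comNzRingType) (p : nat) (m : A -> Prop) (d : nat) :
  (p \in GRing.pchar A) ->
  noetherian A ->
  local_with_max m ->
  krull_dim_eq A d ->
  (compl_nil_dim_lt m d <->
   forall (I : nat -> (A -> Prop)),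
     p_family p I ->
     (forall e, m_primary m (I e)) ->
     forall len : nat -> nat,
       (forall e, colength_eq (I e) (len e)) ->
       exists L : Rdefinitions.R,
         Un_cv (fun e => Rdefinitions.Rdiv (INR (len e)) (INR ((p ^ e) ^ d)%N)) L).
Proof.
move=> pA noethA hL [_ dimA].
have pgt1 : leq 2 p := prime_gt1 (pcharf_prime pA).
have [B [iota [lim [limD limM lim_cst lim_eq0 lim_surj]]]] := completion_exists hL.
split=> [hnil I hfam hprim len hlen|hlim].
  have [xs [C [N0 [N0pos hxs hle hge]]]] :=
    p_family_recurrence pA noethA hL dimA limD limM lim_cst lim_eq0 lim_surj hnil hfam hprim.
  have elen e : colen (I e) = len e.
    by have /colength_eqP := hlen e; case=> //; case: hfam => h _; apply: h.
  apply: (perturbed_cv pgt1 N0pos (y := fun e => sumn [seq x e | x <- xs]) (C := C)).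
  - by apply: sumn_cv => x hx; apply: (recurrence_cv pgt1 N0pos (C := C)); apply: hxs.
  - by move=> e; rewrite -elen; apply: hle.
  - by move=> e; rewrite -elen; apply: hge.
apply/(compl_nil_dim_ltE d hL limD limM lim_cst lim_eq0 lim_surj) => -[P [hP hann]].
have hP0 : is_prime (P 0%nat) by case: hP => h _; apply: h.
have [w [w2 hw]] :=
  nilpotent_witness pA noethA hL limD limM lim_cst lim_eq0 lim_surj hP0 hann.
have [K [c hgap]] := twisted_colen_gap p noethA hL limD limM lim_cst lim_eq0 lim_surj hP hw.
have hcv b := hlim _ (twisted_p_family pA noethA hL limD limM lim_cst lim_eq0 lim_surj w2 b)
  (twisted_m_primary pA noethA hL limD limM lim_cst lim_eq0 lim_surj w2 b)
  (fun e => colen (if b e then addm (pid w) (closed_pow m lim (expn p e)) else closed_pow m lim (expn p e)))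
  (fun e => let: conj h1 h2 := twisted_colen p noethA hL limD limM lim_cst lim_eq0 lim_surj w b e in
    proj2 (colength_eqP _ h1) h2).
(* The first family is [m^q] throughout, the second adds [w] at odd exponents. Their normalized
   colengths agree at even exponents and differ by a fixed amount at large odd ones, so both cannot
   converge. *)
have [L hL0] := hcv (fun=> false); have [L' hL1] := hcv odd.
have K1 : leq 1 K.
  have := hgap c.+1; rewrite lt0n; case: (K) => // h.
  have hc : leq c.+1 (expn p c.+1) by apply/ltnW/ltn_expl.
  by move: (h hc); rewrite mul0n leqn0 expn_eq0 subn_eq0 leqNgt hc.
have hK0 : Rlt 0 (Rinv (2 ^ d * INR K)).
  apply/Rinv_0_lt_compat/Rmult_lt_0_compat; first by apply: pow_lt; lra.
  by apply/lt_0_INR/ltP.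
apply: (alternating_gap_cv (e0 := (2 * c).+1) hK0 hL0 hL1) => e; first by move/negPf->.
move=> he ->; have hce : leq (2 * c).+1 (expn p e).
  by apply: leq_trans he _; apply/ltnW/ltn_expl.
apply: (normalized_gap pgt1 hce); apply: hgap; apply: leq_trans hce; lia.
Qed.
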